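(* Let $\mathbf{M}$ be a weight sequence such that $1<\gamma(\mathbf{M})<\infty$ and $\sup_{k\in\mathbb{N}}\sqrt[k]{M_k/M_{k-1}}<\infty$. Let $\Omega\subseteq\mathbb{R}^n$ be open and let $P$ be a non-elliptic linear differential operator of order $d\ge1$ with coefficients in $\mathcal{E}^{\{\mathbf{M}^\rho\}}(\Omega)$ for some $\rho$ with $1<1/\rho<\gamma(\mathbf{M})$. Then there are a smooth function $u\in\mathcal{E}(\Omega)$ and some $\nu>1$ such that $$u\in\mathcal{E}^{(\mathbf{M})}(\Omega;P)\setminus\mathcal{E}^{\{\mathbf{M}\}}(\Omega)$$ and $u$ is an optimal function of the class $\mathcal{E}^{\{\mathbf{M}^\nu\}}(\Omega)$.
   Context: $\mathbb{N}=\{1,2,\dots\}$. A weight sequence is a sequence $\mathbf{M}=(M_k)_{k\in\mathbb{N}_0}$ of positive numbers with $M_0=1\le M_1$ such that $\mu_k=M_k/M_{k-1}$ ($k\ge1$) is increasing and $\mu_k\to\infty$. For $\tau>0$, $\mathbf{M}^\tau=((M_k)^\tau)_k$. Index: $\gamma(\mathbf{M})=\sup\{\gamma>0: (\mu_k/k^\gamma)_{k\ge1}\text{ is almost increasing}\}\in[0,\infty]$ (with $\sup\emptyset=0$), where $(L_k)_k$ is almost increasing if there is $C>0$ with $L_j\le CL_k$ for all $j\le k$. $\mathbf{T}\preceq\mathbf{N}$ means there are $C,h>0$ with $T_k\le Ch^kN_k$ for all $k\in\mathbb{N}_0$; $\mathbf{T}\precnapprox\mathbf{N}$ means $\mathbf{T}\preceq\mathbf{N}$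 but not $\mathbf{N}\preceq\mathbf{T}$. $\mathcal{E}(\Omega)$: smooth functions on $\Omega$. $\mathcal{E}^{\{\mathbf{M}\}}(\Omega)$: the $f\in\mathcal{E}(\Omega)$ such that for every compact $K\subset\Omega$ there are $C,h>0$ with $\sup_{x\in K}|D^\alpha f(x)|\le Ch^{|\alpha|}M_{|\alpha|}$ for all $\alpha\in\mathbb{N}_0^n$. A function $g\in\mathcal{E}(\Omega)$ is an optimal function of $\mathcal{E}^{\{\mathbf{N}\}}(\Omega)$ if $g\in\mathcal{E}^{\{\mathbf{N}\}}(\Omega)$ but $g\notin\mathcal{E}^{\{\mathbf{T}\}}(\Omega)$ for every weight sequence $\mathbf{T}\precnapprox\mathbf{N}$. For $P$ of order $d$, $\mathcal{E}^{(\mathbf{M})}(\Omega;P)$ is the set of distributions $u\in\mathcal{D}'(\Omega)$ with $P^ku\in L^2_{loc}(\Omega)$ for all $k\in\mathbb{N}_0$ ($P^0=\mathrm{Id}$) such that for all compact $K\subset\Omega$ and all $h>0$ there is $C>0$ with $\|P^ku\|_{L^2(K)}\le Ch^kM_{dk}$ for all $k\in\mathbb{N}_0$. $P=\sum_{|\alpha|\le d}p_\alpha(x)D^\alpha$ is elliptic in $\Omega$ if $p_d(x,\xi)=\sum_{|\alpha|=d}p_\alpha(x)\xi^\alpha\ne0$ for all $x\in\Omega$, $\xi\in\mathbb{R}^n\setminus\{0\}$; otherwise it is non-elliptic. *)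

(* Defs.v *)
From HB Require Import structures.
From mathcomp Require Import all_boot all_order all_algebra.
From mathcomp Require Import all_classical all_reals all_analysis.
From mathcomp Require Import complex.

Set Implicit Arguments.
Unset Strict Implicit.
Unset Printing Implicit Defensive.

Import Order.TTheory GRing.Theory Num.Theory.
Import numFieldNormedType.Exports.

Local Open Scope classical_set_scope.
Local Open Scope ring_scope.

Definition rV_coord (R : realType) n (i : 'I_n) (x : 'rV[R]_n) :
  measurableTypeR R := x ord0 i.

Section rV_measurable.
Variables (R : realType) (n : nat).

Let rV_set0 : g_sigma_preimage (@rV_coord R n) set0.
Proof. exact: sigma_algebra0. Qed.

Let rV_setC A : g_sigma_preimage (@rV_coord R n) A ->
  g_sigma_preimage (@rV_coord R n) (~` A).
Proof. exact: sigma_algebraC. Qed.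

Let rV_bigcup (F : (set 'rV[R]_n)^nat) :
  (forall i, g_sigma_preimage (@rV_coord R n) (F i)) ->
  g_sigma_preimage (@rV_coord R n) (\bigcup_i (F i)).
Proof. exact: sigma_algebra_bigcup. Qed.

(* The sigma-algebra generated by the coordinates is the Borel one. *)
HB.instance Definition _ := @isMeasurable.Build default_measure_display
  'rV[R]_n (g_sigma_preimage (@rV_coord R n)) rV_set0 rV_setC rV_bigcup.

Lemma measurable_rV_coord i : measurable_fun [set: 'rV[R]_n] (@rV_coord R n i).
Proof.
move=> _ Y mY; rewrite setTI; apply: sub_sigma_algebra => /=.
rewrite -bigcup_seq/=; exists i => /=; first by rewrite mem_index_enum.
by exists Y => //; rewrite setTI.
Qed.

Lemma measurable_fun_rVP d (T : measurableType d) (f : T -> 'rV[R]_n) :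
  (forall i, measurable_fun [set: T] (@rV_coord R n i \o f)) ->
  measurable_fun [set: T] f.
Proof.
move=> mf; have H : g_sigma_preimage (fun i => @rV_coord R n i \o f) `<=` measurable.
  apply: smallest_sub; first exact: sigma_algebra_measurable.
  move=> A; rewrite -bigcup_seq => -[i _] [B mB <-]; exact: mf.
by rewrite g_sigma_preimage_comp in H; move=> _ A mA; apply: H; exists A.
Qed.

End rV_measurable.

Section cons_measure.
Local Open Scope ereal_scope.
Variables (R : realType) (n : nat).
Variable mu : {sigma_finite_measure set 'rV[R]_n -> \bar R}.

Definition rV_cons (x : measurableTypeR R * 'rV[R]_n) : 'rV[R]_n.+1 :=
  \row_i oapp (x.2 ord0) x.1 (unlift ord0 i).

Definition rV_uncons (v : 'rV[R]_n.+1) : measurableTypeR R * 'rV[R]_n :=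
  (v ord0 ord0, \row_i v ord0 (lift ord0 i)).

Lemma rV_consK : cancel rV_cons rV_uncons.
Proof.
move=> [x v]; rewrite /rV_uncons mxE unlift_none; congr pair.
by apply/rowP => i; rewrite !mxE liftK.
Qed.

Lemma measurable_rV_cons : measurable_fun setT rV_cons.
Proof.
apply: measurable_fun_rVP => i.
rewrite (_ : _ \o _ = fun x => oapp (fun j => rV_coord j x.2) x.1 (unlift ord0 i)).
  case: unliftP => [j _|_] /=; last exact: measurable_fst.
  by apply: (measurableT_comp (@measurable_rV_coord R n j)).
by apply/funext => x; rewrite /rV_coord /= mxE.
Qed.

Lemma measurable_rV_uncons : measurable_fun setT rV_uncons.
Proof.
apply/measurable_fun_pair; first exact: (@measurable_rV_coord R n.+1 ord0).
apply: measurable_fun_rVP => i.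
rewrite (_ : _ \o _ = rV_coord (lift ord0 i)); first exact: measurable_rV_coord.
by apply/funext => v; rewrite /rV_coord /= mxE.
Qed.

Definition cons_measure : set 'rV[R]_n.+1 -> \bar R :=
  pushforward (@lebesgue_measure R \x mu) rV_cons.

Let pushm := @measure_function_pushforward__canonical__measure_function_Measure
  _ _ _ _ R (@lebesgue_measure R \x mu) _ measurable_rV_cons.

HB.instance Definition _ := Measure.copy cons_measure pushm.

Let cons_measure_sigma_finite : sigma_finite setT cons_measure.
Proof.
have /sigma_finiteP[F [TF ndF Foo]] := sigma_finiteT (@lebesgue_measure R).
have /sigma_finiteP[G [TG ndG Goo]] := sigma_finiteT mu.
exists (fun k => rV_uncons @^-1` (F k `*` G k)).
  apply/seteqP; split => // v _.
  have : (\bigcup_k F k) (rV_uncons v).1 by rewrite -TF.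
  have : (\bigcup_k G k) (rV_uncons v).2 by rewrite -TG.
  move=> [k _ Gk] [l _ Fl]; exists (maxn k l) => //; split.
    by move: Fl; exact/subsetPset/ndF/leq_maxr.
  by move: Gk; exact/subsetPset/ndG/leq_maxl.
move=> k; have [mF Fk] := Foo k; have [mG Gk] := Goo k; split.
  rewrite -[X in measurable X]setTI; apply: measurable_rV_uncons => //.
  exact: measurableX.
rewrite /cons_measure /pushforward -comp_preimage.
rewrite (_ : _ \o _ = id) ?preimage_id/=; last first.
  by apply/funext => x; rewrite /= rV_consK.
by rewrite product_measure1E// lte_mul_pinfty// ge0_fin_numE.
Qed.

HB.instance Definition _ := Measure_isSigmaFinite.Build _ _ _ cons_measure
  cons_measure_sigma_finite.

End cons_measure.

Fixpoint lebesgue_rV (R : realType) (n : nat) :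
    {sigma_finite_measure set 'rV[R]_n -> \bar R} :=
  match n with
  | 0 => \d_ (0 : 'rV[R]_0)
  | n'.+1 => cons_measure (lebesgue_rV R n')
  end.

Section weight_sequences.
Variable R : realType.
Implicit Types M N T : nat -> R.

(* Meant for k >= 1 only; [quot M 0] is never used. *)
Definition quot M (k : nat) : R := M k / M k.-1.

Definition weight_sequence M :=
  [/\ forall k, 0 < M k,
      M 0%N = 1,
      1 <= M 1%N,
      forall j k, (1 <= j <= k)%N -> quot M j <= quot M k
    & quot M k @[k --> \oo] --> +oo].

Definition wpow M (t : R) : nat -> R := fun k => M k `^ t.

Definition almost_increasing (L : nat -> R) :=
  exists2 C : R, 0 < C & forall j k, (1 <= j <= k)%N -> L j <= C * L k.

(* [maxe 0] implements the convention that the supremum of the empty set is 0. *)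
Definition gamma_index M : \bar R :=
  maxe 0%E (ereal_sup [set g%:E | g in
    [set g : R | 0 < g /\ almost_increasing (fun k => quot M k / k%:R `^ g)]]).

Definition wle M N :=
  exists C h : R, [/\ 0 < C, 0 < h & forall k, M k <= C * h ^+ k * N k].

Definition wlt M N := wle M N /\ ~ wle N M.

End weight_sequences.

Section smooth_functions.
Variables (R : realType) (n : nat).
Implicit Types (f g phi : 'rV[R]_n -> R[i]) (K Omega : set 'rV[R]_n).

Definition partial (i : 'I_n) f : 'rV[R]_n -> R[i] := fun x =>
  ('D_(delta_mx ord0 i) (fun y => complex.Re (f y)) x +i*
   'D_(delta_mx ord0 i) (fun y => complex.Im (f y)) x)%C.

(* Functions are total on R^n; only their values on the open set [Omega]
   matter, and there all iterated partial derivatives must exist and be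
   continuous. *)
Definition smooth Omega f := forall (s : seq 'I_n) x, Omega x ->
  let g := foldr partial f s in
  [/\ {for x, continuous (fun y => complex.Re (g y))},
      {for x, continuous (fun y => complex.Im (g y))}
    & forall i : 'I_n,
        derivable (fun y => complex.Re (g y)) x (delta_mx ord0 i) /\
        derivable (fun y => complex.Im (g y)) x (delta_mx ord0 i)].

(* The convention is D_j = -i d/dx_j. *)
Definition Dj (i : 'I_n) f : 'rV[R]_n -> R[i] :=
  fun x => - 'i%C * partial i f x.

Definition mlen (a : 'I_n -> nat) : nat := (\sum_i a i)%N.

Definition Dmulti (a : 'I_n -> nat) f : 'rV[R]_n -> R[i] :=
  foldr (fun i g => iter (a i) (Dj i) g) f (enum 'I_n).

Definition roumieu Omega (M : nat -> R) f :=
  smooth Omega f /\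
  forall K, compact K -> K `<=` Omega ->
    exists C h : R, [/\ 0 < C, 0 < h &
      forall (a : 'I_n -> nat) x, K x ->
        Normc.normc (Dmulti a f x) <= C * h ^+ mlen a * M (mlen a)].

Definition optimal_function Omega (N : nat -> R) g :=
  [/\ smooth Omega g, roumieu Omega N g &
      forall T, weight_sequence T -> wlt T N -> ~ roumieu Omega T g].

End smooth_functions.

Section distributions.
Variables (R : realType) (n : nat).
Implicit Types (f phi psi : 'rV[R]_n -> R[i]) (K Omega : set 'rV[R]_n).
Implicit Types T : ('rV[R]_n -> R[i]) -> R[i].

Definition test_on K phi := smooth setT phi /\ forall x, ~ K x -> phi x = 0.

Definition test_function Omega phi :=
  exists K, [/\ compact K, K `<=` Omega & test_on K phi].

(* Functionals are total; only their values on test functions matter. *)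
Definition distribution Omega T :=
  (forall (c : R[i]) phi psi,
     test_function Omega phi -> test_function Omega psi ->
     T (fun x => c * phi x + psi x) = c * T phi + T psi) /\
  (forall K, compact K -> K `<=` Omega ->
     exists (C : R) (m : nat), forall phi (B : R), test_on K phi ->
       (forall a x, (mlen a <= m)%N -> Normc.normc (Dmulti a phi x) <= B) ->
       Normc.normc (T phi) <= C * B).

Definition cintegral Omega f : R[i] :=
  (Rintegral (lebesgue_rV R n) Omega (fun x => complex.Re (f x)) +i*
   Rintegral (lebesgue_rV R n) Omega (fun x => complex.Im (f x)))%C.

Definition distribution_of Omega f : ('rV[R]_n -> R[i]) -> R[i] :=
  fun phi => cintegral Omega (fun x => f x * phi x).

Definition L2norm K f : \bar R :=
  'N[lebesgue_rV R n]_2%:E[(fun x => (Normc.normc (f x))%:E) \_ K]%E.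

Definition L2loc Omega f :=
  [/\ measurable_fun Omega (fun x => complex.Re (f x)),
      measurable_fun Omega (fun x => complex.Im (f x))
    & forall K, compact K -> K `<=` Omega -> (L2norm K f < +oo)%E].

Definition Dmulti_distr (a : 'I_n -> nat) T : ('rV[R]_n -> R[i]) -> R[i] :=
  fun phi => (-1) ^+ mlen a * T (Dmulti a phi).

Definition mul_distr f T : ('rV[R]_n -> R[i]) -> R[i] :=
  fun phi => T (fun x => f x * phi x).

End distributions.

Section differential_operators.
Variables (R : realType) (n d : nat).

(* Coefficients of sum_(|a| <= d) p_a D^a: every multi-index of length at most
   d has its entries in 'I_d.+1. The values at indices of length greater than d
   are never used. *)
Definition diffop := {ffun 'I_n -> 'I_d.+1} -> 'rV[R]_n -> R[i].

Implicit Types (P : diffop) (Omega : set 'rV[R]_n).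

Definition mnat (a : {ffun 'I_n -> 'I_d.+1}) : 'I_n -> nat := fun i => a i.

Definition of_order Omega P :=
  exists a x, [/\ mlen (mnat a) = d, Omega x & P a x != 0].

Definition coefficients_in (E : set ('rV[R]_n -> R[i])) P :=
  forall a, (mlen (mnat a) <= d)%N -> E (P a).

Definition principal_symbol P (x xi : 'rV[R]_n) : R[i] :=
  \sum_(a : {ffun 'I_n -> 'I_d.+1} | mlen (mnat a) == d)
    P a x * \prod_i (xi ord0 i)%:C%C ^+ mnat a i.

Definition elliptic Omega P :=
  forall x xi, Omega x -> xi != 0 -> principal_symbol P x xi != 0.

Definition diffop_distr P (T : ('rV[R]_n -> R[i]) -> R[i]) :
    ('rV[R]_n -> R[i]) -> R[i] := fun phi =>
  \sum_(a : {ffun 'I_n -> 'I_d.+1} | (mlen (mnat a) <= d)%N)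
    mul_distr (P a) (Dmulti_distr (mnat a) T) phi.

(* The class E^(M)(Omega; P), of distributions [T]; [f k] is the locally square
   integrable function representing P^k T, unique almost everywhere. *)
Definition beurling_vectors Omega (M : nat -> R) P
    (T : ('rV[R]_n -> R[i]) -> R[i]) :=
  distribution Omega T /\
  exists f : nat -> 'rV[R]_n -> R[i],
    (forall k, L2loc Omega (f k) /\
       forall phi, test_function Omega phi ->
         iter k (diffop_distr P) T phi = distribution_of Omega (f k) phi) /\
    (forall K, compact K -> K `<=` Omega -> forall h : R, 0 < h ->
       exists2 C : R, 0 < C &
         forall k, (L2norm K (f k) <= (C * h ^+ k * M (d * k)%N)%:E)%E).

End differential_operators.

(* Main.v *)
(* Let the principal symbol [p_d] vanish at [(x0, xi)]. The wave packet
   [v_t = exp(i t <x - x0, xi>) phi_t], where [phi_t] is a Gevrey cutoff equal to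
   [1] near [x0] and supported in a cube of size [t^-eps], is almost annihilated by
   [P]: conjugation by the wave turns [P] into an operator whose leading part
   [t^d p_d(x, xi)] is [O(t^(d - eps))] on the cube, and a derivative falling on
   [phi_t] costs at most [t^(1 - eps)] instead of [t]. So [P^k v_t] is essentially
   [O(t^((d - eps) k))], while a derivative of order [m] of [v_t] at [x0] has size
   [t^m].

   Put [t_j = mu_(j+1)^nu] and [c_j = M_(j+1)^nu / t_j^(j+1)]; by log-convexity [c_j]
   is the minimum of [M_N^nu / t_j^N] over [N]. In [u = sum_j 2^-(j+1) c_j v_(t_j)] the
   bound [c_j t_j^m <= M_m^nu] is attained at [j = m - 1], and all terms have the same
   phase at [x0], which makes [u] optimal for [M^nu]. Interpolation gives
   [c_j t_j^((d - eps) k) <= M_(dk)^(nu (1 - eps / d))], and [nu > 1] is chosen with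
   [nu (1 - eps / d) < 1], so that [P^k u] is [O(h^k M_(dk))] for every [h > 0]. *)

Require Import Defs.
From HB Require Import structures.
From mathcomp Require Import all_boot all_order all_algebra.
From mathcomp Require Import all_classical all_reals all_analysis.
From mathcomp Require Import measurable_realfun complex.
From mathcomp Require Import ring lra zify.

Set Implicit Arguments.
Unset Strict Implicit.
Unset Printing Implicit Defensive.

Import Order.TTheory GRing.Theory Num.Theory.
Import numFieldNormedType.Exports.

Local Open Scope classical_set_scope.
Local Open Scope ring_scope.

(** * Smooth functions and words of derivatives *)

(** The obstacle is that [P^k] differentiates cutoff and coefficients up to [d k] times, while the
    final constant may only grow like [A^k]. A bound by [W_m = M_m^rho] alone does not iterate,
    since every derivative shifts [m]. The sums [Wsum] therefore keep spent derivatives as separate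
    terms [lam^j W_(j + m)]: one more derivative costs [tau / lam] and admits one more [j]. With
    [tau] of order [t^eps], the scale of the cutoff, [lam = t^-rho] and [eps = (1 - rho) / 2], this
    price is of order [t^(1 - eps)], which matches the gain of the symbol on the small cube. The
    remaining factors [t^(-rho i) M_i^rho], [i <= d k], are absorbed at the end by the minimality of
    [c_j], because [nu >= 1].

    The hypothesis [1 / rho < gamma(M)] makes [mu_k^rho / k^s] almost increasing for some [s > 1].
    The power [1] inside [s] pays for the binomial coefficients in the shifted Leibniz sums; the
    excess [s - 1] makes room for compactly supported Gevrey functions of order [1 + 1/p <= s]. *)

Notation dw f s := (foldr (@partial _ _) f s).

(** Pascal's rule. With [F] and [G] abstract it serves both for bounds on words ([words_M_le]) and
    for one-variable jets ([jet_mulP]). *)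
Lemma leibniz_sum (K : comNzRingType) (F G : nat -> K) m :
  \sum_(j < m.+1) 'C(m, j)%:R * (F j.+1 * G (m - j)%N) +
  \sum_(j < m.+1) 'C(m, j)%:R * (F j * G (m - j)%N.+1) =
  \sum_(j < m.+2) 'C(m.+1, j)%:R * (F j * G (m.+1 - j)%N).
Proof.
rewrite [in RHS]big_ord_recl /= !bin0 subn0.
under [in RHS]eq_bigr do rewrite /bump/= add1n binS natrD mulrDl subSS.
rewrite [in RHS]big_split/= [in RHS]big_ord_recr/= bin_small// mul0r addr0.
rewrite [X in _ + X = _]big_ord_recl /= bin0 subn0 addrCA; congr (_ + _).
rewrite addrC; congr (_ + _); apply: eq_bigr => j _; rewrite /bump/= add1n subnSK//.
Qed.

Lemma near_eq_continuous (T U : topologicalType) (f g : T -> U) x :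
  (\near x, f x = g x) -> {for x, continuous f} -> {for x, continuous g}.
Proof.
move=> fg cf; have e := nbhs_singleton fg.
suff : g @ x --> g x by [].
by rewrite -e; apply: cvg_trans cf; apply: near_eq_cvg; apply: filterS fg.
Qed.

(* The library rules in pointwise form and over an abstract space, which keeps unification away from the matrix structures. *)
Section pointwise_rules.
Variables (R : realType) (V : normedModType R).
Implicit Types (F G : V -> R) (x v : V).

Lemma derivable_addf F G x v : derivable F x v -> derivable G x v ->
  derivable (fun y => F y + G y) x v.
Proof. exact: derivableD. Qed.

Lemma derive_addf F G x v : derivable F x v -> derivable G x v ->
  'D_v (fun y => F y + G y) x = 'D_v F x + 'D_v G x.
Proof. exact: deriveD. Qed.

Lemma derivable_subf F G x v : derivable F x v -> derivable G x v ->
  derivable (fun y => F y - G y) x v.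
Proof. exact: derivableB. Qed.

Lemma derive_subf F G x v : derivable F x v -> derivable G x v ->
  'D_v (fun y => F y - G y) x = 'D_v F x - 'D_v G x.
Proof. exact: deriveB. Qed.

Lemma derivable_mulf F G x v : derivable F x v -> derivable G x v ->
  derivable (fun y => F y * G y) x v.
Proof. exact: derivableM. Qed.

Lemma derive_mulf F G x v : derivable F x v -> derivable G x v ->
  'D_v (fun y => F y * G y) x = F x * 'D_v G x + G x * 'D_v F x.
Proof. exact: deriveM. Qed.

Lemma derive_cstf (c : R) x v : 'D_v (fun=> c) x = 0.
Proof. exact: derive_cst. Qed.

Lemma continuous_addf F G x : {for x, continuous F} -> {for x, continuous G} ->
  {for x, continuous (fun y => F y + G y)}.
Proof. exact: continuousD. Qed.

Lemma continuous_subf F G x : {for x, continuous F} -> {for x, continuous G} ->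
  {for x, continuous (fun y => F y - G y)}.
Proof. exact: continuousB. Qed.

Lemma continuous_mulf F G x : {for x, continuous F} -> {for x, continuous G} ->
  {for x, continuous (fun y => F y * G y)}.
Proof. exact: continuousM. Qed.

Lemma continuous_cstf (c : R) x : {for x, continuous (fun _ : V => c)}.
Proof. exact: cst_continuous. Qed.

End pointwise_rules.

Section calculus.
Variables (R : realType) (n : nat).
Implicit Types (f g h : 'rV[R]_n -> R[i]) (U : set 'rV[R]_n) (x : 'rV[R]_n).
Implicit Types (s : seq 'I_n) (i : 'I_n).

(** What [smooth] asks of one iterated derivative at one point. *)
Definition C1at f x :=
  [/\ {for x, continuous (fun y => complex.Re (f y))},
      {for x, continuous (fun y => complex.Im (f y))}
    & forall i : 'I_n,
        derivable (fun y => complex.Re (f y)) x (delta_mx ord0 i) /\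
        derivable (fun y => complex.Im (f y)) x (delta_mx ord0 i)].

Lemma near_eq_partial i f g x : (\near x, f x = g x) ->
  partial i f x = partial i g x.
Proof.
move=> fg; rewrite /partial; congr (_ +i* _)%C; apply: near_eq_derive;
  by apply: filterS fg => y ->.
Qed.

Lemma near_eq_C1at f g x : (\near x, f x = g x) -> C1at f x -> C1at g x.
Proof.
move=> fg [cR cI df].
have fgR : {near x, (fun y => complex.Re (f y)) =1 (fun y => complex.Re (g y))}.
  by apply: filterS fg => y ->.
have fgI : {near x, (fun y => complex.Im (f y)) =1 (fun y => complex.Im (g y))}.
  by apply: filterS fg => y ->.
split.
- exact: near_eq_continuous fgR cR.
- exact: near_eq_continuous fgI cI.
- move=> i; have [dR dI] := df i.
  by split; [exact: near_eq_derivable fgR dR|exact: near_eq_derivable fgI dI].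
Qed.

(** Functions are total, so identities between derivatives are only available where smoothness is
    known; on an open set they may be differentiated again. *)
Definition eq_on U f g := forall x, U x -> f x = g x.

Lemma eq_on_near U f g x : open U -> U x -> eq_on U f g -> \near x, f x = g x.
Proof.
move=> oU Ux fg; apply: filterS (open_nbhs_nbhs (conj oU Ux)); exact: fg.
Qed.

Lemma eq_on_words U f g s : open U -> eq_on U f g ->
  eq_on U (dw f s) (dw g s).
Proof.
move=> oU; elim: s => //= i s IH fg x Ux; apply: near_eq_partial.
exact: eq_on_near Ux (IH fg).
Qed.

Lemma foldr_partial_cat f s t :
  dw f (s ++ t) = dw (dw f t) s.
Proof. exact: foldr_cat. Qed.

Lemma foldr_partial_rcons f s i :
  dw f (rcons s i) = dw (partial i f) s.
Proof. by rewrite -cats1 foldr_cat. Qed.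

Lemma smooth_C1at U f x : smooth U f -> U x -> C1at f x.
Proof. by move=> sf Ux; exact: (sf [::]). Qed.

Lemma smooth_words U f s : smooth U f -> smooth U (dw f s).
Proof. by move=> sf t x Ux; rewrite -foldr_partial_cat; exact: sf. Qed.

Lemma smooth_partial U f i : smooth U f -> smooth U (partial i f).
Proof. exact: (@smooth_words U f [:: i]). Qed.

Lemma smooth_sub U V f : V `<=` U -> smooth U f -> smooth V f.
Proof. by move=> VU sf s x /VU; exact: sf. Qed.

(* Smoothness is a greatest fixed point. *)
Lemma smooth_coind U (S : ('rV[R]_n -> R[i]) -> Prop) f : open U ->
  (forall g, S g -> (forall x, U x -> C1at g x) /\
     forall i, exists2 h, S h & eq_on U (partial i g) h) ->
  S f -> smooth U f.
Proof.
move=> oU HS Sf s; elim/last_ind: s f Sf => [|s i IH] f Sf x Ux.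
  exact: (HS _ Sf).1.
have [_ /(_ i)[h Sh fh]] := HS _ Sf; rewrite foldr_partial_rcons.
have := IH _ Sh _ Ux; apply: near_eq_C1at.
by apply: eq_on_near Ux _ => // y Uy; rewrite (eq_on_words s oU fh).
Qed.

Lemma normc_ge0 (a : R[i]) : 0 <= Normc.normc a.
Proof. by case: a => u v; exact: sqrtr_ge0. Qed.

Lemma cReD (a b : R[i]) : complex.Re (a + b) = complex.Re a + complex.Re b.
Proof. by case: a b => ? ? []. Qed.
Lemma cImD (a b : R[i]) : complex.Im (a + b) = complex.Im a + complex.Im b.
Proof. by case: a b => ? ? []. Qed.
Lemma cReM (a b : R[i]) : complex.Re (a * b) =
  complex.Re a * complex.Re b - complex.Im a * complex.Im b.
Proof. by case: a b => ? ? []. Qed.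
Lemma cImM (a b : R[i]) : complex.Im (a * b) =
  complex.Re a * complex.Im b + complex.Im a * complex.Re b.
Proof. by case: a b => ? ? []. Qed.

Lemma cReDf f g : (fun y => complex.Re (f y + g y)) =
  (fun y => complex.Re (f y) + complex.Re (g y)).
Proof. by apply/funext => y; rewrite cReD. Qed.
Lemma cImDf f g : (fun y => complex.Im (f y + g y)) =
  (fun y => complex.Im (f y) + complex.Im (g y)).
Proof. by apply/funext => y; rewrite cImD. Qed.
Lemma cReMf f g : (fun y => complex.Re (f y * g y)) = (fun y =>
  complex.Re (f y) * complex.Re (g y) - complex.Im (f y) * complex.Im (g y)).
Proof. by apply/funext => y; rewrite cReM. Qed.
Lemma cImMf f g : (fun y => complex.Im (f y * g y)) = (fun y =>
  complex.Re (f y) * complex.Im (g y) + complex.Im (f y) * complex.Re (g y)).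
Proof. by apply/funext => y; rewrite cImM. Qed.

Lemma C1atD f g x : C1at f x -> C1at g x -> C1at (fun y => f y + g y) x.
Proof.
move=> [fR fI df] [gR gI dg]; split.
- by rewrite cReDf; exact: continuous_addf.
- by rewrite cImDf; exact: continuous_addf.
- move=> i; have [a b] := df i; have [c d] := dg i.
  by rewrite cReDf cImDf; split; exact: derivable_addf.
Qed.

Lemma C1atM f g x : C1at f x -> C1at g x -> C1at (fun y => f y * g y) x.
Proof.
move=> [fR fI df] [gR gI dg]; split.
- by rewrite cReMf; apply: continuous_subf; exact: continuous_mulf.
- by rewrite cImMf; apply: continuous_addf; exact: continuous_mulf.
- move=> i; have [a b] := df i; have [c d] := dg i.
  rewrite cReMf cImMf; split.
    by apply: derivable_subf; exact: derivable_mulf.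
  by apply: derivable_addf; exact: derivable_mulf.
Qed.

Lemma partialD i f g x : C1at f x -> C1at g x ->
  partial i (fun y => f y + g y) x = partial i f x + partial i g x.
Proof.
move=> [_ _ /(_ i)[a b]] [_ _ /(_ i)[c d]].
by rewrite /partial cReDf cImDf !derive_addf.
Qed.

Lemma partialM i f g x : C1at f x -> C1at g x ->
  partial i (fun y => f y * g y) x = partial i f x * g x + f x * partial i g x.
Proof.
move=> [_ _ /(_ i)[a b]] [_ _ /(_ i)[c d]].
rewrite /partial cReMf cImMf.
rewrite derive_subf; [|exact: derivable_mulf|exact: derivable_mulf].
rewrite derive_addf; [|exact: derivable_mulf|exact: derivable_mulf].
rewrite !derive_mulf//; case: (f x) (g x) => fR fI [gR gI].
set A := 'D_ _ _ _; set B := 'D_ _ _ _; set C := 'D_ _ _ _; set D := 'D_ _ _ _.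
apply/eqP; rewrite eq_complex; apply/andP; split; apply/eqP;
  rewrite ?cReD ?cImD ?cReM ?cImM /=; ring.
Qed.

Lemma C1at_cst (c : R[i]) x : C1at (fun=> c) x.
Proof.
split; [exact: continuous_cstf|exact: continuous_cstf|].
by move=> i; split; exact: derivable_cst.
Qed.

Lemma partial_cst i (c : R[i]) : partial i (fun _ : 'rV[R]_n => c) = (fun=> 0).
Proof. by apply/funext => x; rewrite /partial !derive_cstf. Qed.

Lemma smooth_cst U (c : R[i]) : open U -> smooth U (fun=> c).
Proof.
move=> oU; apply: (@smooth_coind U (fun g => exists c, g = fun=> c)) => //.
- move=> _ [{}c ->]; split => [x _|i]; first exact: C1at_cst.
  by exists (fun=> 0); [exists 0|rewrite partial_cst].
- by exists c.
Qed.

Section algebra.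
Variable U : set 'rV[R]_n.
Hypothesis oU : open U.

(** Products alone are not stable under [partial]; closing under sums and products together gives a
    class to which [smooth_coind] applies. *)
Inductive smooth_alg : ('rV[R]_n -> R[i]) -> Prop :=
| alg_smooth f : smooth U f -> smooth_alg f
| algD f g : smooth_alg f -> smooth_alg g -> smooth_alg (fun x => f x + g x)
| algM f g : smooth_alg f -> smooth_alg g -> smooth_alg (fun x => f x * g x).

Lemma smooth_alg_smooth f : smooth_alg f -> smooth U f.
Proof.
apply: smooth_coind => // {}g; elim=> {g}.
- move=> g sg; split=> [x|i]; first exact: smooth_C1at.
  by exists (partial i g) => //; apply/alg_smooth/smooth_partial.
- move=> f1 f2 a1 [c1 p1] a2 [c2 p2]; split=> [x Ux|i].
    by apply: C1atD; [exact: c1|exact: c2].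
  have [h1 ah1 e1] := p1 i; have [h2 ah2 e2] := p2 i.
  exists (fun x => h1 x + h2 x); first exact: algD.
  by move=> x Ux; rewrite partialD ?e1 ?e2//; [exact: c1|exact: c2].
- move=> f1 f2 a1 [c1 p1] a2 [c2 p2]; split=> [x Ux|i].
    by apply: C1atM; [exact: c1|exact: c2].
  have [h1 ah1 e1] := p1 i; have [h2 ah2 e2] := p2 i.
  exists (fun x => h1 x * f2 x + f1 x * h2 x).
    by apply: algD; apply: algM.
  by move=> x Ux; rewrite partialM ?e1 ?e2//; [exact: c1|exact: c2].
Qed.

Lemma smoothD f g : smooth U f -> smooth U g -> smooth U (fun x => f x + g x).
Proof. by move=> *; apply: smooth_alg_smooth; apply: algD; apply: alg_smooth. Qed.

Lemma smoothM f g : smooth U f -> smooth U g -> smooth U (fun x => f x * g x).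
Proof. by move=> *; apply: smooth_alg_smooth; apply: algM; apply: alg_smooth. Qed.

Lemma smoothZ (c : R[i]) f : smooth U f -> smooth U (fun x => c * f x).
Proof. by move=> sf; exact: smoothM (smooth_cst c oU) sf. Qed.

Lemma smooth_sum (I : Type) (r : seq I) (Q : pred I) (F : I -> 'rV[R]_n -> R[i]) :
  (forall k, Q k -> smooth U (F k)) -> smooth U (fun x => \sum_(k <- r | Q k) F k x).
Proof.
move=> sF; elim: r => [|k r IH].
  rewrite (_ : (fun x => _) = fun=> 0); first exact: smooth_cst.
  by apply/funext => x; rewrite big_nil.
have [Qk|Qk] := boolP (Q k).
  rewrite (_ : (fun x => _) = fun x => F k x + \sum_(k <- r | Q k) F k x).
    exact: smoothD (sF k Qk) IH.
  by apply/funext => x; rewrite big_cons Qk.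
rewrite (_ : (fun x => _) = fun x => \sum_(k <- r | Q k) F k x)//.
by apply/funext => x; rewrite big_cons (negbTE Qk).
Qed.

Lemma words_D s f g : smooth U f -> smooth U g ->
  eq_on U (dw (fun y => f y + g y) s)
          (fun x => dw f s x + dw g s x).
Proof.
move=> sf sg; elim: s => [|i s IH] x Ux //=.
rewrite (near_eq_partial i (eq_on_near oU Ux IH)).
by rewrite partialD//; [exact: sf|exact: sg].
Qed.

Lemma words_Z s (c : R[i]) f : smooth U f ->
  eq_on U (dw (fun y => c * f y) s)
          (fun x => c * dw f s x).
Proof.
move=> sf; elim: s => [|i s IH] x Ux //=.
rewrite (near_eq_partial i (eq_on_near oU Ux IH)).
rewrite partialM ?partial_cst ?mul0r ?add0r//; [exact: C1at_cst|exact: sf].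
Qed.

Lemma words_sum s (I : Type) (r : seq I) (Q : pred I)
    (F : I -> 'rV[R]_n -> R[i]) : (forall k, Q k -> smooth U (F k)) ->
  eq_on U (dw (fun y => \sum_(k <- r | Q k) F k y) s)
          (fun x => \sum_(k <- r | Q k) dw (F k) s x).
Proof.
move=> sF; elim: r => [|k r IH] x Ux.
  rewrite (_ : (fun x => _) = fun=> 0); last first.
    by apply/funext => y; rewrite big_nil.
  rewrite big_nil; elim: s x Ux => [//|i s IH] x Ux.
  rewrite /= (@near_eq_partial i _ (fun=> 0)) ?partial_cst//.
  exact: eq_on_near Ux IH.
rewrite big_cons; have [Qk|Qk] := boolP (Q k); last first.
  rewrite (_ : (fun x => _) = fun x => \sum_(k <- r | Q k) F k x); first exact: IH.
  by apply/funext => y; rewrite big_cons (negbTE Qk).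
rewrite (_ : (fun x => _) = fun x => F k x + \sum_(k <- r | Q k) F k x); last first.
  by apply/funext => y; rewrite big_cons Qk.
rewrite words_D; [by rewrite IH|exact: sF|exact: smooth_sum|by []].
Qed.

(** Peeling off the innermost letter shifts either [F] or [G], and Pascal's rule reassembles the two
    sums. Words, unlike multi-indices, produce one-variable binomial coefficients. *)
Lemma words_M_le (B : set 'rV[R]_n) f g (F G : nat -> R) : B `<=` U ->
  smooth U f -> smooth U g ->
  (forall s x, B x -> Normc.normc (dw f s x) <= F (size s)) ->
  (forall s x, B x -> Normc.normc (dw g s x) <= G (size s)) ->
  forall s x, B x -> Normc.normc (dw (fun y => f y * g y) s x) <=
    \sum_(j < (size s).+1) 'C(size s, j)%:R * (F j * G (size s - j)%N).
Proof.
move=> BU + + + + s; elim/last_ind: s f g F G => [|s i IH] f g F G sf sg bf bg x Bx.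
  rewrite big_ord1 /= bin0 mul1r Normc.normcM.
  apply: ler_pM; rewrite ?normc_ge0//; first exact: (bf [::] x Bx).
  exact: (bg [::] x Bx).
rewrite foldr_partial_rcons size_rcons.
rewrite (@eq_on_words U _ (fun y => partial i f y * g y + f y * partial i g y))//; last 2 first.
- by move=> y Uy; rewrite partialM//; [exact: (sf [::])|exact: (sg [::])].
- exact: BU.
have sdf := smooth_partial i sf; have sdg := smooth_partial i sg.
rewrite words_D; [|exact: smoothM|exact: smoothM|exact: BU].
apply: le_trans (le_normcD _ _) _.
have bdf t y : B y -> Normc.normc (dw (partial i f) t y) <= F (size t).+1.
  by move=> By; rewrite -foldr_partial_rcons -(size_rcons t i); exact: bf.
have bdg t y : B y -> Normc.normc (dw (partial i g) t y) <= G (size t).+1.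
  by move=> By; rewrite -foldr_partial_rcons -(size_rcons t i); exact: bg.
apply: le_trans (lerD (IH _ _ (fun k => F k.+1) G sdf sg bdf bg _ Bx)
   (IH _ _ F (fun k => G k.+1) sf sdg bf bdg _ Bx)) _.
set m := size s.
by rewrite leibniz_sum.
Qed.

End algebra.
End calculus.

(** * Mean value inequalities and commuting derivatives *)

Lemma ge_min_l (R : realDomainType) (a b : R) : Num.min a b <= a.
Proof. by rewrite ge_min lexx. Qed.

Lemma ge_min_r (R : realDomainType) (a b : R) : Num.min a b <= b.
Proof. by rewrite ge_min lexx orbT. Qed.

Section lines.
Variables (R : realType) (V : normedModType R).
Implicit Types (F G : V -> R) (x y v w : V).

Lemma open_ball_sub (U : set V) x : open U -> U x ->
  exists2 r : R, 0 < r & ball x r `<=` U.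
Proof.
move=> oU Ux; have h : nbhs x U by apply: open_nbhs_nbhs.
by have [r r0 Br] := (nbhs_ballP _ _).1 h; exists r.
Qed.

Lemma continuous_ball F x (e : R) : {for x, continuous F} -> 0 < e ->
  exists2 r : R, 0 < r & forall y, ball x r y -> `|F x - F y| <= e.
Proof.
move=> cF e0; have /cvgrPdist_le/(_ _ e0)/nbhs_ballP[r r0 Br] : F y @[y --> x] --> F x.
  exact: cF.
by exists r.
Qed.

Lemma line_is_derive F x v (h : R) : derivable F (h *: v + x) v ->
  is_derive h 1 (fun k : R => F (k *: v + x)) ('D_v F (h *: v + x)).
Proof.
have E : (fun k : R => k^-1 *: (((fun k : R => F (k *: v + x)) \o shift h) (k *: 1)
     - F (h *: v + x))) =
   (fun k : R => k^-1 *: ((F \o shift (h *: v + x)) (k *: v) - F (h *: v + x))).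
  apply/funext => k /=; congr (_ *: (F _ - _)).
  by rewrite scalerDl [_%:A]mulr1 addrA.
move=> dF; apply: DeriveDef; rewrite /derivable /derive; first by rewrite E.
by rewrite E.
Qed.

Lemma line_MVT_pos F x v (a b : R) : a < b ->
  (forall h, a <= h <= b -> derivable F (h *: v + x) v) ->
  exists2 c, a <= c <= b &
    F (b *: v + x) - F (a *: v + x) = 'D_v F (c *: v + x) * (b - a).
Proof.
move=> ab dF.
have [||c cab ->] := @MVT R (fun k => F (k *: v + x))
    (fun k => 'D_v F (k *: v + x)) a b ab.
- move=> h; rewrite in_itv/= => /andP[ah hb].
  by apply: line_is_derive; apply: dF; rewrite !ltW.
- apply: derivable_within_continuous => h; rewrite in_itv/= => hab.
  by have [] := line_is_derive (dF h hab).
- by exists c => //; move: cab; rewrite in_itv/= => /andP[? ?]; rewrite !ltW.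
Qed.

Lemma line_MVT F x v (a : R) :
  (forall h, `|h| <= `|a| -> derivable F (h *: v + x) v) ->
  exists2 c, `|c| <= `|a| &
    F (a *: v + x) - F x = 'D_v F (c *: v + x) * a.
Proof.
move=> dF; have [a0|a0|->] := ltgtP a 0; last first.
- by exists 0; rewrite // scale0r add0r subrr mulr0.
- have [|c c0 e] := @line_MVT_pos F x v 0 a a0.
    move=> h /andP[h0 ha]; apply: dF; rewrite !ger0_norm//.
    exact: le_trans ha.
  move: c0 => /andP[c0 ca].
  exists c; first by rewrite !ger0_norm// ltW.
  by move: e; rewrite scale0r add0r subr0.
- have [|c c0 e] := @line_MVT_pos F x v a 0 a0.
    by move=> h /andP[ah h0]; apply: dF; rewrite !ler0_norm ?lerN2// ltW.
  move: c0 => /andP[ac c0].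
  exists c; first by rewrite !ler0_norm ?lerN2// ltW.
  by move: e; rewrite scale0r add0r => /(congr1 -%R); rewrite opprB => ->; ring.
Qed.

Lemma taylor2 F x v (a B : R) :
  (forall y, derivable F y v) -> (forall y, derivable ('D_v F) y v) ->
  (forall y, `|'D_v ('D_v F) y| <= B) ->
  `|F (a *: v + x) - F x - a * 'D_v F x| <= B * a ^+ 2.
Proof.
move=> dF ddF bF; have B0 : 0 <= B by exact: le_trans (bF x).
have [c ca ->] := @line_MVT F x v a (fun h _ => dF _).
rewrite mulrC -mulrBr; have [c' _ ->] := @line_MVT _ x v c (fun h _ => ddF _).
rewrite !normrM; have -> : B * a ^+ 2 = `|a| * (B * `|a|).
  by rewrite -[a ^+ 2]real_normK ?num_real//; ring.
by apply: ler_wpM2l => //; apply: ler_pM.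
Qed.

(** This is how a derivative is identified where no rule of calculus applies: for pointwise limits,
    and at the flat point of [flat]. *)
Lemma is_derive_quadratic F x v (G B : R) : 0 <= B ->
  (forall h : R, `|F (h *: v + x) - F x - h * G| <= B * h ^+ 2) ->
  is_derive x v F G.
Proof.
move=> B0 T.
have cvG : (fun h : R => h^-1 *: ((F \o shift x) (h *: v) - F x)) @ 0^' --> G.
  apply/cvgrPdist_le => e e0; near=> h.
  have h0 : h != 0 by near: h; exact: nbhs_dnbhs_neq.
  have hB : `|h| <= e / (B + 1).
    by near: h; apply: dnbhs0_le; rewrite divr_gt0// ltr_wpDl.
  rewrite /= [_ *: _]mulrC distrC.
  have -> : (F (h *: v + x) - F x) / h - G = (F (h *: v + x) - F x - h * G) / h.
    by rewrite [in RHS]mulrBl mulrAC divff// mul1r.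
  rewrite normrM normfV ler_pdivrMr ?normr_gt0//.
  apply: le_trans (T h) _; rewrite -[h ^+ 2]real_normK ?num_real// expr2 mulrA.
  apply: ler_wpM2r => //; apply: le_trans (ler_wpM2l B0 hB) _.
  rewrite mulrCA -[leRHS]mulr1; apply: ler_wpM2l; first exact: ltW.
  by rewrite ler_pdivrMr ?mul1r ?ltr_wpDl// lerDl.
apply: DeriveDef; first by apply/cvg_ex; exists G.
exact: cvg_lim.
Unshelve. all: by end_near. Qed.

(* The second-order bound [taylor2] is uniform in [N], so it survives the pointwise limit. *)
Lemma is_derive_limit (F_ : nat -> V -> R) F (G : R) v x (B : R) :
  (forall N y, derivable (F_ N) y v) ->
  (forall N y, derivable ('D_v (F_ N)) y v) ->
  (forall N y, `|'D_v ('D_v (F_ N)) y| <= B) ->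
  (forall y, F_ N y @[N --> \oo] --> F y) ->
  'D_v (F_ N) x @[N --> \oo] --> G ->
  is_derive x v F G.
Proof.
move=> dF ddF bF cF cG.
have T (a : R) : `|F (a *: v + x) - F x - a * G| <= B * a ^+ 2.
  have cv : `|F_ N (a *: v + x) - F_ N x - a * 'D_v (F_ N) x| @[N --> \oo] -->
      `|F (a *: v + x) - F x - a * G|.
    by apply: cvg_norm; apply: cvgB; [exact: cvgB|apply: cvgM => //; exact: cvg_cst].
  rewrite -(cvg_lim _ cv)//; apply: limr_le; first by apply/cvg_ex; eexists; exact: cv.
  by near=> N; exact: taylor2.
exact: (is_derive_quadratic (le_trans (normr_ge0 _) (bF 0%N x)) T).
Unshelve. all: by end_near. Qed.

Lemma is_derive_translate F p y v : derivable F (p + y) v ->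
  is_derive y v (fun z => F (p + z)) ('D_v F (p + y)).
Proof.
have E : (fun k : R => k^-1 *: (((fun z => F (p + z)) \o shift y) (k *: v)
     - F (p + y))) =
   (fun k : R => k^-1 *: ((F \o shift (p + y)) (k *: v) - F (p + y))).
  by apply/funext => k /=; rewrite addrCA.
by move=> dF; apply: DeriveDef; rewrite /derivable /derive E.
Qed.

Lemma second_difference F v w x (h : R) : 0 < h ->
  (forall a b : R, `|a| <= h -> `|b| <= h ->
     derivable F (a *: v + (b *: w + x)) v /\
     derivable ('D_v F) (b *: w + (a *: v + x)) w) ->
  exists c c' : R, [/\ `|c| <= h, `|c'| <= h &
    F (h *: v + (h *: w + x)) - F (h *: v + x) - (F (h *: w + x) - F x) =
    'D_w ('D_v F) (c' *: w + (c *: v + x)) * h * h].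
Proof.
move=> h0 H; have hh : `|h| <= h by rewrite gtr0_norm.
(* The second difference is the increment of [G] along [v]; a first mean value theorem is applied to
   [G] along [v], a second one to ['D_v F] along [w]. *)
pose G z := F (h *: w + z) - F z.
have dG a : `|a| <= h -> is_derive (a *: v + x) v G
    ('D_v F (h *: w + (a *: v + x)) - 'D_v F (a *: v + x)).
  move=> ah.
  have d1 : derivable F (h *: w + (a *: v + x)) v.
    by have [+ _] := H a h ah hh; rewrite addrCA.
  have d2 : derivable F (a *: v + x) v.
    by have [|+ _] := H a 0 ah; [rewrite normr0 ltW|rewrite scale0r add0r].
  have [e1 e2] := is_derive_translate d1.
  apply: DeriveDef; first exact: derivable_subf.
  by rewrite (derive_subf e1 d2) e2.
have [|c ch e] := @line_MVT G x v h.
  by move=> a ah; have [] := dG a (le_trans ah hh).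
have {}ch := le_trans ch hh; exists c.
have [|c' c'h e'] := @line_MVT ('D_v F) (c *: v + x) w h.
  by move=> b bh; exact: (H c b ch (le_trans bh hh)).2.
exists c'; split => //; first exact: le_trans hh.
have [_ De] := dG c ch; move: e; rewrite De e' /G => <-.
by rewrite (addrCA (h *: w)).
Qed.

Lemma eq_common_values (P Q : V -> R) x :
  {for x, continuous P} -> {for x, continuous Q} ->
  (forall r : R, 0 < r -> exists p q, [/\ ball x r p, ball x r q & P p = Q q]) ->
  P x = Q x.
Proof.
move=> cP cQ H; apply/eqP; rewrite -subr_eq0 -normr_le0.
apply/ler_addgt0Pr => e e0; rewrite add0r.
have e20 : 0 < e / 2 by rewrite divr_gt0.
have [r1 r10 B1] := continuous_ball cP e20.
have [r2 r20 B2] := continuous_ball cQ e20.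
have [|p [q [xp xq PQ]]] := H (Num.min r1 r2); first by rewrite lt_min r10.
have {}xp := B1 p (le_ball (ge_min_l r1 r2) xp).
have {}xq := B2 q (le_ball (ge_min_r r1 r2) xq).
have -> : P x - Q x = (P x - P p) - (Q x - Q q) by rewrite PQ; ring.
apply: le_trans (ler_normB _ _) _.
by rewrite (le_trans (lerD xp xq))// -splitr.
Qed.

(* Both mixed derivatives are read off the same second difference over a parallelogram of size [h]. *)
Lemma derive_comm F v w x (U : set V) : open U -> U x ->
  (forall y, U y -> derivable F y v) ->
  (forall y, U y -> derivable F y w) ->
  (forall y, U y -> derivable ('D_v F) y w) ->
  (forall y, U y -> derivable ('D_w F) y v) ->
  {for x, continuous ('D_w ('D_v F))} -> {for x, continuous ('D_v ('D_w F))} ->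
  'D_w ('D_v F) x = 'D_v ('D_w F) x.
Proof.
move=> oU Ux dv dw dvw dwv c1 c2; apply: (eq_common_values c1 c2) => r' r'0.
have [r1 r10 B1] := open_ball_sub oU Ux.
pose r := Num.min r' r1; have r0 : 0 < r by rewrite lt_min r'0.
(* Half of the size at which [h (|v| + |w| + 1) = r], so that the closed parallelogram lies in the
   open ball; the [1] covers [v = w = 0]. *)
pose h := r / (`|v| + `|w| + 1) / 2.
have D0 : 0 < `|v| + `|w| + 1 by rewrite ltr_wpDl// addr_ge0.
have h0 : 0 < h by rewrite !divr_gt0.
have inB a b : `|a| <= h -> `|b| <= h -> ball x r (a *: v + (b *: w + x)).
  move=> ah bh; rewrite -ball_normE /= addrA opprD addrCA subrr addr0 normrN.
  apply: le_lt_trans (ler_normD _ _) _; rewrite !normrZ.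
  apply: (@le_lt_trans _ _ (h * (`|v| + `|w| + 1))).
    rewrite mulrDr mulr1; apply: ler_wpDr; first exact: ltW.
    by rewrite mulrDr; apply: lerD; apply: ler_wpM2r.
  rewrite /h mulrAC divfK ?gt_eqF// ltr_pdivrMr// ltr_pMr// ltr1n//.
have inB' a b : `|a| <= h -> `|b| <= h -> ball x r (b *: w + (a *: v + x)).
  by move=> ah bh; rewrite addrCA; exact: inB.
have rr' y : ball x r y -> ball x r' y by apply: le_ball; rewrite ge_min lexx.
have rU y : ball x r y -> U y.
  by move=> xy; apply: B1; apply: le_ball xy; rewrite ge_min lexx orbT.
have [|c [c' [ch c'h e1]]] := @second_difference F v w x h h0.
  move=> a b ah bh; split; first by apply: dv; apply: rU; exact: inB.
  by apply: dvw; apply: rU; exact: inB'.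
have [|d [d' [dh d'h e2]]] := @second_difference F w v x h h0.
  move=> a b ah bh; split; first by apply: dw; apply: rU; exact: inB'.
  by apply: dwv; apply: rU; exact: inB.
exists (c' *: w + (c *: v + x)), (d' *: v + (d *: w + x)).
split; [exact/rr'/inB'|exact/rr'/inB|].
apply: (@mulIf _ h); first by rewrite gt_eqF.
apply: (@mulIf _ h); first by rewrite gt_eqF.
apply: etrans (esym e1) (etrans _ e2).
have -> : h *: w + (h *: v + x) = h *: v + (h *: w + x) by rewrite addrCA.
have swap (a b c0 d0 : R) : a - b - (c0 - d0) = a - c0 - (b - d0) by ring.
exact: swap.
Qed.

End lines.

Section coordinate_lines.
Variables (R : realType) (n : nat).
Implicit Types (F : 'rV[R]_n -> R) (x y z : 'rV[R]_n).

(** Only derivatives along the axes are given, so the segment is replaced by a path that changes one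
    coordinate at a time and stays in the box spanned by [x] and [y]. *)
Lemma box_lipschitz F x y (B : R) :
  (forall z, (forall i, `|z ord0 i - x ord0 i| <= `|y ord0 i - x ord0 i|) ->
     forall i, derivable F z (delta_mx ord0 i) /\
       `|'D_(delta_mx ord0 i) F z| <= B) ->
  `|F y - F x| <= B * \sum_i `|y ord0 i - x ord0 i|.
Proof.
move=> H.
pose z k : 'rV[R]_n := \row_i if (i < k)%N then y ord0 i else x ord0 i.
have zS (k : 'I_n) : z k.+1 = (y ord0 k - x ord0 k) *: delta_mx ord0 k + z k.
  apply/rowP => i; rewrite !mxE eqxx/= ltnS.
  have [->|ik] := eqVneq i k; first by rewrite leqnn ltnn mulr1 subrK.
  by rewrite mulr0 add0r leq_eqVlt (negbTE ik : (i == k :> nat) = false).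
have yE : y = z n by apply/rowP => i; rewrite mxE ltn_ord.
have xE : x = z 0%N by apply/rowP => i; rewrite mxE.
rewrite {1}yE {1}xE -(telescope_sumr (fun k => F (z k)) (leq0n n)) big_mkord.
apply: le_trans (ler_norm_sum _ _ _) _; rewrite mulr_sumr; apply: ler_sum => k _.
set d := y ord0 k - x ord0 k.
have inbox c : `|c| <= `|d| -> forall i,
    `|(c *: delta_mx ord0 k + z k) ord0 i - x ord0 i| <= `|y ord0 i - x ord0 i|.
  move=> cd i; rewrite !mxE eqxx/=; have [->|ik] := eqVneq i k.
    by rewrite ltnn mulr1 addrK.
  by rewrite mulr0 add0r; case: ifP => // _; rewrite subrr normr0.
rewrite zS -/d; have [|c cd ->] := @line_MVT _ _ F (z k) (delta_mx ord0 k) d.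
  by move=> h hd; have [] := H _ (inbox h hd) k.
by rewrite normrM; apply: ler_wpM2r => //; have [] := H _ (inbox c cd) k.
Qed.

End coordinate_lines.

Section words.
Variables (R : realType) (n : nat).
Implicit Types (f g h : 'rV[R]_n -> R[i]) (U : set 'rV[R]_n) (x : 'rV[R]_n).
Implicit Types (s t : seq 'I_n) (i j : 'I_n).

Lemma C1at_Re f x i : C1at f x ->
  derivable (fun z => complex.Re (f z)) x (delta_mx ord0 i).
Proof. by case=> _ _ /(_ i)[]. Qed.

Lemma C1at_Im f x i : C1at f x ->
  derivable (fun z => complex.Im (f z)) x (delta_mx ord0 i).
Proof. by case=> _ _ /(_ i)[]. Qed.

Lemma C1at_partial U f x i : smooth U f -> U x -> C1at (partial i f) x.
Proof. by move=> sf; apply: smooth_C1at; exact: smooth_partial. Qed.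

Lemma partial_comm U f i j x : open U -> U x -> smooth U f ->
  partial i (partial j f) x = partial j (partial i f) x.
Proof.
move=> oU Ux sf.
have [cR1 cI1 _] := C1at_partial i (smooth_partial j sf) Ux.
have [cR2 cI2 _] := C1at_partial j (smooth_partial i sf) Ux.
have dR k := fun y (Uy : U y) => @C1at_Re f y k (smooth_C1at sf Uy).
have dI k := fun y (Uy : U y) => @C1at_Im f y k (smooth_C1at sf Uy).
have ddR k l := fun y (Uy : U y) => @C1at_Re (partial l f) y k (C1at_partial l sf Uy).
have ddI k l := fun y (Uy : U y) => @C1at_Im (partial l f) y k (C1at_partial l sf Uy).
have eR := @derive_comm R _ (fun z => complex.Re (f z)) (delta_mx ord0 j)
  (delta_mx ord0 i) x U oU Ux (dR j) (dR i) (ddR i j) (ddR j i) cR1 cR2.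
have eI := @derive_comm R _ (fun z => complex.Im (f z)) (delta_mx ord0 j)
  (delta_mx ord0 i) x U oU Ux (dI j) (dI i) (ddI i j) (ddI j i) cI1 cI2.
apply/eqP; rewrite eq_complex; apply/andP; split; apply/eqP.
  exact: eR.
exact: eI.
Qed.

Lemma words_rotate U f i s t : open U -> smooth U f ->
  eq_on U (dw f (i :: s ++ t)) (dw f (s ++ i :: t)).
Proof.
move=> oU sf; elim: s => [|j s IH] x Ux //=.
rewrite (partial_comm _ _ oU Ux (smooth_words (s ++ t) sf)).
by apply: near_eq_partial; exact: eq_on_near oU Ux IH.
Qed.

Lemma words_perm U f s t : open U -> smooth U f -> perm_eq s t ->
  eq_on U (dw f s) (dw f t).
Proof.
move=> oU sf; elim: s t => [|i s IH] t st.
  by move: st; rewrite perm_sym => /perm_nilP ->.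
have it : i \in t by rewrite -(perm_mem st) mem_head.
case/splitPr: it st => t1 t2 st x Ux.
rewrite -(words_rotate i t1 t2 oU sf Ux) /=.
apply: near_eq_partial; apply: eq_on_near oU Ux (IH _ _).
by move: st; rewrite perm_sym perm_catC/= perm_cons perm_catC perm_sym.
Qed.

(** Multi-indices are traded for words, from which an induction can peel off a single derivative. *)
Definition index_word (a : 'I_n -> nat) : seq 'I_n :=
  flatten [seq nseq (a i) i | i <- enum 'I_n].

Lemma size_index_word a : size (index_word a) = mlen a.
Proof.
rewrite /index_word size_flatten /shape -map_comp /mlen sumnE big_map big_enum/=.
by apply: eq_bigr => i _; rewrite /= size_nseq.
Qed.

Lemma count_index_word a i : count_mem i (index_word a) = a i.
Proof.
rewrite /index_word count_flatten -map_comp sumnE big_map big_enum/=.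
rewrite (bigD1 i)//= count_nseq /= eqxx mul1n big1 ?addn0// => j ji.
by rewrite count_nseq /= (negbTE ji) mul0n.
Qed.

Lemma DmultiE a f : Dmulti a f = foldr (@Dj R n) f (index_word a).
Proof.
rewrite /Dmulti /index_word; elim: (enum 'I_n) => //= i r IH.
rewrite foldr_cat -IH; elim: (a i) => //= k ->//.
Qed.

Lemma partialZ i (c : R[i]) f x : C1at f x ->
  partial i (fun y => c * f y) x = c * partial i f x.
Proof.
by move=> cf; rewrite (partialM i (C1at_cst c x) cf) partial_cst mul0r add0r.
Qed.

Lemma Dwords U f s : open U -> smooth U f ->
  eq_on U (foldr (@Dj R n) f s) (fun x => (- 'i%C) ^+ size s * dw f s x).
Proof.
move=> oU sf; elim: s => [|i s IH] x Ux /=; first by rewrite mul1r.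
rewrite {1}/Dj (near_eq_partial i (eq_on_near oU Ux IH)).
by rewrite (partialZ i _ (sf s x Ux)) mulrA exprS.
Qed.

Lemma normc_i : Normc.normc (- 'i%C : R[i]) = 1.
Proof. by rewrite /Normc.normc/= oppr0 expr0n/= add0r sqrrN expr1n sqrtr1. Qed.

Lemma normc_exp (z : R[i]) k : Normc.normc (z ^+ k) = Normc.normc z ^+ k.
Proof.
by elim: k => [|k IH]; rewrite ?expr0 ?Normc.normc1// !exprS Normc.normcM IH.
Qed.

Lemma normc_Dwords U f s x : open U -> smooth U f -> U x ->
  Normc.normc (foldr (@Dj R n) f s x) = Normc.normc (dw f s x).
Proof.
by move=> oU sf Ux; rewrite (Dwords s oU sf Ux) Normc.normcM normc_exp normc_i
  expr1n mul1r.
Qed.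

(** A word is a permutation of the word of its letter counts, and derivatives of a smooth function
    commute. *)
Lemma roumieu_words U (M : nat -> R) f K : open U -> roumieu U M f ->
  compact K -> K `<=` U -> exists C h : R, [/\ 0 < C, 0 < h &
    forall s x, K x -> Normc.normc (dw f s x) <= C * h ^+ size s * M (size s)].
Proof.
move=> oU [sf bf] cK KU; have [C [h [C0 h0 b]]] := bf K cK KU.
exists C, h; split => // s x Kx; have Ux := KU _ Kx.
have st : perm_eq s (index_word (fun i => count_mem i s)).
  by apply/allP => i _; rewrite /= count_index_word.
rewrite (words_perm oU sf st Ux) -(normc_Dwords _ oU sf Ux) -DmultiE.
by rewrite (perm_size st) size_index_word; exact: b.
Qed.

Lemma words_roumieu U (M : nat -> R) f : open U -> smooth U f ->
  (exists C h : R, [/\ 0 < C, 0 < h &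
    forall s x, U x -> Normc.normc (dw f s x) <= C * h ^+ size s * M (size s)]) ->
  roumieu U M f.
Proof.
move=> oU sf [C [h [C0 h0 b]]]; split=> // K _ KU; exists C, h; split=> // a x Kx.
by rewrite DmultiE (normc_Dwords _ oU sf (KU _ Kx)) -size_index_word; apply: b; apply: KU.
Qed.

End words.

(** * Limits of smooth functions *)

Lemma norm_lipschitz_continuous (R : realType) (V : normedModType R)
  (F : V -> R) x (C : R) : 0 <= C -> (forall y, `|F y - F x| <= C * `|y - x|) ->
  {for x, continuous F}.
Proof.
move=> C0 H; suff : F y @[y --> x] --> F x by [].
apply/cvgrPdist_le => e e0; have D0 : 0 < C + 1 by rewrite ltr_wpDl.
apply/nbhs_ballP; exists (e / (C + 1)); rewrite /= ?divr_gt0// => y.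
rewrite -ball_normE /= distrC => xy; rewrite distrC; apply: le_trans (H y) _.
apply: le_trans (ler_wpM2l C0 (ltW xy)) _.
by rewrite mulrCA ger_pMr// ler_pdivrMr// mul1r lerDl.
Qed.

Section limits.
Variables (R : realType) (n : nat).
Implicit Types (f g h : 'rV[R]_n -> R[i]) (U : set 'rV[R]_n) (x : 'rV[R]_n).
Implicit Types (s t : seq 'I_n) (i j : 'I_n).

Lemma normc_ge_absRe (z : R[i]) : `|complex.Re z| <= Normc.normc z.
Proof.
by case: z => a b /=; rewrite -sqrtr_sqr ler_wsqrtr// lerDl sqr_ge0.
Qed.

Lemma normc_ge_absIm (z : R[i]) : `|complex.Im z| <= Normc.normc z.
Proof.
by case: z => a b /=; rewrite -sqrtr_sqr ler_wsqrtr// lerDr sqr_ge0.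
Qed.

Lemma normc_le_absReIm (z : R[i]) :
  Normc.normc z <= `|complex.Re z| + `|complex.Im z|.
Proof.
case: z => a b /=; rewrite -[leRHS]ger0_norm ?addr_ge0// -sqrtr_sqr.
rewrite ler_wsqrtr// sqrrD !real_normK ?num_real// lerD2r lerDl.
by rewrite mulrn_wge0// mulr_ge0.
Qed.

Lemma norm_coord_le x i : `|x ord0 i| <= `|x|.
Proof.
rewrite [leRHS]/Num.norm/= mx_normrE.
exact: (le_bigmax _ (fun ij : 'I_1 * 'I_n => `|x ij.1 ij.2|) (ord0, i)).
Qed.

Lemma lipschitz_continuous (F : 'rV[R]_n -> R) x (B : R) : 0 <= B ->
  (forall y, `|F y - F x| <= B * \sum_i `|y ord0 i - x ord0 i|) ->
  {for x, continuous F}.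
Proof.
move=> B0 H; apply: (@norm_lipschitz_continuous _ _ _ _ (B * n%:R)).
  exact: mulr_ge0.
move=> y; apply: le_trans (H y) _; rewrite -mulrA; apply: ler_wpM2l => //.
rewrite -[n in n%:R]card_ord -sum1_card natr_sum mulr_suml; apply: ler_sum => i _.
by rewrite mul1r; have := norm_coord_le (y - x) i; rewrite !mxE.
Qed.

(** Componentwise, to match the definitions of [partial] and [smooth]. *)
Definition ccvg (u : nat -> R[i]) (l : R[i]) :=
  complex.Re (u N) @[N --> \oo] --> complex.Re l /\
  complex.Im (u N) @[N --> \oo] --> complex.Im l.

Section smooth_limit.
Variables (V_ : nat -> 'rV[R]_n -> R[i]) (L : seq 'I_n -> 'rV[R]_n -> R[i]).
Hypothesis sV : forall N, smooth setT (V_ N).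
Hypothesis bV : forall s, exists B : R, forall N x, Normc.normc (dw (V_ N) s x) <= B.
Hypothesis cV : forall s x, ccvg (fun N => dw (V_ N) s x) (L s x).

Let lim_continuous (F_ : nat -> 'rV[R]_n -> R) (F : 'rV[R]_n -> R) (B : R) x :
  (forall N y i, derivable (F_ N) y (delta_mx ord0 i)) ->
  (forall N y i, `|'D_(delta_mx ord0 i) (F_ N) y| <= B) ->
  (forall y, F_ N y @[N --> \oo] --> F y) -> 0 <= B -> {for x, continuous F}.
Proof.
move=> dF bF cF B0; apply: (@lipschitz_continuous _ _ B) => // y.
have cv : `|F_ N y - F_ N x| @[N --> \oo] --> `|F y - F x|.
  by apply: cvg_norm; exact: cvgB.
rewrite -(cvg_lim _ cv)//; apply: limr_le; first by apply/cvg_ex; eexists; exact: cv.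
by near=> N; apply: box_lipschitz => z _ i; split.
Unshelve. all: by end_near. Qed.

Let bound s : exists2 B : R, 0 <= B & forall N i x,
  Normc.normc (dw (V_ N) (i :: s) x) <= B.
Proof.
have [B HB] := choice (fun i => bV (i :: s)).
have B0 i : 0 <= B i by exact: le_trans (normc_ge0 _) (HB i 0%N 0).
exists (\sum_i B i); first exact: sumr_ge0.
move=> N i x; apply: le_trans (HB i N x) _.
by rewrite (bigD1 i)//= lerDl sumr_ge0.
Qed.

(** Uniform bounds on the words that are two letters longer take the place of uniform convergence of
    the derivatives. *)
Lemma limit_is_derive s i x :
  is_derive x (delta_mx ord0 i) (fun y => complex.Re (L s y)) (complex.Re (L (i :: s) x)) /\
  is_derive x (delta_mx ord0 i) (fun y => complex.Im (L s y)) (complex.Im (L (i :: s) x)).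
Proof.
have [B HB] := bV [:: i, i & s].
have C1 t N y : C1at (dw (V_ N) t) y by exact: smooth_C1at (smooth_words t (sV N)) _.
split.
  apply: (@is_derive_limit _ _ (fun N y => complex.Re (dw (V_ N) s y)) _ _ _ _ B).
  - by move=> N y; exact: C1at_Re (C1 s N y).
  - move=> N y; exact (@C1at_Re _ _ _ y i (C1 (i :: s) N y)).
  - move=> N y; exact (le_trans (normc_ge_absRe (dw (V_ N) [:: i, i & s] y)) (HB N y)).
  - by move=> y; exact: (cV s y).1.
  - exact: (cV (i :: s) x).1.
apply: (@is_derive_limit _ _ (fun N y => complex.Im (dw (V_ N) s y)) _ _ _ _ B).
- by move=> N y; exact: C1at_Im (C1 s N y).
- move=> N y; exact (@C1at_Im _ _ _ y i (C1 (i :: s) N y)).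
- move=> N y; exact (le_trans (normc_ge_absIm (dw (V_ N) [:: i, i & s] y)) (HB N y)).
- by move=> y; exact: (cV s y).2.
- exact: (cV (i :: s) x).2.
Qed.

Lemma limit_C1at s x : C1at (L s) x.
Proof.
have C1 t N y : C1at (dw (V_ N) t) y by exact: smooth_C1at (smooth_words t (sV N)) _.
have [B B0 HB] := bound s; split.
- apply: (@lim_continuous (fun N y => complex.Re (dw (V_ N) s y)) _ B) => //.
  + by move=> N y i; exact: C1at_Re (C1 s N y).
  + move=> N y i; exact (le_trans (normc_ge_absRe (dw (V_ N) (i :: s) y)) (HB N i y)).
  + by move=> y; exact: (cV s y).1.
- apply: (@lim_continuous (fun N y => complex.Im (dw (V_ N) s y)) _ B) => //.
  + by move=> N y i; exact: C1at_Im (C1 s N y).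
  + move=> N y i; exact (le_trans (normc_ge_absIm (dw (V_ N) (i :: s) y)) (HB N i y)).
  + by move=> y; exact: (cV s y).2.
- by move=> i; have [[dR _] [dI _]] := limit_is_derive s i x.
Qed.

Lemma limit_words s : dw (L [::]) s = L s.
Proof.
elim: s => //= i s ->; apply/funext => x.
have [[_ eR] [_ eI]] := limit_is_derive s i x.
by rewrite /partial eR eI; case: (L (i :: s) x).
Qed.

Lemma smooth_limit : smooth setT (L [::]).
Proof. by move=> s x _; rewrite /= limit_words; exact: limit_C1at. Qed.

End smooth_limit.

Lemma ccvg_unique u l l' : ccvg u l -> ccvg u l' -> l = l'.
Proof.
case: l l' => a b [c d] [/= h1 h2] [/= h3 h4].
by rewrite (cvg_unique _ h1 h3)// (cvg_unique _ h2 h4).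
Qed.

Lemma ccvg_cst l : ccvg (fun=> l) l.
Proof. by split; exact: cvg_cst. Qed.

Lemma ccvgD u v l m : ccvg u l -> ccvg v m -> ccvg (fun N => u N + v N) (l + m).
Proof.
move=> [h1 h2] [h3 h4]; split.
  by rewrite cReD; under eq_fun do rewrite cReD; exact: cvgD.
by rewrite cImD; under eq_fun do rewrite cImD; exact: cvgD.
Qed.

Lemma ccvgM u v l m : ccvg u l -> ccvg v m -> ccvg (fun N => u N * v N) (l * m).
Proof.
move=> [h1 h2] [h3 h4]; split.
  rewrite (cReM l m) (_ : (fun N => _) = fun N => complex.Re (u N) * complex.Re (v N) -
    complex.Im (u N) * complex.Im (v N)); last by apply/funext => N; rewrite (cReM (u N)).
  by apply: cvgB; exact: cvgM.
rewrite (cImM l m) (_ : (fun N => _) = fun N => complex.Re (u N) * complex.Im (v N) +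
  complex.Im (u N) * complex.Re (v N)); last by apply/funext => N; rewrite (cImM (u N)).
by apply: cvgD; exact: cvgM.
Qed.

Lemma ccvg_sum (I : Type) (r : seq I) (Q : pred I) (u : I -> nat -> R[i]) l :
  (forall k, Q k -> ccvg (u k) (l k)) ->
  ccvg (fun N => \sum_(k <- r | Q k) u k N) (\sum_(k <- r | Q k) l k).
Proof.
move=> ul; elim: r => [|k r IH].
  by under eq_fun do rewrite big_nil; rewrite big_nil; exact: ccvg_cst.
under eq_fun do rewrite big_cons; rewrite big_cons; case: ifP => // Qk.
by apply: ccvgD => //; exact: ul.
Qed.

(** The squared norm is a polynomial in the two components, so sums and products of limits
    suffice. *)
Lemma ccvg_normc2 u l : ccvg u l ->
  Normc.normc (u N) ^+ 2 @[N --> \oo] --> Normc.normc l ^+ 2.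
Proof.
move=> [h1 h2].
have sq (z : R[i]) : Normc.normc z ^+ 2 = complex.Re z ^+ 2 + complex.Im z ^+ 2.
  by case: z => a b; rewrite sqr_sqrtr// addr_ge0 ?sqr_ge0.
under eq_fun do rewrite sq !expr2.
by rewrite sq !expr2; apply: cvgD; exact: cvgM.
Qed.

Lemma ccvg_normc_le u l (B : R) : ccvg u l -> (forall N, Normc.normc (u N) <= B) ->
  Normc.normc l <= B.
Proof.
move=> ul bu; have B0 : 0 <= B := le_trans (normc_ge0 _) (bu 0%N).
rewrite -(ler_pXn2r (n := 2))// ?nnegrE ?normc_ge0//.
have cv := ccvg_normc2 ul; rewrite -(cvg_lim _ cv)//; apply: limr_le.
  by apply/cvg_ex; eexists; exact: cv.
by apply: nearW => N; rewrite ler_pXn2r// ?nnegrE ?normc_ge0.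
Qed.

Lemma ccvg_normc_ge u l (B : R) k : ccvg u l -> 0 <= B ->
  (forall N, (k <= N)%N -> B <= Normc.normc (u N)) -> B <= Normc.normc l.
Proof.
move=> ul B0 uB; rewrite -(ler_pXn2r (n := 2))// ?nnegrE ?normc_ge0//.
have cv := ccvg_normc2 ul; rewrite -(cvg_lim _ cv)//; apply: limr_ge.
  by apply/cvg_ex; eexists; exact: cv.
exists k => // N /= kN; rewrite ler_pXn2r// ?nnegrE ?normc_ge0//.
exact: uB.
Qed.

Lemma ccvg_geometric (v : nat -> R[i]) (B : R) :
  (forall j : nat, Normc.normc (v j) <= B * 2^-1 ^+ j) ->
  ccvg (fun N => \sum_(j < N) v j)
    (lim ((\sum_(j < N) complex.Re (v j)) @[N --> \oo]) +i*
     lim ((\sum_(j < N) complex.Im (v j)) @[N --> \oo]))%C.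
Proof.
move=> bv.
have key (w : nat -> R) : (forall j : nat, `|w j| <= B * 2^-1 ^+ j) ->
    cvg ((\sum_(j < N) w j) @[N --> \oo]).
  move=> bw; have : cvgn [normed series w].
    apply: (@series_le_cvg _ _ (geometric B 2^-1)) => [j|||] /=; [exact: normr_ge0| |exact: bw|].
    - by move=> j; apply: le_trans (bw j).
    - apply: is_cvg_geometric_series.
      by rewrite ger0_norm ?invr_ge0// invf_lt1// ltr1n.
  move/normed_cvg; rewrite /series /=.
  by under eq_fun do rewrite big_mkord.
have RE N : complex.Re (\sum_(j < N) v j) = \sum_(j < N) complex.Re (v j).
  by elim: N => [|N IH]; rewrite ?big_ord0// !big_ord_recr/= cReD IH.
have IE N : complex.Im (\sum_(j < N) v j) = \sum_(j < N) complex.Im (v j).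
  by elim: N => [|N IH]; rewrite ?big_ord0// !big_ord_recr/= cImD IH.
split; [under eq_fun do rewrite RE|under eq_fun do rewrite IE].
  by apply: (key (fun k => complex.Re (v k))) => k; exact: le_trans (normc_ge_absRe _) (bv k).
by apply: (key (fun k => complex.Im (v k))) => k; exact: le_trans (normc_ge_absIm _) (bv k).
Qed.

End limits.

(** * Integration and distributions *)

Section borel.
Variables (R : realType) (n : nat).
Implicit Types (U : set 'rV[R]_n) (x : 'rV[R]_n).

Definition cube (c : 'rV[R]_n) (L : R) : set 'rV[R]_n :=
  [set x | forall i, `|x ord0 i - c ord0 i| <= L].

Lemma cube_measurable c L : measurable (cube c L).
Proof.
have -> : cube c L = \bigcap_(i in [set: 'I_n])
    (@rV_coord R n i @^-1` [set y : R | c ord0 i - L <= y <= c ord0 i + L]).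
  apply/seteqP; split => [x cx i _|x cx i] /=.
    by have := cx i; rewrite ler_distl.
  by have := cx i Logic.I; rewrite /= ler_distl.
apply: fin_bigcap_measurable => // i _; rewrite -[X in measurable X]setTI.
apply: measurable_rV_coord => //.
rewrite (_ : [set y : R | _] = `[c ord0 i - L, c ord0 i + L]%classic).
  exact: measurable_itv.
by apply/seteqP; split => y; rewrite /= in_itv.
Qed.

(** The sigma-algebra is generated by the coordinates, so it contains cubes; an open set is the
    union of the countably many rational cubes contained in it. *)
Lemma open_measurable_rV U : open U -> measurable U.
Proof.
move=> oU.
pose I := ({ffun 'I_n -> rat} * nat)%type.
pose c (t : I) : 'rV[R]_n := \row_i ratr (t.1 i).
pose B (t : I) : set 'rV[R]_n := cube (c t) (t.2.+1%:R^-1).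
pose F (t : I) : set 'rV[R]_n := if `[< B t `<=` U >] then B t else set0.
have -> : U = \bigcup_t F t.
  apply/seteqP; split => [x Ux|x [t _]]; last first.
    by rewrite /F; case: asboolP => // BU /BU.
  have [r r0 xrU] := open_ball_sub oU Ux.
  (* A radius below [r / 2] leaves room for two steps, from [x] to the rational centre and from
     there to any point of the cube. *)
  pose k := Num.bound (2 / r).
  have k1 : k.+1%:R^-1 < r / 2.
    rewrite -[ltRHS]invrK ltf_pV2 ?posrE ?invr_gt0 ?divr_gt0// invf_div.
    apply: lt_trans (archi_boundP _) _; first by rewrite divr_ge0// ltW.
    by rewrite ltr_nat.
  have k0 : 0 < k.+1%:R^-1 :> R by rewrite invr_gt0.
  have /choice[q Hq] i : exists q : rat, `|x ord0 i - ratr q| <= k.+1%:R^-1.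
    have [|q] := @rat_in_itvoo R (x ord0 i - k.+1%:R^-1) (x ord0 i + k.+1%:R^-1).
      by rewrite ltrBlDr -addrA ltrDl addr_gt0.
    rewrite in_itv/= => /andP[q1 q2]; exists q.
    by rewrite distrC ler_distl !ltW.
  exists ([ffun i => q i], k) => //; rewrite /F asboolT.
    by move=> i; rewrite !mxE ffunE.
  move=> y By; apply: xrU; split => // i j; rewrite ord1 -ball_normE/=.
  apply: le_lt_trans (ler_distD (ratr (q j)) _ _) _.
  apply: (@le_lt_trans _ _ (k.+1%:R^-1 + k.+1%:R^-1)).
    by apply: lerD => //; have := By j; rewrite !mxE ffunE distrC.
  by rewrite [ltRHS](splitr r) ltrD.
apply: countable_bigcupT_measurable => [|t]; first exact: countableP.
by rewrite /F; case: asboolP => // _; exact: cube_measurable.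
Qed.

Lemma continuous_measurable_rV (F : 'rV[R]_n -> R) : continuous F ->
  measurable_fun [set: 'rV[R]_n] (F : 'rV[R]_n -> measurableTypeR R).
Proof.
move=> cF; apply: (measurability _ (measurable_realfun.RGenOInfty.measurableE R)).
move=> _ [_ [a ->] <-]; rewrite setTI; apply: open_measurable_rV.
by apply: open_comp => // x _; exact: cF.
Qed.

End borel.

Section integration.
Variable R : realType.

Definition supported n (F : 'rV[R]_n -> R) L := forall x, ~ cube 0 L x -> F x = 0.

Lemma cube_compact n (c : 'rV[R]_n) L : compact (cube c L).
Proof.
have -> : cube c L = [set x : 'rV[R]_n |
    forall i, `[c ord0 i - L, c ord0 i + L]%classic (x ord0 i)].
  apply/seteqP; split => x cx i; have := cx i; rewrite /= ler_distl in_itv //=.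
apply: (@rV_compact R n (fun i => `[c ord0 i - L, c ord0 i + L]%classic)) => i.
exact: segment_compact.
Qed.

Lemma cube_finite n L : (lebesgue_rV R n (cube 0 L) < +oo)%E.
Proof.
elim: n => [|n IH] /=; first by rewrite diracE ltry.
rewrite /cons_measure /pushforward /=.
rewrite (_ : _ @^-1` _ = `[- L, L]%classic `*` cube 0 L); last first.
  apply/seteqP; split => [[a v]|[a v] [/= aL vL]].
    move=> H; split=> [|i] /=.
      by have := H ord0; rewrite !mxE unlift_none/= subr0 ler_norml in_itv.
    by have := H (lift ord0 i); rewrite !mxE liftK/= subr0.
  move=> i; rewrite !mxE subr0; case: unliftP => [j _|_] /=.
    by have := vL j; rewrite mxE subr0.
  by move: aL; rewrite in_itv/= ler_norml.
rewrite [X in (X < _)%E]product_measure1E; [|exact: measurable_itv|exact: cube_measurable].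
apply: lte_mul_pinfty; [by []| |exact: IH].
rewrite [X in X \is a fin_num](@lebesgue_measure_itv R `[- L, L])/=.
by case: ifP => // _; rewrite -EFinB.
Qed.

Lemma supported_integrable n (F : 'rV[R]_n -> R) L : continuous F ->
  supported F L -> (lebesgue_rV R n).-integrable setT (EFin \o F).
Proof.
move=> cF sF.
have FE : EFin \o F = (EFin \o F) \_ (cube 0 L).
  apply/funext => x; rewrite patchE; case: ifPn => // /negP xL /=.
  by rewrite sF// => Lx; apply: xL; rewrite inE.
rewrite FE; apply/(integrable_mkcond _ (@cube_measurable R n 0 L)).
apply: measurable_bounded_integrable.
- exact: cube_measurable.
- exact: cube_finite.
- by apply: measurable_funTS; exact: continuous_measurable_rV.
- have := compact_bounded (continuous_compact (continuous_subspaceT cF) (@cube_compact n 0 L)).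
  by move=> [M [Mr HM]]; exists M; split => // a Ma x /= Lx; apply: HM => //; exists x.
Qed.

Lemma is_derive_reparam (V W : normedModType R) (phi : W -> V) (F : V -> R) w w' v d :
  (forall h : R, phi (h *: w' + w) = h *: v + phi w) ->
  is_derive (phi w) v F d -> is_derive w w' (F \o phi) d.
Proof.
move=> phiE [dF dFE].
have E : (fun k : R => k^-1 *: (((F \o phi) \o shift w) (k *: w') - (F \o phi) w)) =
    (fun k : R => k^-1 *: ((F \o shift (phi w)) (k *: v) - F (phi w))).
  by apply/funext => k /=; rewrite phiE.
by apply: DeriveDef; rewrite /derivable /derive E.
Qed.

Lemma rV_cons_lift n (x : R) (v : 'rV[R]_n) j (h : R) :
  rV_cons (x, h *: delta_mx ord0 j + v) =
  h *: delta_mx ord0 (lift ord0 j) + rV_cons (x, v).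
Proof.
apply/rowP => i; rewrite !mxE; case: unliftP => [k ->|->] /=.
  by rewrite !mxE (inj_eq lift_inj).
by rewrite mulr0 add0r.
Qed.

Lemma rV_cons_shift n (x : R) (v : 'rV[R]_n) (h : R) :
  rV_cons (h *: (1 : R) + x : R, v) = h *: delta_mx ord0 ord0 + rV_cons (x, v).
Proof.
apply/rowP => i; rewrite !mxE; case: unliftP => [k ->|->] /=.
  by rewrite mulr0 add0r.
by [].
Qed.

Lemma rV_cons_continuousr n (x : R) : continuous (fun v : 'rV[R]_n => rV_cons (x, v)).
Proof.
move=> v A /= /nbhs_ballP[e /= e0 eA]; apply/nbhs_ballP; exists e => // w [_ vw] /=.
apply: eA; split => // i j; rewrite !mxE; case: unliftP => [k _|_] /=; last exact: ballxx.
exact: vw.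
Qed.

Lemma rV_cons_continuousl n (v : 'rV[R]_n) : continuous (fun x : R => rV_cons (x, v)).
Proof.
move=> x A /= /nbhs_ballP[e /= e0 eA]; apply/nbhs_ballP; exists e => // w xw /=.
apply: eA; split => // i j; rewrite !mxE; case: unliftP => [k _|_] //=.
exact: ballxx.
Qed.

Lemma supported_cons n (F : 'rV[R]_n.+1 -> R) L x : supported F L ->
  supported (fun v => F (rV_cons (x, v))) L.
Proof.
move=> sF v vL; apply: sF => H; apply: vL => j.
by have := H (lift ord0 j); rewrite !mxE liftK.
Qed.

Lemma integral_line_derivative0 (f g : R -> R) L : 0 < L ->
  (forall x : R, is_derive x 1 f (g x)) -> continuous g ->
  (forall x, L < `|x| -> f x = 0) -> (forall x, L < `|x| -> g x = 0) ->
  (\int[@lebesgue_measure R]_x (g x)%:E)%E = 0%E.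
Proof.
move=> L0 df cg f0 g0.
(* The end points must lie strictly beyond [L], since [f] is only known to vanish where
   [|x| > L]. *)
pose b := L + 1; have Lb : L < b by rewrite ltrDl.
have b0 : 0 < b by exact: lt_trans Lb.
have nb : - b < b by rewrite gtrN.
have cf : continuous f.
  by move=> x; apply: differentiable_continuous; apply/derivable1_diffP; have [] := df x.
have := @continuous_FTC2 R g f (- b) b nb (continuous_subspaceT cg).
rewrite !f0 ?normrN ?gtr0_norm// subee// => <-; last 2 first.
- split => [x _||]; first by have [] := df x.
  + exact: cvg_at_right_filter (cf _).
  + exact: cvg_at_left_filter (cf _).
- by move=> x _; rewrite derive1E; have [_ ->] := df x.
rewrite [RHS]integral_mkcond; apply: eq_integral => x _.
rewrite patchE; case: ifPn => // /negP xb.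
rewrite g0//; apply: lt_le_trans Lb _; rewrite leNgt; apply/negP => /ltW.
by rewrite ler_norml => xb'; apply: xb; rewrite inE/= in_itv.
Qed.

(* The fundamental theorem of calculus in the differentiated coordinate, Fubini in the others. *)
Lemma integral_derivative0 n (F G : 'rV[R]_n -> R) i L : 0 < L ->
  (forall x, is_derive x (delta_mx ord0 i) F (G x)) -> continuous G ->
  supported F L -> supported G L -> (\int[lebesgue_rV R n]_x (G x)%:E)%E = 0%E.
Proof.
move=> L0; elim: n F G i => [|n IH] F G i dF cG sF sG; first by case: i {dF}.
have iG := supported_integrable cG sG.
pose cons := @rV_cons R n.
have mG := continuous_measurable_rV cG.
pose EG : 'rV[R]_n.+1 -> \bar R := fun x => (G x)%:E.
have mEG : measurable_fun [set: 'rV[R]_n.+1] EG by exact/measurable_realfun.measurable_EFinP.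
have iGc : (@lebesgue_measure R \x lebesgue_rV R n)%E.-integrable setT
    (EG \o cons).
  apply/integrableP; split.
    by apply: measurableT_comp => //; exact: measurable_rV_cons.
  move/integrableP: iG => [_]; rewrite /= /cons_measure.
  rewrite (@ge0_integral_pushforward _ _ _ _ R _ (@measurable_rV_cons R n)
    (@lebesgue_measure R \x lebesgue_rV R n)%E setT (fun x => `|EG x|%E))//.
  exact: measurableT_comp.
have -> : (\int[lebesgue_rV R n.+1]_x (G x)%:E =
    \int[@lebesgue_measure R \x lebesgue_rV R n]_z (G (cons z))%:E)%E.
  rewrite /= /cons_measure.
  by rewrite (@integral_pushforward _ _ _ _ R _ (@measurable_rV_cons R n)
    (@lebesgue_measure R \x lebesgue_rV R n)%E setT EG).
case: (unliftP ord0 i) => [j|] ij.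
  rewrite -(integral12_prod_meas1 iGc)/=; apply: integral0_eq => x _.
  apply: (IH (fun v => F (cons (x, v))) (fun v => G (cons (x, v))) j).
  - move=> v; apply: (@is_derive_reparam _ _ (fun v => cons (x, v)) F v _
      (delta_mx ord0 i)) => h;
    by rewrite ij; exact: rV_cons_lift.
  - move=> v; apply: (@continuous_comp _ _ _ (fun v => cons (x, v)) G).
      exact: rV_cons_continuousr.
    exact: cG.
  - exact: supported_cons.
  - exact: supported_cons.
rewrite -(integral21_prod_meas1 iGc)/=; apply: integral0_eq => v _.
have out (H : 'rV[R]_n.+1 -> R) (x : R) : supported H L -> L < `|x| -> H (cons (x, v)) = 0.
  move=> sH Lx; apply: sH => /(_ ord0); rewrite !mxE unlift_none/= subr0.
  by rewrite leNgt Lx.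
apply: (@integral_line_derivative0 (fun x => F (cons (x, v))) (fun x => G (cons (x, v))) L L0).
- move=> x; apply: (@is_derive_reparam _ _ (fun x : R => cons (x, v)) F x 1
    (delta_mx ord0 i)) => h;
  by rewrite ij; exact: rV_cons_shift.
- move=> x; apply: (@continuous_comp _ _ _ (fun x : R => cons (x, v)) G).
    exact: rV_cons_continuousl.
  exact: cG.
- by move=> x; exact: out.
- by move=> x; exact: out.
Qed.

End integration.

(** * Integration by parts against test functions *)

Section test_functions.
Variables (R : realType) (n : nat).
Implicit Types (f g h phi : 'rV[R]_n -> R[i]) (U K Omega : set 'rV[R]_n) (x : 'rV[R]_n).
Implicit Types (s t : seq 'I_n) (i j : 'I_n).

Lemma compact_closed_rV K : compact K -> closed K.
Proof. by apply: compact_closed; exact: norm_hausdorff. Qed.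

Lemma compact_open_compl K : compact K -> open (~` K).
Proof. by move=> /compact_closed_rV/closed_openC. Qed.

Lemma words_vanish K f s x : compact K -> (forall x, ~ K x -> f x = 0) ->
  ~ K x -> dw f s x = 0.
Proof.
move=> cK f0; elim: s x => [|i s IH] x Kx /=; first exact: f0.
rewrite (@near_eq_partial _ _ i _ (fun=> 0)) ?partial_cst//.
exact: (eq_on_near (compact_open_compl cK) Kx).
Qed.

(** [U] and the complement of [K] are open and cover the space; [f] is smooth on the first and zero
    on the second. *)
Lemma test_on_extend U K f : open U -> compact K -> K `<=` U -> smooth U f ->
  (forall x, ~ K x -> f x = 0) -> test_on K f.
Proof.
move=> oU cK KU sf f0; split=> //.
apply: (@smooth_coind _ _ setT (fun g => smooth U g /\ forall x, ~ K x -> g x = 0)) => //.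
  exact: openT.
move=> {sf f0}{}f [sf f0]; split=> [x _|i].
  have [Ux|Ux] := pselect (U x); first exact: smooth_C1at sf Ux.
  have Kx : ~ K x by move/KU.
  apply: near_eq_C1at (C1at_cst 0 x).
  by apply: (eq_on_near (compact_open_compl cK) Kx) => y /f0.
exists (partial i f); last by [].
split; first exact: smooth_partial.
by move=> x; exact: (@words_vanish K f [:: i] x cK f0).
Qed.

Lemma test_onM U K f g : open U -> compact K -> K `<=` U -> smooth U f ->
  test_on K g -> test_on K (fun x => f x * g x).
Proof.
move=> oU cK KU sf [sg g0]; apply: (test_on_extend oU cK KU).
  exact: (smoothM oU sf (smooth_sub (@subsetT _ U) sg)).
by move=> x /g0 ->; rewrite mulr0.
Qed.

Lemma test_onD K f g : test_on K f -> test_on K g -> test_on K (fun x => f x + g x).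
Proof.
move=> [sf f0] [sg g0]; split; first exact: (smoothD openT sf sg).
by move=> x Kx; rewrite f0// g0// addr0.
Qed.

Lemma test_on0 K : test_on K (fun=> 0).
Proof. by split=> //; apply: smooth_cst; exact: openT. Qed.

Lemma test_on_sum K (I : Type) (r : seq I) (Q : pred I) (F : I -> 'rV[R]_n -> R[i]) :
  (forall k, Q k -> test_on K (F k)) -> test_on K (fun x => \sum_(k <- r | Q k) F k x).
Proof.
move=> tF; split; first by apply: smooth_sum; [exact: openT|move=> k /tF[]].
by move=> x Kx; rewrite big1// => k /tF[_]; exact.
Qed.

Lemma smooth_Dj U f i : open U -> smooth U f -> smooth U (Dj i f).
Proof. by move=> oU sf; exact: (smoothZ oU (- 'i%C) (smooth_partial i sf)). Qed.

Lemma smooth_Dword U f s : open U -> smooth U f -> smooth U (foldr (@Dj R n) f s).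
Proof. by move=> oU sf; elim: s => [//|i s IH] /=; exact: (smooth_Dj i oU IH). Qed.

Lemma test_on_Dj K f i : compact K -> test_on K f -> test_on K (Dj i f).
Proof.
move=> cK [sf f0]; split; first exact: (smooth_Dj i openT sf).
move=> x Kx; have e : partial i f x = 0 := @words_vanish K f [:: i] x cK f0 Kx.
by rewrite /Dj e mulr0.
Qed.

Lemma test_on_Dword K f s : compact K -> test_on K f ->
  test_on K (foldr (@Dj R n) f s).
Proof. by move=> cK tf; elim: s => [//|i s IH] /=; exact: (test_on_Dj i cK IH). Qed.

Lemma compact_sub_cube K : compact K -> exists2 L : R, 0 < L & K `<=` cube 0 L.
Proof.
move=> /compact_bounded[M [Mr HM]]; exists (`|M| + 1); first by rewrite ltr_wpDl.
move=> x Kx i; rewrite mxE subr0; apply: le_trans (norm_coord_le x i) _.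
by apply: HM => //; rewrite ltr_pwDr// ler_norm.
Qed.

Lemma smooth_continuous f : smooth setT f ->
  continuous (fun x => complex.Re (f x)) /\ continuous (fun x => complex.Im (f x)).
Proof. by move=> sf; split=> x; have [] := sf [::] x Logic.I. Qed.

Lemma test_on_integrable K f : compact K -> test_on K f ->
  (lebesgue_rV R n).-integrable setT (EFin \o (fun x => complex.Re (f x))) /\
  (lebesgue_rV R n).-integrable setT (EFin \o (fun x => complex.Im (f x))).
Proof.
move=> cK [sf f0]; have [L L0 KL] := compact_sub_cube cK.
have [cR cI] := smooth_continuous sf.
by split; apply: (@supported_integrable _ _ _ L) => // x xL; rewrite f0// => /KL.
Qed.

Lemma cintegral_setT Omega K f : test_on K f -> K `<=` Omega ->
  cintegral Omega f = cintegral setT f.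
Proof.
move=> [sf f0] KO; rewrite /cintegral; congr (_ +i* _)%C.
  rewrite Rintegral_mkcond; congr Rintegral; apply/funext => x.
  by rewrite patchE; case: ifPn => // /negP xO; rewrite f0// => /KO/mem_set.
rewrite Rintegral_mkcond; congr Rintegral; apply/funext => x.
by rewrite patchE; case: ifPn => // /negP xO; rewrite f0// => /KO/mem_set.
Qed.

Lemma cintegralD K f g : compact K -> test_on K f -> test_on K g ->
  cintegral setT (fun x => f x + g x) = cintegral setT f + cintegral setT g.
Proof.
move=> cK tf tg; have [iR iI] := test_on_integrable cK tf.
have [jR jI] := test_on_integrable cK tg.
rewrite /cintegral; under eq_Rintegral do rewrite cReD.
under [X in (_ +i* X)%C]eq_Rintegral do rewrite cImD.
by rewrite !RintegralD.
Qed.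

Lemma cintegralZ K (c : R[i]) f : compact K -> test_on K f ->
  cintegral setT (fun x => c * f x) = c * cintegral setT f.
Proof.
move=> cK tf; have [iR iI] := test_on_integrable cK tf.
have iZ (F : 'rV[R]_n -> R) (r : R) : (lebesgue_rV R n).-integrable setT (EFin \o F) ->
    (lebesgue_rV R n).-integrable setT (EFin \o (fun x => r * F x)).
  by move=> iF; exact: (integrableZl measurableT r iF).
apply/eqP; rewrite eq_complex /cintegral cReM cImM /=.
under eq_Rintegral do rewrite cReM.
under [X in (_ == _) && (X == _)]eq_Rintegral do rewrite cImM.
rewrite RintegralB ?RintegralD//; [|exact: iZ|exact: iZ|exact: iZ|exact: iZ].
by rewrite !RintegralZl// !eqxx.
Qed.

Lemma cintegral_sum K (I : Type) (r : seq I) (Q : pred I) (F : I -> 'rV[R]_n -> R[i]) :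
  compact K -> (forall k, Q k -> test_on K (F k)) ->
  cintegral setT (fun x => \sum_(k <- r | Q k) F k x) =
  \sum_(k <- r | Q k) cintegral setT (F k).
Proof.
move=> cK tF; elim: r => [|k r IH].
  rewrite big_nil (_ : (fun x => _) = fun x => 0 * 0).
    by rewrite (@cintegralZ K) ?mul0r//; exact: test_on0.
  by apply/funext => x; rewrite big_nil mul0r.
rewrite big_cons; have [Qk|Qk] := boolP (Q k); last first.
  by rewrite -IH; congr cintegral; apply/funext => x; rewrite big_cons (negbTE Qk).
rewrite -IH -(@cintegralD K)//; [|exact: tF|exact: test_on_sum].
by congr cintegral; apply/funext => x; rewrite big_cons Qk.
Qed.

Lemma cintegral_partial0 K f i : compact K -> test_on K f ->
  cintegral setT (partial i f) = 0.
Proof.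
move=> cK tf; have [sf f0] := tf; have [L L0 KL] := compact_sub_cube cK.
have fv x : ~ cube 0 L x -> f x = 0 by move=> xL; apply: f0 => /KL.
have pv x : ~ cube 0 L x -> partial i f x = 0.
  by move=> xL; apply: (@words_vanish K f [:: i] x cK f0) => /KL.
have [cR cI] := smooth_continuous (smooth_partial i sf).
have sup (p : R[i] -> R) (p0 : p 0 = 0) : supported (fun x => p (f x)) L /\
    supported (fun x => p (partial i f x)) L.
  by split=> x xL; rewrite ?fv// ?pv.
have dR x : is_derive x (delta_mx ord0 i) (fun y => complex.Re (f y))
    (complex.Re (partial i f x)).
  exact (derivableP (@C1at_Re _ _ f x i (smooth_C1at sf Logic.I))).
have dI x : is_derive x (delta_mx ord0 i) (fun y => complex.Im (f y))
    (complex.Im (partial i f x)).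
  exact (derivableP (@C1at_Im _ _ f x i (smooth_C1at sf Logic.I))).
have [sR sR'] := sup (@complex.Re R) erefl; have [sI sI'] := sup (@complex.Im R) erefl.
have zR := @integral_derivative0 R n _ _ i L L0 dR cR sR sR'.
have zI := @integral_derivative0 R n _ _ i L L0 dI cI sI sI'.
by rewrite /cintegral /Rintegral zR zI.
Qed.

Lemma integration_by_parts_Dj K f g i : compact K -> smooth setT f -> test_on K g ->
  cintegral setT (fun x => f x * Dj i g x) = - cintegral setT (fun x => Dj i f x * g x).
Proof.
move=> cK sf tg; have [sg _] := tg.
have tT k : smooth setT k -> forall l, test_on K l -> test_on K (fun x => k x * l x).
  by move=> sk l tl; exact: (test_onM openT cK (@subsetT _ K) sk tl).
have t1 := tT _ sf _ (test_on_Dj i cK tg).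
have t2 := tT _ (smooth_Dj i openT sf) _ tg.
apply/eqP; rewrite -addr_eq0 -(cintegralD cK t1 t2).
rewrite (_ : (fun x => _) = fun x => - 'i%C * partial i (fun y => f y * g y) x).
  rewrite (@cintegralZ K) ?(cintegral_partial0 i cK (tT _ sf _ tg)) ?mulr0//.
  split; first exact: smooth_partial (tT _ sf _ tg).1.
  by move=> x; exact: (@words_vanish K _ [:: i] x cK (tT _ sf _ tg).2).
apply/funext => x; rewrite partialM; [|exact: smooth_C1at sf _|exact: smooth_C1at sg _].
by rewrite /Dj mulrDr addrC !mulrA (mulrC (f x)).
Qed.

Lemma integration_by_parts_word K f g s : compact K -> smooth setT f -> test_on K g ->
  (-1) ^+ size s * cintegral setT (fun x => f x * foldr (@Dj R n) g s x) =
  cintegral setT (fun x => foldr (@Dj R n) f (rev s) x * g x).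
Proof.
move=> cK; elim: s f => [|i s IH] f sf tg /=; first by rewrite mul1r.
rewrite (integration_by_parts_Dj i cK sf (test_on_Dword s cK tg)).
rewrite exprS mulN1r mulNr mulrN opprK IH//; last exact: (smooth_Dj i openT sf).
by rewrite rev_cons -cats1 foldr_cat.
Qed.

End test_functions.

(** * Iterates of the operator, distributions and square norms *)

Section iterates.
Variables (R : realType) (n d : nat).
Implicit Types (f g h phi u : 'rV[R]_n -> R[i]) (U K Omega : set 'rV[R]_n) (x : 'rV[R]_n).
Implicit Types (P : diffop R n d).

(* The reversed words arise by transposing twice: they make [diffop_fun P] the classical counterpart of [diffop_distr P] without commuting derivatives. *)
Definition rev_word (a : {ffun 'I_n -> 'I_d.+1}) := rev (index_word (mnat a)).

Definition diffop_fun P f : 'rV[R]_n -> R[i] := fun x =>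
  \sum_(a : {ffun 'I_n -> 'I_d.+1} | (mlen (mnat a) <= d)%N)
    P a x * foldr (@Dj R n) f (rev_word a) x.

Lemma test_on_diffop_fun Omega P K f : open Omega -> compact K -> K `<=` Omega ->
  (forall a, (mlen (mnat a) <= d)%N -> smooth Omega (P a)) ->
  test_on K f -> test_on K (diffop_fun P f).
Proof.
move=> oO cK KO sP tf; apply: test_on_sum => a ad.
exact: (test_onM oO cK KO (sP a ad) (test_on_Dword _ cK tf)).
Qed.

Lemma distribution_of_setT Omega K u phi : open Omega -> smooth Omega u ->
  compact K -> K `<=` Omega -> test_on K phi ->
  distribution_of Omega u phi = cintegral setT (fun x => u x * phi x).
Proof.
move=> oO su cK KO tphi.
exact: (cintegral_setT (test_onM oO cK KO su tphi) KO).
Qed.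

Lemma diffop_distr_step Omega P (T : ('rV[R]_n -> R[i]) -> R[i]) f phi :
  open Omega -> (forall a, (mlen (mnat a) <= d)%N -> smooth Omega (P a)) ->
  smooth setT f ->
  (forall psi, test_function Omega psi -> T psi = distribution_of Omega f psi) ->
  test_function Omega phi ->
  diffop_distr P T phi = distribution_of Omega (diffop_fun P f) phi.
Proof.
move=> oO sP sf TE [K [cK KO tphi]].
have sfO : smooth Omega f by exact: (smooth_sub (@subsetT _ Omega) sf).
have tP a : (mlen (mnat a) <= d)%N -> test_on K (fun x => P a x * phi x).
  by move=> ad; exact: (test_onM oO cK KO (sP a ad) tphi).
have sPf : smooth Omega (diffop_fun P f).
  apply: (smooth_sum oO) => a ad; apply: (smoothM oO (sP a ad)).
  exact: (smooth_Dword _ oO sfO).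
rewrite (distribution_of_setT oO sPf cK KO tphi) /diffop_distr.
transitivity (\sum_(a : {ffun 'I_n -> 'I_d.+1} | (mlen (mnat a) <= d)%N)
    cintegral setT (fun x => foldr (@Dj R n) f (rev_word a) x * (P a x * phi x))).
  apply: eq_bigr => a ad; rewrite /mul_distr /Dmulti_distr TE; last first.
    exists K; split; [exact: cK|exact: KO|].
    by rewrite DmultiE; exact: (test_on_Dword _ cK (tP a ad)).
  rewrite (distribution_of_setT oO sfO cK KO); last first.
    by rewrite DmultiE; exact: (test_on_Dword _ cK (tP a ad)).
  rewrite DmultiE -size_index_word.
  by rewrite (integration_by_parts_word (index_word (mnat a)) cK sf (tP a ad)).
rewrite -(@cintegral_sum R n K); [|exact: cK|]; last first.
  move=> a ad; apply: (test_onM openT cK (@subsetT _ K) _ (tP a ad)).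
  exact: (smooth_Dword (rev_word a) openT sf).
congr cintegral; apply/funext => x; rewrite /diffop_fun mulr_suml.
by apply: eq_bigr => a _; rewrite mulrA (mulrC _ (P a x)).
Qed.

(** The support never leaves [K]. Hence every iterate is smooth on the whole space, although the
    coefficients are controlled on [Omega] only, and the one-step identity applies again. *)
Lemma iter_diffop Omega P K u : open Omega -> compact K -> K `<=` Omega ->
  (forall a, (mlen (mnat a) <= d)%N -> smooth Omega (P a)) -> test_on K u ->
  forall k, test_on K (iter k (diffop_fun P) u) /\
    forall phi, test_function Omega phi ->
      iter k (diffop_distr P) (distribution_of Omega u) phi =
      distribution_of Omega (iter k (diffop_fun P) u) phi.
Proof.
move=> oO cK KO sP tu; elim=> [|k [tk IH]] //; split.
  exact: (test_on_diffop_fun oO cK KO sP tk).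
by move=> phi tphi /=; exact: (diffop_distr_step oO sP tk.1 IH tphi).
Qed.

Lemma Rintegral_bound (F : 'rV[R]_n -> R) (B L : R) : continuous F ->
  supported F L -> 0 <= B -> (forall x, `|F x| <= B) ->
  `|Rintegral (lebesgue_rV R n) setT F| <= B * fine (lebesgue_rV R n (cube 0 L)).
Proof.
move=> cF sF B0 FB; have iF := supported_integrable cF sF.
apply: le_trans (le_normr_Rintegral measurableT iF) _.
pose G := (fun _ : 'rV[R]_n => B) \_ (cube 0 L).
have mQ := @cube_measurable R n 0 L.
have iG : (lebesgue_rV R n).-integrable setT (EFin \o G).
  rewrite (_ : EFin \o G = (EFin \o (fun _ : 'rV[R]_n => B)) \_ (cube 0 L)).
    apply/(integrable_mkcond _ mQ); apply: measurable_bounded_integrable => //.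
      exact: cube_finite.
    exact: bounded_cst.
  by apply/funext => x; rewrite /G /= !patchE; case: ifP.
have iaF : (lebesgue_rV R n).-integrable setT (EFin \o (fun x => `|F x|)).
  exact: (integrable_norm iF).
apply: le_trans (le_Rintegral measurableT iaF iG _) _.
  move=> x _; rewrite /G patchE; case: ifPn => [_|/negP xL]; first exact: FB.
  by rewrite sF ?normr0// => /mem_set.
by rewrite /G -Rintegral_mkcond Rintegral_cst.
Qed.

Lemma cintegral_bound K f (B L : R) : test_on K f -> K `<=` cube 0 L -> 0 <= B ->
  (forall x, Normc.normc (f x) <= B) ->
  Normc.normc (cintegral setT f) <= B * (2 * fine (lebesgue_rV R n (cube 0 L))).
Proof.
move=> [sf f0] KL B0 fB; have [cR cI] := smooth_continuous sf.
apply: le_trans (normc_le_absReIm _) _.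
have -> (z : R) : B * (2 * z) = B * z + B * z by rewrite mulrCA; ring.
apply: lerD; apply: Rintegral_bound => //.
- by move=> x xL; rewrite f0// => /KL.
- by move=> x; exact: le_trans (normc_ge_absRe _) (fB x).
- by move=> x xL; rewrite f0// => /KL.
- by move=> x; exact: le_trans (normc_ge_absIm _) (fB x).
Qed.

Lemma distribution_of_is_distribution Omega u (B : R) : open Omega ->
  smooth Omega u -> (forall x, Omega x -> Normc.normc (u x) <= B) ->
  Defs.distribution Omega (distribution_of Omega u).
Proof.
move=> oO su uB; split.
  move=> c phi psi [K1 [cK1 K1O t1]] [K2 [cK2 K2O t2]].
  have cK : compact (K1 `|` K2) by exact: compactU.
  have KO : K1 `|` K2 `<=` Omega by move=> x [/K1O|/K2O].
  have t1' : test_on (K1 `|` K2) phi.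
    by split=> [|x Kx]; [exact: t1.1|apply: t1.2 => ?; apply: Kx; left].
  have t2' : test_on (K1 `|` K2) psi.
    by split=> [|x Kx]; [exact: t2.1|apply: t2.2 => ?; apply: Kx; right].
  have tc : test_on (K1 `|` K2) (fun x => c * phi x).
    exact: (test_onM openT cK (@subsetT _ _) (smooth_cst c openT) t1').
  rewrite (distribution_of_setT oO su cK KO (test_onD tc t2')).
  rewrite !(distribution_of_setT oO su cK KO)//.
  have t3 := test_onM oO cK KO su t1'; have t4 := test_onM oO cK KO su t2'.
  rewrite -(cintegralZ c cK t3) -(cintegralD cK _ t4); last first.
    exact: (test_onM openT cK (@subsetT _ _) (smooth_cst c openT) t3).
  by congr cintegral; apply/funext => x; rewrite mulrDr mulrCA.
move=> K cK KO; have [L L0 KL] := compact_sub_cube cK.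
(* The distribution has order [0]. The absolute value covers an empty [Omega], for which [B] may be
   negative. *)
exists (`|B| * (2 * fine (lebesgue_rV R n (cube 0 L)))), 0%N => phi B' tphi phiB.
have B'phi x : Normc.normc (phi x) <= B'.
  have := phiB (fun=> 0%N) x; rewrite DmultiE (_ : index_word _ = [::]); last first.
    by apply: size0nil; rewrite size_index_word /mlen big1.
  by apply; rewrite /mlen big1.
have B'0 : 0 <= B' by exact: le_trans (normc_ge0 _) (B'phi 0).
have KLu := test_onM oO cK KO su tphi.
rewrite (distribution_of_setT oO su cK KO tphi) mulrAC.
apply: (cintegral_bound KLu KL) => [|x]; first exact: mulr_ge0.
have [Kx|Kx] := pselect (K x); last first.
  by rewrite (KLu.2 x Kx) Normc.normc0 mulr_ge0.
rewrite Normc.normcM; apply: ler_pM; rewrite ?normc_ge0//.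
exact: le_trans (uB x (KO x Kx)) (ler_norm B).
Qed.

(** The bound depends on the support of [f] and not on [K], so that one estimate will serve all
    compact sets. *)
Lemma L2norm_le K f (B L : R) : compact K -> smooth setT f ->
  (forall x, ~ cube 0 L x -> f x = 0) -> 0 <= B ->
  (forall x, Normc.normc (f x) <= B) ->
  (L2norm K f <= (B * Num.sqrt (fine (lebesgue_rV R n (cube 0 L))))%:E)%E.
Proof.
move=> cK sf f0 B0 fB; have [cR cI] := smooth_continuous sf.
have mK : measurable K.
  by rewrite -[K]setCK; apply: measurableC; exact: open_measurable_rV (compact_open_compl cK).
have mQ := @cube_measurable R n 0 L.
have fQ := @cube_finite R n L.
(* The squared modulus as a polynomial in the components, hence continuous and measurable. *)
pose S x := complex.Re (f x) * complex.Re (f x) + complex.Im (f x) * complex.Im (f x).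
have cS : continuous S.
  move=> x; exact (continuous_addf (continuous_mulf (cR x) (cR x))
    (continuous_mulf (cI x) (cI x))).
have SE x : S x = Normc.normc (f x) ^+ 2.
  rewrite /S -!expr2; case: (f x) => a b /=; rewrite sqr_sqrtr// addr_ge0 ?sqr_ge0//.
have S0 x : 0 <= S x by rewrite SE sqr_ge0.
have SB x : S x <= B ^+ 2 by rewrite SE ler_pXn2r ?nnegrE ?normc_ge0.
pose g : 'rV[R]_n -> \bar R := (fun x => (S x)%:E) \_ K.
pose G : 'rV[R]_n -> \bar R := (fun=> (B ^+ 2)%:E) \_ (cube 0 L).
have gG : (\int[lebesgue_rV R n]_x g x <= \int[lebesgue_rV R n]_x G x)%E.
  apply: ge0_le_integral => //.
  - by move=> x _; rewrite /g patchE; case: ifP => // _; rewrite lee_fin.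
  - apply/(measurable_restrictT _ mK); apply: measurable_funTS.
    exact: ((measurable_EFinP _ _).2 (continuous_measurable_rV cS)).
  - by apply/(measurable_restrictT _ mQ); exact: measurable_cst.
  - move=> x _; rewrite /g /G !patchE.
    have [xL|xL] := boolP (x \in cube 0 L).
      by case: ifP => _; rewrite lee_fin ?sqr_ge0.
    have -> : S x = 0.
      by rewrite SE f0 ?Normc.normc0 ?expr0n// => /mem_set; exact/negP.
    by case: ifP.
rewrite /L2norm unlock.
have -> : (\int[lebesgue_rV R n]_x `|((fun x => (Normc.normc (f x))%:E) \_ K) x| `^ 2 =
  \int[lebesgue_rV R n]_x g x)%E.
  apply: eq_integral => x _; rewrite /g !patchE; case: ifP => _.
    by rewrite /= powR_mulrn// SE ger0_norm// normc_ge0.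
  by rewrite abse0 poweR0r.
have GE : (\int[lebesgue_rV R n]_x G x = (B ^+ 2)%:E * lebesgue_rV R n (cube 0 L))%E.
  by rewrite /G -integral_mkcond; exact: integral_cst.
rewrite GE in gG.
apply: (@le_trans _ _ (((B ^+ 2)%:E * lebesgue_rV R n (cube 0 L)) `^ 2^-1)%E).
  apply: gt0_ler_poweR => //; rewrite ?in_itv/= ?leey ?andbT.
  - by apply: integral_ge0 => x _; rewrite /g patchE; case: ifP => // _; rewrite lee_fin.
  - by rewrite mule_ge0// lee_fin sqr_ge0.
rewrite -[lebesgue_rV R n _]fineK ?ge0_fin_numE//.
rewrite -EFinM poweR_EFin powR12_sqrt ?mulr_ge0 ?sqr_ge0 ?fine_ge0//.
by rewrite sqrtrM ?sqr_ge0// sqrtr_sqr ger0_norm.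
Qed.

End iterates.

(** * Compactly supported Gevrey functions *)

Section is_derive_rules.
Variables (R : realType) (V : normedModType R).
Implicit Types (F G : V -> R) (x v : V).

Lemma is_derive_mulf F G x v (a b : R) : is_derive x v F a -> is_derive x v G b ->
  is_derive x v (fun y => F y * G y) (F x * b + G x * a).
Proof.
move=> [dF <-] [dG <-]; apply: DeriveDef; first exact: derivable_mulf.
exact: derive_mulf.
Qed.

Lemma is_derive_addf F G x v (a b : R) : is_derive x v F a -> is_derive x v G b ->
  is_derive x v (fun y => F y + G y) (a + b).
Proof.
move=> [dF <-] [dG <-]; apply: DeriveDef; first exact: derivable_addf.
exact: derive_addf.
Qed.

End is_derive_rules.

Section gevrey_sequence.
Variables (R : realType) (p : nat).
Hypothesis p_gt0 : (0 < p)%N.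

(** The Gevrey sequence of order [1 + 1/p]. The factors are kept apart because in [gevM] the first
    absorbs the binomial coefficient exactly. *)
Definition gev (m : nat) : R := m`!%:R * (m`!%:R `^ p%:R^-1).

Lemma gev_gt0 m : 0 < gev m.
Proof. by rewrite /gev mulr_gt0 ?powR_gt0 ?ltr0n ?fact_gt0. Qed.

Lemma gevS m : gev m <= gev m.+1.
Proof.
have h : m`!%:R <= m.+1`!%:R :> R by rewrite ler_nat factS leq_pmull.
by apply: ler_pM; rewrite ?powR_ge0// ge0_ler_powR ?invr_ge0 ?nnegrE.
Qed.

Lemma gevM m j : (j <= m)%N -> 'C(m, j)%:R * (gev j * gev (m - j)) <= gev m.
Proof.
move=> jm; rewrite /gev.
have -> (a b c x y : R) : a * (b * x * (c * y)) = a * (b * c) * (x * y) by ring.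
rewrite -(natrM _ j`!) -(natrM _ 'C(m, j)) bin_fact//.
apply: ler_wpM2l => //; rewrite -powRM// -natrM.
apply: ge0_ler_powR; rewrite ?invr_ge0 ?nnegrE// ler_nat -(bin_fact jm).
by rewrite leq_pmull// bin_gt0.
Qed.

Lemma expR_ge_exp (x : R) n : 0 <= x -> x ^+ n / n`!%:R <= expR x.
Proof.
case: n => [|n] x0; first by rewrite expr0 fact0 divr1 -expR0 ler_expR.
by apply: le_trans (expR_ge1Dxn n x0); rewrite lerDr.
Qed.

Section flat_function.

(** The derivative of [x^-(i p + m) exp(-x^-p)] has a term with exponent [(i + 1) p + m + 1] and
    factor [p], and one with exponent [i p + m + 1] and factor [-(i p + m)]. *)
Fixpoint flat_coef (m i : nat) : R :=
  if m is m'.+1 then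
    p%:R * (if i is i'.+1 then flat_coef m' i' else 0) - (i * p + m')%:R * flat_coef m' i
  else (i == 0%N)%:R.

Lemma flat_coef_small m i : (m < i)%N -> flat_coef m i = 0.
Proof.
elim: m i => [|m IH] [|i]//= mi; rewrite !IH ?mulr0 ?subr0//.
exact: leqW.
Qed.

(** The weight [i!] is what [y^i <= 2^i i! exp(y / 2)] will demand in [flat_abs_le]. In the
    recursion it costs a factor [i <= m + 1], so the total growth remains that of [m!]. *)
Lemma flat_coef_le m i : `|flat_coef m i| * i`!%:R <= (2 * p + 1)%:R ^+ m * m`!%:R.
Proof.
elim: m i => [|m IH] i; first by case: i => [|i] /=; rewrite ?normr1 ?normr0 ?mul0r ?mul1r// mulr_ge0.
have [im|im] := leqP i m.+1; last by rewrite flat_coef_small// normr0 mul0r mulr_ge0 ?exprn_ge0.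
set A := (2 * p + 1)%:R ^+ m * m`!%:R in IH.
have A0 : 0 <= A by rewrite mulr_ge0 ?exprn_ge0.
have step : `|flat_coef m.+1 i| * i`!%:R <= (p * i + (i * p + m))%:R * A.
  rewrite /= [in leRHS]natrD mulrDl; apply: le_trans (ler_wpM2r _ (ler_normB _ _)) _ => //.
  rewrite mulrDl; apply: lerD; last first.
    by rewrite normrM normr_nat -mulrA; apply: ler_wpM2l.
  case: i {im} => [|i]; first by rewrite mulr0 normr0 mul0r muln0 mul0r.
  rewrite normrM normr_nat factS natrM natrM -!mulrA; apply: ler_wpM2l => //.
  by rewrite mulrCA; apply: ler_wpM2l.
apply: le_trans step _; rewrite exprS factS natrM.
have -> : (2 * p + 1)%:R * (2 * p + 1)%:R ^+ m * (m.+1%:R * m`!%:R) =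
  ((2 * p + 1) * m.+1)%:R * A by rewrite /A natrM; ring.
apply: ler_wpM2r => //; rewrite ler_nat.
have : (i * p <= m.+1 * p)%N by rewrite leq_mul2r im orbT.
by nia.
Qed.

(** The [m]-th derivative of [exp(-x^-p)], extended by zero. *)
Definition flat (m : nat) (x : R) : R :=
  if 0 < x then
    (\sum_(i < m.+1) flat_coef m i * x^-1 ^+ (i * p + m)) * expR (- (x^-1 ^+ p))
  else 0.

Lemma flat_le0 m x : x <= 0 -> flat m x = 0.
Proof. by move=> x0; rewrite /flat ltNge x0. Qed.

Lemma flat0_gt0 x : 0 < x -> 0 < flat 0 x.
Proof. by move=> x0; rewrite /flat x0 big_ord1/= mul0n expr0 !mul1r expR_gt0. Qed.

Lemma flat0_ge0 x : 0 <= flat 0 x.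
Proof. by have [x0|x0] := ltP 0 x; [rewrite ltW ?flat0_gt0|rewrite flat_le0]. Qed.

(* [X ^ p] with [X = z^N e^(-z^p/2)] is [y^N e^(-py/2)] with [y = z^p]. *)
Lemma exp_flat_le (z : R) N : 0 <= z ->
  (z ^+ N * expR (- (z ^+ p) / 2)) ^+ p <= N`!%:R * 2 ^+ N.
Proof.
move=> z0; rewrite exprMn -exprM mulnC exprM -expRM_natl.
set y := z ^+ p; have y0 : 0 <= y by rewrite exprn_ge0.
have p1 : 1 <= p%:R :> R by rewrite ler1n.
apply: (@le_trans _ _ (y ^+ N * expR (- (y / 2)))).
  rewrite ler_wpM2l ?exprn_ge0// ler_expR mulNr mulrN lerN2 ler_peMl//.
  by rewrite divr_ge0.
have h : (y / 2) ^+ N / N`!%:R <= expR (y / 2) by apply: expR_ge_exp; rewrite divr_ge0.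
rewrite ler_pdivrMr ?ltr0n ?fact_gt0// in h.
rewrite expRN ler_pdivrMr ?expR_gt0//.
have -> : y ^+ N = 2 ^+ N * (y / 2) ^+ N by rewrite -exprMn mulrCA divff// mulr1.
apply: le_trans (ler_wpM2l _ h) _; first by rewrite exprn_ge0.
by rewrite le_eqVlt; apply/orP; left; apply/eqP; ring.
Qed.

(** With [y = x^-p], half of the exponential absorbs the powers [y^i]; the other half is kept to
    absorb [x^-m]. *)
Lemma flat_abs_le m x : 0 < x ->
  `|flat m x| <= (2 * p + 1)%:R ^+ m * m`!%:R * 2 ^+ m.+1 *
    (x^-1 ^+ m * expR (- (x^-1 ^+ p) / 2)).
Proof.
move=> x0; rewrite /flat x0 normrM (ger0_norm (expR_ge0 _)).
set z := x^-1; have z0 : 0 <= z by rewrite invr_ge0 ltW.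
set y := z ^+ p; have y0 : 0 <= y by rewrite exprn_ge0.
set A := (2 * p + 1)%:R ^+ m * m`!%:R.
have A0 : 0 <= A by rewrite mulr_ge0 ?exprn_ge0.
have term (i : nat) : `|flat_coef m i * z ^+ (i * p + m)| <= A * 2 ^+ i * (z ^+ m * expR (y / 2)).
  rewrite normrM (ger0_norm (exprn_ge0 _ z0)) exprD mulnC exprM -/y.
  have h : (y / 2) ^+ i / i`!%:R <= expR (y / 2) by apply: expR_ge_exp; rewrite divr_ge0.
  have -> : `|flat_coef m i| * (y ^+ i * z ^+ m) =
      (`|flat_coef m i| * i`!%:R) * (2 ^+ i * (z ^+ m * ((y / 2) ^+ i / i`!%:R))).
    have f0 : i`!%:R != 0 :> R by rewrite pnatr_eq0 -lt0n fact_gt0.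
    have t0 : 2 ^+ i != 0 :> R by rewrite expf_neq0.
    by rewrite expr_div_n; field; rewrite f0 t0.
  rewrite -(mulrA A); apply: ler_pM; rewrite ?flat_coef_le ?mulr_ge0 ?exprn_ge0//.
    by rewrite !divr_ge0.
  by rewrite !ler_wpM2l ?exprn_ge0.
apply: (@le_trans _ _ ((\sum_(i < m.+1) A * 2 ^+ i * (z ^+ m * expR (y / 2))) * expR (- y))).
  apply: ler_wpM2r; first exact: expR_ge0.
  by apply: le_trans (ler_norm_sum _ _ _) _; apply: ler_sum => i _; exact: term.
rewrite -mulr_suml -mulr_sumr -!mulrA -expRD.
have -> : y / 2 + - y = - y / 2 by field.
rewrite !mulrA; apply: ler_wpM2r; first exact: expR_ge0.
apply: ler_wpM2r; first exact: exprn_ge0.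
apply: ler_wpM2l => //; have := subrX1 (2 : R) m.+1.
have -> : (2 - 1 : R) = 1 by ring.
by rewrite mul1r => <-; rewrite lerBlDr lerDl.
Qed.

Lemma flat_gev m x : `|flat m x| <= 2 * (4 * (2 * p + 1)%:R) ^+ m * gev m.
Proof.
have [x0|x0] := leP x 0.
  by rewrite flat_le0// normr0 !mulr_ge0 ?exprn_ge0 ?ltW// gev_gt0.
apply: le_trans (flat_abs_le m x0) _.
set z := x^-1; have z0 : 0 <= z by rewrite invr_ge0 ltW.
set X := z ^+ m * _; have X0 : 0 <= X by rewrite mulr_ge0 ?exprn_ge0 ?expR_ge0.
(* Taking the [p]-th root in [exp_flat_le] yields [m!^(1/p)], the second factor of [gev]. *)
have XE : X = (X ^+ p) `^ p%:R^-1.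
  by rewrite -powR_mulrn// -powRrM divff ?powRr1// pnatr_eq0 -lt0n.
have XB : X <= m`!%:R `^ p%:R^-1 * 2 ^+ m.
  rewrite XE; apply: (@le_trans _ _ ((m`!%:R * 2 ^+ m) `^ p%:R^-1)).
    apply: ge0_ler_powR; [by rewrite invr_ge0|by rewrite nnegrE exprn_ge0| |].
      by rewrite nnegrE mulr_ge0 ?exprn_ge0.
    exact: exp_flat_le.
  rewrite powRM ?exprn_ge0//; apply: ler_wpM2l; first exact: powR_ge0.
  rewrite -[leRHS]powRr1 ?exprn_ge0//; apply: ler_powR.
    by rewrite exprn_ege1// ler1n.
  by rewrite invf_le1 ?ltr0n// ler1n.
apply: le_trans (ler_wpM2l _ XB) _; first by rewrite !mulr_ge0 ?exprn_ge0.
have E4 : (4 : R) ^+ m = 2 ^+ m * 2 ^+ m by rewrite -exprMn; congr (_ ^+ _); ring.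
rewrite /gev exprMn E4.
by rewrite le_eqVlt; apply/orP; left; apply/eqP; rewrite exprS; ring.
Qed.

(** Two further powers of [1/x] are absorbed by the exponential and given back as [x^2]; this yields
    the zero derivative at the origin. *)
Lemma flat_quadratic m : exists2 C : R, 0 <= C & forall x, `|flat m x| <= C * x ^+ 2.
Proof.
pose D : R := (2 * p + 1)%:R ^+ m * m`!%:R * 2 ^+ m.+1.
have D0 : 0 <= D by rewrite !mulr_ge0 ?exprn_ge0.
pose A : R := (m.+2)`!%:R * 2 ^+ m.+2.
have A1 : 1 <= A by rewrite mulr_ege1 ?exprn_ege1 ?ler1n ?fact_gt0.
exists (D * A); first by rewrite mulr_ge0 ?(le_trans _ A1).
move=> x; have [x0|x0] := leP x 0.
  by rewrite flat_le0// normr0 mulr_ge0 ?sqr_ge0// mulr_ge0 ?(le_trans _ A1).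
apply: le_trans (flat_abs_le m x0) _; rewrite -/D -mulrA; apply: ler_wpM2l => //.
set z := x^-1; have z0 : 0 <= z by rewrite invr_ge0 ltW.
set e := expR _; have e0 : 0 <= e by exact: expR_ge0.
have -> : z ^+ m * e = (z ^+ m.+2 * e) * x ^+ 2.
  have xz : x * z = 1 by rewrite divff// gt_eqF.
  rewrite -[LHS]mulr1 -(expr1n _ 2) -xz exprMn -(addn2 m) exprD; ring.
apply: ler_wpM2r; first exact: sqr_ge0.
set X := z ^+ m.+2 * e; have X0 : 0 <= X by rewrite mulr_ge0 ?exprn_ge0.
have XA : X ^+ p <= A by exact: exp_flat_le.
have [X1|X1] := leP X 1; first exact: le_trans X1 A1.
by apply: le_trans XA; rewrite ler_eXnr// ltW.
Qed.

Lemma flat_is_derive_pos m (x : R) : 0 < x -> is_derive x 1 (flat m) (flat m.+1 x).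
Proof.
move=> x0.
pose G N (y : R) : R := y^-1 ^+ N * expR (- (y^-1 ^+ p)).
have xn : x != 0 by rewrite gt_eqF.
have dz : is_derive x 1 (fun y : R => y^-1) (- x^-1 ^+ 2).
  apply: is_derive_eq (is_deriveV xn (is_derive_id x 1)) _.
  by rewrite scaleNr /GRing.scale/= mulr1 exprVn.
have dP N : is_derive x 1 (fun y : R => y^-1 ^+ N) (- (N%:R * x^-1 ^+ N.+1)).
  elim: N => [|N IH].
    rewrite mul0r oppr0 (_ : (fun y => _) = fun=> 1); first exact: is_derive_cst.
    by apply/funext => y; rewrite expr0.
  rewrite (_ : (fun y => _) = fun y => y^-1 * y^-1 ^+ N); last first.
    by apply/funext => y; rewrite exprS.
  apply: is_derive_eq (is_derive_mulf dz IH) _.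
  by rewrite -(natr1 N) !exprS; ring.
have dE : is_derive x 1 (fun y : R => expR (- (y^-1 ^+ p)))
    (expR (- (x^-1 ^+ p)) * (p%:R * x^-1 ^+ p.+1)).
  have dN : is_derive x 1 (fun y : R => - y^-1 ^+ p) (p%:R * x^-1 ^+ p.+1).
    by apply: is_derive_eq (is_deriveN (dP p)) _; rewrite opprK.
  exact: (is_derive1_comp (is_derive_expR _) dN).
have dG N : is_derive x 1 (G N) (p%:R * G (N + p).+1 x - N%:R * G N.+1 x).
  apply: is_derive_eq (is_derive_mulf (dP N) dE) _.
  by rewrite /G -addnS exprD; ring.
have step : flat m.+1 x = \sum_(i < m.+1) flat_coef m i *
    (p%:R * G (i * p + m + p).+1 x - (i * p + m)%:R * G (i * p + m).+1 x).
  rewrite /flat x0.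
  under [RHS]eq_bigr do rewrite mulrBr.
  rewrite [RHS]sumrB /= mulr_suml.
  under [LHS]eq_bigr do rewrite mulrBl mulrBl.
  rewrite [LHS]sumrB; congr (_ - _).
    rewrite big_ord_recl /= mulr0 !mul0r add0r; apply: eq_bigr => i _.
    rewrite /G /bump /= add1n mulSn -!mulrA mulrCA; congr (_ * (_ * (_ ^+ _ * _))).
    by lia.
  rewrite big_ord_recr /= flat_coef_small// mulr0 !mul0r addr0.
  by apply: eq_bigr => i _; rewrite /G addnS; ring.
rewrite step.
apply: (@near_eq_is_derive _ _ _ (fun y => \sum_(i < m.+1) flat_coef m i * G (i * p + m)%N y)).
  near=> y; have y0 : 0 < y by near: y; exact: lt_nbhsr.
  by rewrite /flat y0 mulr_suml; apply: eq_bigr => i _; rewrite mulrA.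
have dS k : is_derive x 1 (fun y => \sum_(i < k) flat_coef m i * G (i * p + m)%N y)
   (\sum_(i < k) flat_coef m i *
    (p%:R * G (i * p + m + p).+1 x - (i * p + m)%:R * G (i * p + m).+1 x)).
  elim: k => [|k IH].
    rewrite big_ord0 (_ : (fun y => _) = fun=> 0); first exact: is_derive_cst.
    by apply/funext => y; rewrite big_ord0.
  have dk := @is_derive_mulf R R (fun=> flat_coef m k) _ x 1 0 _
    (is_derive_cst (flat_coef m k) x 1) (dG (k * p + m)%N).
  rewrite (_ : (fun y => _) = fun y => (\sum_(i < k) flat_coef m i * G (i * p + m)%N y) +
      flat_coef m k * G (k * p + m)%N y); last first.
    by apply/funext => y; rewrite big_ord_recr.
  rewrite big_ord_recr /=; apply: is_derive_eq (is_derive_addf IH dk) _.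
  by rewrite mulr0 addr0.
exact: dS.
Unshelve. all: by end_near. Qed.

Lemma flat_is_derive m (x : R) : is_derive x 1 (flat m) (flat m.+1 x).
Proof.
have [x0|x0|<-] := ltgtP 0 x; first exact: flat_is_derive_pos.
  rewrite flat_le0 ?ltW//; apply: (@near_eq_is_derive _ _ _ (fun=> 0)).
  by near=> y; rewrite flat_le0// ltW//; near: y; exact: lt_nbhsl.
rewrite flat_le0//; have [C C0 HC] := flat_quadratic m.
apply: (is_derive_quadratic C0) => h.
by rewrite (flat_le0 m (lexx 0)) mulr0 !subr0 addr0 [_ *: _]mulr1; exact: HC.
Unshelve. all: by end_near. Qed.

End flat_function.
End gevrey_sequence.

(** * One-variable Gevrey bump functions *)

Section bump.
Variables (R : realType) (p : nat).
Hypothesis p_gt0 : (0 < p)%N.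
Implicit Types F G : nat -> R -> R.

(** A smooth function is carried together with all its derivatives, so that Gevrey bounds concern
    explicit formulas. *)
Definition jet F := forall m (x : R), is_derive x 1 (F m) (F m.+1 x).

Definition gevrey F := exists C h : R, [/\ 0 <= C, 0 < h &
  forall m x, `|F m x| <= C * h ^+ m * gev R p m].

Lemma jet_continuous F m : jet F -> continuous (F m).
Proof.
move=> jF x; apply: differentiable_continuous; apply/derivable1_diffP.
by have [] := jF m x.
Qed.

Definition jet_affine (a b : R) F : nat -> R -> R := fun m x => a ^+ m * F m (a * x + b).

Lemma jet_affineP a b F : jet F -> jet (jet_affine a b F).
Proof.
move=> jF m x.
have da : is_derive x 1 (fun y : R => a * y + b) a.
  have d1 := @is_derive_mulf R R (fun=> a) id x 1 0 1 (is_derive_cst a x 1) (is_derive_id x 1).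
  apply: is_derive_eq (is_derive_addf d1 (is_derive_cst b x 1)) _.
  by rewrite mulr1 mulr0 !addr0.
have dF := @is_derive1_comp R (F m) (fun y => a * y + b) x _ a (jF m (a * x + b)) da.
have dk := @is_derive_mulf R R (fun=> a ^+ m) _ x 1 0 _ (is_derive_cst (a ^+ m) x 1) dF.
by apply: is_derive_eq dk _; rewrite mulr0 addr0 /jet_affine exprS; ring.
Qed.

Lemma gevrey_affine a b F : `|a| <= 1 -> gevrey F -> gevrey (jet_affine a b F).
Proof.
move=> a1 [C [h [C0 h0 HF]]]; exists C, h; split => // m x.
rewrite /jet_affine normrM normrX; apply: le_trans (HF m (a * x + b)).
by rewrite ler_piMl// exprn_ile1.
Qed.

Definition jet_mul F G : nat -> R -> R := fun m x =>
  \sum_(j < m.+1) 'C(m, j)%:R * (F j x * G (m - j)%N x).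

Lemma jet_mulP F G : jet F -> jet G -> jet (jet_mul F G).
Proof.
move=> jF jG m x.
have dS (k : nat) : is_derive x 1
    (fun y => \sum_(j < k) 'C(m, j)%:R * (F j y * G (m - j)%N y))
    (\sum_(j < k) 'C(m, j)%:R * (F j.+1 x * G (m - j)%N x) +
     \sum_(j < k) 'C(m, j)%:R * (F j x * G (m - j)%N.+1 x)).
  elim: k => [|k IH].
    rewrite !big_ord0 addr0 (_ : (fun y => _) = fun=> 0); first exact: is_derive_cst.
    by apply/funext => y; rewrite big_ord0.
  have dk := @is_derive_mulf R R (fun=> 'C(m, k)%:R : R) _ x 1 0 _
    (is_derive_cst ('C(m, k)%:R : R) x 1) (is_derive_mulf (jF k x) (jG (m - k)%N x)).
  rewrite (_ : (fun y => _) = fun y =>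
      (\sum_(j < k) 'C(m, j)%:R * (F j y * G (m - j)%N y)) +
      'C(m, k)%:R * (F k y * G (m - k)%N y)); last first.
    by apply/funext => y; rewrite big_ord_recr.
  apply: is_derive_eq (is_derive_addf IH dk) _.
  by rewrite !big_ord_recr /=; ring.
by apply: is_derive_eq (dS m.+1) _; rewrite (leibniz_sum (fun j => F j x) (fun j => G j x)).
Qed.

Lemma gevrey_mul F G : gevrey F -> gevrey G -> gevrey (jet_mul F G).
Proof.
move=> [C [h [C0 h0 HF]]] [D [k [D0 k0 HG]]].
pose r := Num.max h k; have r0 : 0 < r by rewrite lt_max h0.
have hr : h <= r by rewrite le_max lexx.
have kr : k <= r by rewrite le_max lexx orbT.
exists (C * D), (2 * r); split; rewrite ?mulr_ge0 ?mulr_gt0// => m x.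
apply: le_trans (ler_norm_sum _ _ _) _.
have g0 := ltW (gev_gt0 R p m).
apply: (@le_trans _ _ (\sum_(j < m.+1) (C * D * r ^+ m * gev R p m))); last first.
  rewrite sumr_const card_ord -[_ *+ m.+1]mulr_natl.
  have -> : C * D * (2 * r) ^+ m * gev R p m = 2 ^+ m * (C * D * r ^+ m * gev R p m).
    by rewrite exprMn; ring.
  apply: ler_wpM2r; first by rewrite !mulr_ge0 ?exprn_ge0// ltW.
  by rewrite -natrX ler_nat ltn_expl.
apply: ler_sum => j _; have jm : (j <= m)%N by rewrite -ltnS.
rewrite normrM normr_nat normrM.
apply: (@le_trans _ _ ('C(m, j)%:R * ((C * r ^+ j * gev R p j) * (D * r ^+ (m - j) * gev R p (m - j)%N)))).
  apply: ler_wpM2l => //; apply: ler_pM => //.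
    apply: le_trans (HF j x) _; apply: ler_wpM2r; first exact: ltW (gev_gt0 _ _ _).
    by rewrite ler_wpM2l// lerXn2r// nnegrE ltW.
  apply: le_trans (HG _ x) _; apply: ler_wpM2r; first exact: ltW (gev_gt0 _ _ _).
  by rewrite ler_wpM2l// lerXn2r// nnegrE ltW.
have -> : 'C(m, j)%:R * ((C * r ^+ j * gev R p j) * (D * r ^+ (m - j) * gev R p (m - j)%N)) =
    C * D * (r ^+ j * r ^+ (m - j)) * ('C(m, j)%:R * (gev R p j * gev R p (m - j)%N)) by ring.
rewrite -exprD subnKC//; apply: ler_wpM2l; last exact: gevM.
by rewrite !mulr_ge0 ?exprn_ge0// ltW.
Qed.

Lemma primitive_exists (b : R -> R) : continuous b -> (forall x, 0 <= b x) ->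
  (forall x, x <= 0 \/ 1 <= x -> b x = 0) -> 0 < b 2^-1 ->
  exists B : R -> R, exists2 k : R, 0 < k &
    [/\ forall x : R, is_derive x 1 B (b x), forall x, x <= 0 -> B x = 0,
        forall x, 1 <= x -> B x = k & forall x, 0 <= B x <= k].
Proof.
move=> cb b0 bz bhalf.
pose mu := @lebesgue_measure R.
pose B x := Rintegral mu `]-oo, x] b.
have ib u : mu.-integrable `]-oo, u] (EFin \o b).
  have iT : mu.-integrable setT (EFin \o b).
    have E : EFin \o b = (EFin \o b) \_ (`[0, 1]%classic : set R).
      apply/funext => x; rewrite patchE; case: ifPn => // /negP xL /=.
      rewrite bz//; have [x0|x0] := leP x 0; [by left|right].
      by rewrite leNgt; apply/negP => x1; apply: xL; rewrite inE/= in_itv/= !ltW.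
    have iI : mu.-integrable `[0, 1] (EFin \o b).
      apply: continuous_compact_integrable; first exact: segment_compact.
      exact: continuous_subspaceT.
    rewrite E; apply/(@integrable_mkcond _ _ R mu `[0, 1]%classic (EFin \o b)) => //.
  by apply: integrableS iT.
have dB (x : R) : is_derive x 1 B (b x).
  have H := @continuous_FTC1 R b -oo%O x (x + 1) (ltr_pwDr ltr01 (lexx x)) (ib _).
  have [d e] : derivable B x 1 /\ (B^`())%classic x = b x.
    by apply: H; rewrite ?ltNyr//; exact: cb.
  by rewrite derive1E in e; exact: DeriveDef.
have B0 x : x <= 0 -> B x = 0.
  move=> x0; rewrite /B /Rintegral integral0_eq// => y /=.
  by rewrite in_itv/= => yx; rewrite bz//; left; exact: le_trans yx x0.
have cB : continuous B.
  by move=> x; apply: differentiable_continuous; apply/derivable1_diffP; have [] := dB x.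
have mvt x y : x < y -> exists2 c, x < c < y & B y - B x = b c * (y - x).
  move=> xy; have [c cxy e] := @MVT R B b x y xy (fun z _ => dB z) (continuous_subspaceT cB).
  by exists c => //; move: cxy; rewrite in_itv.
have incr x y : x <= y -> B x <= B y.
  rewrite le_eqVlt => /predU1P[->//|xy]; have [c _ e] := mvt x y xy.
  by rewrite -subr_ge0 e mulr_ge0// subr_ge0 ltW.
have cst1 x : 1 <= x -> B x = B 1.
  rewrite le_eqVlt => /predU1P[->//|x1]; have [c /andP[c1 _] e] := mvt 1 x x1.
  by apply/eqP; rewrite -subr_eq0 e bz ?mul0r//; right; exact: ltW.
have k0 : 0 < B 1.
  have B00 := B0 0 (lexx 0).
  have B1ge : 0 <= B 1 by rewrite -B00 incr.
  rewrite lt_neqAle B1ge andbT eq_sym; apply/eqP => B1.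
  (* If [B 1 = 0], the increasing function [B] vanishes on [[0, 1]], against [b (1/2) > 0]. *)
  have : 'D_1 B (2^-1 : R) = 0.
    rewrite (@near_eq_derive _ _ _ B (fun=> 0)) ?derive_cst//.
    near=> y; apply: le_anti; apply/andP; split.
      by rewrite -B1 incr// ltW//; near: y; apply: lt_nbhsl; rewrite invf_lt1 ?ltr1n.
    by rewrite -B00 incr// ltW//; near: y; apply: lt_nbhsr; rewrite invr_gt0.
  by have [_ ->] := dB 2^-1 => b2; rewrite b2 ltxx in bhalf.
exists B, (B 1) => //; split => // x.
have [x0|x0] := leP x 0; first by rewrite B0// lexx ltW.
apply/andP; split; first by rewrite -(B0 0 (lexx 0)); apply: incr; exact: ltW.
have [x1|x1] := leP x 1; first exact: incr.
by rewrite cst1// ltW.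
Unshelve. all: by end_near. Qed.

(* [1] near [0], as the product of two mirrored plateaus of a primitive of [exp(-x^-p) exp(-(1-x)^-p)]. *)
Lemma bump_exists : exists Psi : nat -> R -> R, [/\ jet Psi, gevrey Psi,
  forall x, `|x| <= 1 -> Psi 0%N x = 1 & forall x, 2 <= `|x| -> Psi 0%N x = 0].
Proof.
pose f := @flat R p.
have jf : jet f by move=> m x; exact: (flat_is_derive p_gt0).
have gf : gevrey f.
  exists 2, (4 * (2 * p + 1)%:R); split; [by []|by rewrite mulr_gt0 ?ltr0n ?addn1|].
  by move=> m x; exact: (flat_gev p_gt0).
pose b := jet_mul f (jet_affine (-1) 1 f).
have jb : jet b by apply: jet_mulP => //; exact: jet_affineP.
have gb : gevrey b by apply: gevrey_mul => //; apply: gevrey_affine => //; rewrite normrN1.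
have bE x : b 0%N x = f 0%N x * f 0%N (1 - x).
  by rewrite /b /jet_mul big_ord1 /jet_affine/= bin0 expr0 !mul1r mulN1r addrC.
have [||||B [k k0 [dB B0 B1 Bk]]] := @primitive_exists (b 0%N).
- exact: jet_continuous.
- by move=> x; rewrite bE mulr_ge0 ?flat0_ge0.
- move=> x [x0|x1]; rewrite bE; first by rewrite /f flat_le0// mul0r.
  by rewrite mulrC /f flat_le0 ?mul0r// subr_le0.
- have h : 1 - 2^-1 = 2^-1 :> R by field.
  by rewrite bE h mulr_gt0 ?flat0_gt0 ?invr_gt0.
pose BJ (m : nat) : R -> R := if m is m'.+1 then b m' else B.
have jBJ : jet BJ by case=> [|m] x; [exact: dB|exact: jb].
have gBJ : gevrey BJ.
  have [C [h [C0 h0 Hb]]] := gb.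
  have C'0 : 0 <= C / h by rewrite divr_ge0// ltW.
  (* [k] bounds the primitive itself, and [C / h] pays for the shift of all orders by one. *)
  exists (k + C / h), h; split=> [|//|m x]; first by rewrite addr_ge0// ltW.
  have gm := ltW (gev_gt0 R p m).
  rewrite mulrDl mulrDl; case: m gm => [|m] gm /=.
    rewrite -[leLHS]addr0; apply: lerD; last first.
      by rewrite mulr_ge0// mulr_ge0// exprn_ge0// ltW.
    have /andP[Bx0 Bxk] := Bk x.
    by rewrite ger0_norm// expr0 mulr1 /gev fact0 powR1 !mulr1.
  rewrite -[leLHS]add0r; apply: lerD.
    by rewrite mulr_ge0// mulr_ge0 ?(ltW k0)// exprn_ge0// ltW.
  apply: le_trans (Hb m x) _; rewrite exprS mulrA divfK ?gt_eqF//.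
  by apply: ler_wpM2l; [rewrite mulr_ge0// exprn_ge0// ltW|exact: gevS].
(* For [|x| <= 1] both [2 + x] and [2 - x] are at least [1], where [B] equals [k]; for [|x| >= 2]
   one of them is at most [0], where [B] vanishes. *)
pose T := jet_mul (jet_affine 1 2 BJ) (jet_affine (-1) 2 BJ).
have TE x : T 0%N x = B (x + 2) * B (2 - x).
  by rewrite /T /jet_mul big_ord1 /jet_affine/= bin0 !expr0 !mul1r mulN1r (addrC 2).
have jT : jet T by apply: jet_mulP; exact: jet_affineP.
have gT : gevrey T.
  by apply: gevrey_mul; apply: gevrey_affine; rewrite ?normrN1 ?normr1.
have k2 : 0 < k * k by rewrite mulr_gt0.
exists (fun m x => (k * k)^-1 * T m x); split.
- move=> m x.
  have dk := @is_derive_mulf R R (fun=> (k * k)^-1) _ x 1 0 _ (is_derive_cst _ x 1) (jT m x).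
  by apply: is_derive_eq dk _; rewrite mulr0 addr0.
- have [C [h [C0 h0 HT]]] := gT; exists ((k * k)^-1 * C), h; split => //.
    by rewrite mulr_ge0// invr_ge0 ltW.
  move=> m x; rewrite normrM ger0_norm ?invr_ge0 ?(ltW k2)// -!mulrA.
  by rewrite ler_wpM2l ?invr_ge0 ?(ltW k2)// mulrA.
- move=> x; rewrite ler_norml => /andP[x1 x2].
  rewrite TE !B1 ?mulVf ?gt_eqF//.
    by rewrite lerBrDr -lerBrDl; apply: le_trans x2 _; lra.
  by lra.
- move=> x x2; rewrite TE.
  have [x0|x0] := leP 0 x.
    by rewrite ger0_norm// in x2; rewrite [B (2 - x)]B0 ?mulr0// subr_le0.
  by rewrite ltr0_norm// in x2; rewrite B0 ?mul0r ?mulr0//; lra.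
Qed.

End bump.

(** * Plane waves and the conjugated operator *)

Section building_blocks.
Variables (R : realType) (n : nat).
Implicit Types (f g h : 'rV[R]_n -> R[i]) (U : set 'rV[R]_n) (x : 'rV[R]_n).
Implicit Types (s t : seq 'I_n) (i j : 'I_n).

Lemma is_derive_line (V : normedModType R) (F : V -> R) (x v : V) (d : R) :
  is_derive (0 : R) 1 (fun h : R => F (h *: v + x)) d -> is_derive x v F d.
Proof.
move=> [dF dFE].
have E : (fun k : R => k^-1 *: ((F \o shift x) (k *: v) - F x)) =
  (fun k : R => k^-1 *: (((fun h : R => F (h *: v + x)) \o shift 0) (k *: 1)
     - F ((0 : R) *: v + x))).
  apply/funext => k /=; congr (_ *: (F _ - F _)).
    by rewrite addr0 [_%:A]mulr1.
  by rewrite scale0r add0r.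
by apply: DeriveDef; rewrite /derivable /derive E.
Qed.

Lemma C1at_of_is_derive f (D : 'I_n -> R[i]) x :
  {for x, continuous (fun y => complex.Re (f y))} ->
  {for x, continuous (fun y => complex.Im (f y))} ->
  (forall i, is_derive x (delta_mx ord0 i) (fun y => complex.Re (f y)) (complex.Re (D i)) /\
     is_derive x (delta_mx ord0 i) (fun y => complex.Im (f y)) (complex.Im (D i))) ->
  C1at f x /\ forall i, partial i f x = D i.
Proof.
move=> cR cI H; split.
  by split=> // i; have [[? _] [? _]] := H i.
move=> i; have [[_ eR] [_ eI]] := H i.
by rewrite /partial eR eI; case: (D i).
Qed.

Definition coordf i (G : nat -> R -> R) m : 'rV[R]_n -> R[i] :=
  fun x => ((G m (x ord0 i))%:C)%C.

Lemma coordf_C1 i G m x : jet G -> C1at (coordf i G m) x /\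
  forall j, partial j (coordf i G m) x = if j == i then coordf i G m.+1 x else 0.
Proof.
move=> jG; apply: C1at_of_is_derive.
- apply: (@continuous_comp _ _ _ (fun y : 'rV[R]_n => y ord0 i) (G m)).
    exact: coord_continuous.
  exact: jet_continuous.
- exact: continuous_cstf.
move=> j; split; last first.
  by case: ifP => _; exact: (is_derive_cst (0 : R) x (delta_mx ord0 j)).
apply: is_derive_line => /=.
have [->|ji] := eqVneq j i.
  rewrite (_ : (fun h : R => _) = fun h : R => G m (1 * h + x ord0 i)); last first.
    by apply/funext => h; rewrite !mxE !eqxx mulr1 mul1r.
  have := jet_affineP 1 (x ord0 i) jG m 0; rewrite /jet_affine.
  rewrite (_ : (fun y : R => _) = fun h : R => G m (1 * h + x ord0 i)); last first.
    by apply/funext => h; rewrite expr1n mul1r.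
  by rewrite expr1n mulr0 add0r mul1r.
rewrite (_ : (fun h : R => _) = fun=> G m (x ord0 i)); last first.
  by apply/funext => h; rewrite !mxE eqxx eq_sym (negbTE ji) mulr0 add0r.
exact: is_derive_cst.
Qed.

Lemma coordf_smooth U i G m : open U -> jet G -> smooth U (coordf i G m).
Proof.
move=> oU jG; apply: (@smooth_coind _ _ U
  (fun g => g = (fun=> 0) \/ exists m, g = coordf i G m)) => //; last by right; exists m.
move=> _ [->|[{}m ->]]; split.
- by move=> x _; exact: C1at_cst.
- by move=> j; exists (fun=> 0); [left|rewrite partial_cst].
- by move=> x _; have [] := coordf_C1 i m x jG.
move=> j; have [ji|ji] := eqVneq j i.
  exists (coordf i G m.+1); first by right; exists m.+1.
  by move=> x _; have [_ ->] := coordf_C1 i m x jG; rewrite ji eqxx.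
exists (fun=> 0); first by left.
by move=> x _; have [_ ->] := coordf_C1 i m x jG; rewrite (negbTE ji).
Qed.

Lemma coordf_words i G s : jet G -> dw (coordf i G 0) s =
  if all (pred1 i) s then coordf i G (size s) else fun=> 0.
Proof.
move=> jG; elim: s => //= j s ->; apply/funext => x.
case: ifP => [_|_]; last by rewrite partial_cst andbF.
have [_ ->] := coordf_C1 i (size s) x jG.
by rewrite andbT; case: eqP.
Qed.

Lemma normc_real (r : R) : Normc.normc (r%:C)%C = `|r|.
Proof. by rewrite /= expr0n/= addr0 sqrtr_sqr. Qed.

Lemma coordf_words_le i G s x (B : nat -> R) : jet G ->
  (forall m y, `|G m y| <= B m) -> Normc.normc (dw (coordf i G 0) s x) <= B (size s).
Proof.
move=> jG GB; have B0 m : 0 <= B m := le_trans (normr_ge0 _) (GB m 0).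
rewrite coordf_words//; case: ifP => _; first by rewrite normc_real.
by rewrite Normc.normc0.
Qed.

Section plane_wave.
Variables (c xi : 'rV[R]_n) (t : R).

Definition phase x : R := t * \sum_i xi ord0 i * (x ord0 i - c ord0 i).

Definition wave : 'rV[R]_n -> R[i] := fun x => (cos (phase x) +i* sin (phase x))%C.

Lemma phase_line x i (h : R) : phase (h *: delta_mx ord0 i + x) = h * (t * xi ord0 i) + phase x.
Proof.
rewrite /phase (bigD1 i)//= [in RHS](bigD1 i)//= !mxE !eqxx.
rewrite (eq_bigr (fun j => xi ord0 j * (x ord0 j - c ord0 j))).
  by rewrite mulr1; ring.
by move=> j ji; rewrite !mxE eqxx (negbTE ji) mulr0 add0r.
Qed.

Lemma wave_C1 x : C1at wave x /\
  forall i, partial i wave x = ('i * (t * xi ord0 i)%:C)%C * wave x.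
Proof.
have cphase : {for x, continuous phase}.
  apply: (@lipschitz_continuous _ _ _ _ (`|t| * \sum_i `|xi ord0 i|)).
    by rewrite mulr_ge0// sumr_ge0.
  move=> y; rewrite /phase -mulrBr normrM -mulrA; apply: ler_wpM2l => //.
  rewrite -sumrB mulr_suml; apply: le_trans (ler_norm_sum _ _ _) _.
  apply: ler_sum => i _; rewrite -mulrBr normrM; apply: ler_wpM2l => //.
  rewrite (_ : _ - _ - _ = y ord0 i - x ord0 i); last by ring.
  by rewrite (bigD1 i)//= lerDl sumr_ge0.
apply: C1at_of_is_derive => /=.
- by apply: (@continuous_comp _ _ _ phase cos) => //; exact: continuous_cos.
- by apply: (@continuous_comp _ _ _ phase sin) => //; exact: continuous_sin.
move=> i.
have dl : is_derive (0 : R) 1 (fun h : R => h * (t * xi ord0 i) + phase x) (t * xi ord0 i).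
  have d1 := @is_derive_mulf R R id (fun=> t * xi ord0 i) 0 1 1 0 (is_derive_id (0 : R) 1)
    (is_derive_cst (t * xi ord0 i) (0 : R) 1).
  apply: is_derive_eq (is_derive_addf d1 (is_derive_cst (phase x) (0 : R) 1)) _.
  by rewrite mulr0 mulr1 add0r addr0.
split; apply: is_derive_line.
  rewrite (_ : (fun h : R => _) = cos \o (fun h : R => h * (t * xi ord0 i) + phase x)); last first.
    by apply/funext => h /=; rewrite phase_line.
  apply: is_derive_eq (@is_derive1_comp R cos _ 0 _ _ (is_derive_cos _) dl) _.
  by rewrite mul0r add0r /=; ring.
rewrite (_ : (fun h : R => _) = sin \o (fun h : R => h * (t * xi ord0 i) + phase x)); last first.
  by apply/funext => h /=; rewrite phase_line.
apply: is_derive_eq (@is_derive1_comp R sin _ 0 _ _ (is_derive_sin _) dl) _.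
by rewrite mul0r add0r /=; ring.
Qed.

Lemma wave_smooth U : open U -> smooth U wave.
Proof.
move=> oU; apply: (@smooth_coind _ _ U
  (fun g => exists z : R[i], g = fun x => z * wave x)) => //; last first.
  by exists 1; apply/funext => x; rewrite mul1r.
move=> _ [z ->]; split=> [x _|i].
  by apply: C1atM; [exact: C1at_cst|have [] := wave_C1 x].
exists (fun x => z * ('i * (t * xi ord0 i)%:C)%C * wave x).
  by exists (z * ('i * (t * xi ord0 i)%:C)%C).
by move=> x _; have [cw e] := wave_C1 x; rewrite (partialZ i z cw) e mulrA.
Qed.

Lemma normc_wave x : Normc.normc (wave x) = 1.
Proof. by rewrite /= cos2Dsin2 sqrtr1. Qed.

Lemma wave_center : wave c = 1.
Proof.
rewrite /wave /phase big1 ?mulr0 ?cos0 ?sin0// => i _.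
by rewrite subrr mulr0.
Qed.

(* Conjugating [D_i] by the plane wave. *)
Definition Lj i g : 'rV[R]_n -> R[i] := fun x => Dj i g x + ((t * xi ord0 i)%:C)%C * g x.

Lemma smooth_Lj U i g : open U -> smooth U g -> smooth U (Lj i g).
Proof.
move=> oU sg; exact: (smoothD oU (smooth_Dj i oU sg) (smoothZ oU _ sg)).
Qed.

Lemma smooth_Lword U g s : open U -> smooth U g -> smooth U (foldr Lj g s).
Proof. by move=> oU sg; elim: s => [//|i s IH] /=; exact: smooth_Lj. Qed.

Lemma Dj_wave U i g x : smooth U g -> U x ->
  Dj i (fun y => wave y * g y) x = wave x * Lj i g x.
Proof.
move=> sg Ux; have [cw dw] := wave_C1 x.
rewrite /Dj /Lj (partialM i cw (smooth_C1at sg Ux)) dw /Dj.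
have ii : - 'i%C * 'i%C = 1 :> R[i] by rewrite mulNr -expr2 sqr_i opprK.
have -> (a b w u v : R[i]) : a * (b * v * w * u + w * (partial i g x)) =
  w * (a * partial i g x + a * b * v * u) by ring.
by rewrite ii mul1r.
Qed.

Lemma Dword_wave U s g : open U -> smooth U g ->
  eq_on U (foldr (@Dj R n) (fun y => wave y * g y) s)
    (fun x => wave x * foldr Lj g s x).
Proof.
move=> oU sg; elim: s => [//|i s IH] x Ux /=.
rewrite -(Dj_wave i (smooth_Lword s oU sg) Ux) {1 2}/Dj.
by rewrite (near_eq_partial i (eq_on_near oU Ux IH)).
Qed.

End plane_wave.
End building_blocks.

(** * Majorants that survive iteration of the operator *)

Section majorants.
Variables (R : realType) (n : nat).
Variables (U B : set 'rV[R]_n).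
Hypotheses (oU : open U) (BU : B `<=` U).
Variables (W : nat -> R) (K : R).
Hypotheses (W0 : forall m, 0 < W m) (K1 : 1 <= K).
Hypothesis WM : forall j m i, (i <= m)%N ->
  'C(m, i)%:R * (W i * W (j + (m - i))%N) <= K ^+ i * W (j + m)%N.
Variables (tau lam : R).
Hypotheses (tau0 : 0 < tau) (lam0 : 0 < lam).
Implicit Types (f g : 'rV[R]_n -> R[i]) (kap : R) (J : nat).

Definition Wsum J m : R := \sum_(j < J.+1) lam ^+ j * W (j + m)%N.

(* [maj kap J f]: the derivatives of [f] of order [m] are at most [kap tau^m W_m], up to [J] derivatives already spent, each at the price [1/lam]. *)
Definition maj kap J f := forall s x, B x ->
  Normc.normc (dw f s x) <= kap * tau ^+ size s * Wsum J (size s).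

Lemma Wsum_ge0 J m : 0 <= Wsum J m.
Proof. by apply: sumr_ge0 => j _; rewrite mulr_ge0 ?exprn_ge0// ltW. Qed.

Lemma Wsum_mono J J' m : (J <= J')%N -> Wsum J m <= Wsum J' m.
Proof.
move=> JJ; rewrite /Wsum -(big_mkord xpredT (fun j => lam ^+ j * W (j + m)%N)).
rewrite -(big_mkord xpredT (fun j => lam ^+ j * W (j + m)%N)).
rewrite (@big_cat_nat _ _ _ J.+1 0%N J'.+1)//= lerDl.
by apply: sumr_ge0 => j _; rewrite mulr_ge0 ?exprn_ge0// ltW.
Qed.

(** Reindexing [j] to [j + 1]: an additional derivative is converted into the factor [1 / lam] and
    one more term. *)
Lemma WsumS J m : lam * Wsum J m.+1 <= Wsum J.+1 m.
Proof.
rewrite /Wsum [leRHS]big_ord_recl /= mulr_sumr.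
rewrite (eq_bigr (fun j : 'I_J.+1 => lam ^+ (bump 0 j) * W (bump 0 j + m)%N)).
  by rewrite lerDr mulr_ge0 ?exprn_ge0// ltW.
by move=> j _; rewrite /bump /= add1n exprS mulrA addnS.
Qed.

Lemma maj_mono kap kap' J J' f : 0 <= kap -> kap <= kap' -> (J <= J')%N ->
  maj kap J f -> maj kap' J' f.
Proof.
move=> k0 kk JJ mf s x Bx; apply: le_trans (mf s x Bx) _.
apply: ler_pM; rewrite ?Wsum_ge0 ?Wsum_mono ?mulr_ge0 ?exprn_ge0 ?(ltW tau0)//.
by rewrite ler_wpM2r// exprn_ge0// ltW.
Qed.

Lemma majD kap kap' J f g : smooth U f -> smooth U g -> maj kap J f -> maj kap' J g ->
  maj (kap + kap') J (fun x => f x + g x).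
Proof.
move=> sf sg mf mg s x Bx; rewrite (words_D oU s sf sg (BU Bx)).
apply: le_trans (le_normcD _ _) _; rewrite !mulrDl.
by apply: lerD; [exact: mf|exact: mg].
Qed.

Lemma majZ kap J (z : R[i]) f : smooth U f -> maj kap J f ->
  maj (Normc.normc z * kap) J (fun x => z * f x).
Proof.
move=> sf mf s x Bx; rewrite (words_Z oU s z sf (BU Bx)) Normc.normcM -!mulrA.
by apply: ler_wpM2l; [exact: normc_ge0|rewrite mulrA; exact: mf].
Qed.

Lemma maj_partial kap J i f : 0 <= kap -> maj kap J f ->
  maj (kap * (tau / lam)) J.+1 (partial i f).
Proof.
move=> k0 mf s x Bx; rewrite -foldr_partial_rcons.
apply: le_trans (mf _ _ Bx) _; rewrite size_rcons exprS.
have -> : kap * (tau / lam) * tau ^+ size s * Wsum J.+1 (size s) =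
  kap * (tau * tau ^+ size s) * (lam^-1 * Wsum J.+1 (size s)) by ring.
apply: ler_wpM2l; first by rewrite !mulr_ge0 ?exprn_ge0// ltW.
by rewrite ler_pdivlMl// WsumS.
Qed.

Lemma maj_Dj kap J i f : 0 <= kap -> smooth U f -> maj kap J f ->
  maj (kap * (tau / lam)) J.+1 (Dj i f).
Proof.
move=> k0 sf mf.
have := majZ (- 'i%C) (smooth_partial i sf) (maj_partial i k0 mf).
by rewrite normc_i mul1r.
Qed.

Lemma maj_sum (I : Type) (r : seq I) (Q : pred I) (F : I -> 'rV[R]_n -> R[i]) kap J :
  0 <= kap -> (forall k, Q k -> smooth U (F k)) -> (forall k, Q k -> maj kap J (F k)) ->
  maj ((size r)%:R * kap) J (fun x => \sum_(k <- r | Q k) F k x).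
Proof.
move=> k0 sF mF; elim: r => [|k r IH].
  move=> s x Bx; rewrite (words_sum oU s _ sF (BU Bx)) big_nil Normc.normc0.
  by rewrite !mul0r.
move=> s x Bx; rewrite (words_sum oU s _ sF (BU Bx)) big_cons.
have := IH s x Bx; rewrite (words_sum oU s _ sF (BU Bx)) /= => IH'.
have [Qk|Qk] := boolP (Q k); last first.
  apply: le_trans IH' _; rewrite -!mulrA; apply: ler_wpM2r.
    by rewrite mulr_ge0// mulr_ge0 ?Wsum_ge0 ?exprn_ge0// ltW.
  by rewrite ler_nat.
apply: le_trans (le_normcD _ _) _; rewrite -natr1 !mulrDl mul1r addrC.
by apply: lerD => //; exact: mF.
Qed.

Definition coef_maj al (a : 'rV[R]_n -> R[i]) := forall s x, B x ->
  Normc.normc (dw a s x) <= al * (tau / (2 * K)) ^+ size s * W (size s).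

(* The ratio [1 / (2 K)] of the two growth rates turns the Leibniz sum into a geometric one. *)
Lemma maj_coefM al kap J a g : 0 <= al -> 0 <= kap -> smooth U a -> smooth U g ->
  coef_maj al a -> maj kap J g -> maj (2 * al * kap) J (fun x => a x * g x).
Proof.
move=> al0 k0 sa sg ca mg s x Bx.
apply: le_trans (words_M_le oU BU sa sg
  (F := fun m => al * (tau / (2 * K)) ^+ m * W m)
  (G := fun m => kap * tau ^+ m * Wsum J m) ca mg s Bx) _.
set m := size s; have K0 : 0 < K by exact: lt_le_trans K1.
apply: (@le_trans _ _ (\sum_(i < m.+1) (al * kap * tau ^+ m * Wsum J m) * 2^-1 ^+ i)).
  apply: ler_sum => i _; have im : (i <= m)%N by rewrite -ltnS.
  have -> : 'C(m, i)%:R * (al * (tau / (2 * K)) ^+ i * W i *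
      (kap * tau ^+ (m - i) * Wsum J (m - i)%N)) =
      al * kap * (tau ^+ i * tau ^+ (m - i)) * 2^-1 ^+ i * K^-1 ^+ i *
      ('C(m, i)%:R * (W i * Wsum J (m - i)%N)).
    by rewrite invfM !exprMn; ring.
  rewrite -exprD subnKC//.
  have WW : 'C(m, i)%:R * (W i * Wsum J (m - i)%N) <= K ^+ i * Wsum J m.
    rewrite /Wsum !mulr_sumr; apply: ler_sum => j _.
    have -> : 'C(m, i)%:R * (W i * (lam ^+ j * W (j + (m - i))%N)) =
      lam ^+ j * ('C(m, i)%:R * (W i * W (j + (m - i))%N)) by ring.
    rewrite [leRHS]mulrCA; apply: ler_wpM2l; last exact: WM.
    by rewrite exprn_ge0// ltW.
  apply: le_trans (ler_wpM2l _ WW) _.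
    by rewrite !mulr_ge0 ?exprn_ge0 ?invr_ge0// ltW.
  rewrite le_eqVlt; apply/orP; left; apply/eqP.
  have KK : K^-1 ^+ i * K ^+ i = 1 by rewrite -exprMn mulVf ?expr1n// gt_eqF.
  have -> (u v w z y : R) : u * v * w * (z * y) = u * y * v * (w * z) by ring.
  by rewrite KK mulr1.
rewrite -mulr_sumr.
have -> : 2 * al * kap * tau ^+ m * Wsum J m = (al * kap * tau ^+ m * Wsum J m) * 2 by ring.
apply: ler_wpM2l; first by rewrite !mulr_ge0 ?exprn_ge0 ?Wsum_ge0// ltW.
have h := subrX1 (2^-1 : R) m.+1.
have -> : \sum_(i < m.+1) 2^-1 ^+ i = 2 - 2 * 2^-1 ^+ m.+1 :> R.
  have E : \sum_(i < m.+1) 2^-1 ^+ i = (2^-1 ^+ m.+1 - 1) / (2^-1 - 1) :> R.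
    by rewrite h mulrC mulKf// lt_eqF// subr_lt0 invf_lt1// ltr1n.
  by rewrite E; field.
by rewrite gerBl mulr_ge0// exprn_ge0.
Qed.

Section conjugated_operator.
Variables (xi : 'rV[R]_n) (t del ca c : R).
Hypotheses (t1 : 1 <= t) (del0 : 0 < del) (del1 : del <= 1) (tdel : 1 <= del * t).
Hypotheses (ca0 : 0 <= ca) (price : tau / lam <= ca * (t * del)).
Hypotheses (cge : forall i, ca + `|xi ord0 i| <= c) (c1 : 1 <= c).

Let t0 : 0 <= t := le_trans ler01 t1.
Let c0 : 0 <= c := le_trans ler01 c1.
Let ct0 : 0 <= c * t := mulr_ge0 c0 t0.
Let ct1 : 1 <= c * t := mulr_ege1 c1 t1.

(** The derivative costs [tau / lam <= ca t del <= ca t], the multiplication [t |xi_i|]; together at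
    most [c t]. *)
Lemma maj_Lj kap J i g : 0 <= kap -> smooth U g -> maj kap J g ->
  maj (kap * (c * t)) J.+1 (Lj xi t i g).
Proof.
move=> k0 sg mg.
have h1 := maj_Dj i k0 sg mg.
have h2 := majZ ((t * xi ord0 i)%:C)%C sg mg.
have s2 := smoothZ oU ((t * xi ord0 i)%:C)%C sg.
have h2' := maj_mono (mulr_ge0 (normc_ge0 _) k0) (lexx _) (leqnSn J) h2.
have h3 := majD (smooth_Dj i oU sg) s2 h1 h2'.
have tl0 : 0 <= tau / lam by rewrite divr_ge0 ?ltW.
have h0 : 0 <= kap * (tau / lam) + Normc.normc ((t * xi ord0 i)%:C)%C * kap.
  by rewrite addr_ge0// mulr_ge0// normc_ge0.
apply: (maj_mono h0 _ (leqnn _) h3).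
rewrite normc_real normrM (ger0_norm t0) [_ * kap]mulrC -mulrDr; apply: ler_wpM2l => //.
apply: (@le_trans _ _ ((ca + `|xi ord0 i|) * t)); last exact: ler_wpM2r (cge i).
rewrite mulrDl [t * _]mulrC lerD2r; apply: le_trans price _.
by rewrite ler_wpM2l// ler_piMr.
Qed.

Lemma maj_Lword kap J s g : 0 <= kap -> smooth U g -> maj kap J g ->
  maj (kap * (c * t) ^+ size s) (J + size s) (foldr (Lj xi t) g s).
Proof.
move=> k0 sg mg; elim: s => [|i s IH] /=; first by rewrite expr0 mulr1 addn0.
rewrite exprSr mulrA addnS; apply: maj_Lj IH; first by rewrite mulr_ge0 ?exprn_ge0.
exact: smooth_Lword.
Qed.

Definition symbol_word (s : seq 'I_n) : R[i] := \prod_(i <- s) ((t * xi ord0 i)%:C)%C.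

(* At least one derivative falls on [g], which gains the factor [del]. *)
Lemma maj_Ldiff kap J s g : 0 <= kap -> smooth U g -> maj kap J g ->
  maj (kap * (del * (c * t) ^+ size s)) (J + size s)
    (fun x => foldr (Lj xi t) g s x - symbol_word s * g x).
Proof.
move=> k0 sg mg; elim: s => [|i s IH] /=.
  rewrite (_ : (fun x => _) = fun x => 0 * g x); last first.
    by apply/funext => x; rewrite /symbol_word big_nil mul1r subrr mul0r.
  have := majZ 0 sg mg; rewrite Normc.normc0 mul0r => m0.
  apply: (maj_mono (lexx 0) _ _ m0); last by rewrite addn0.
  by rewrite expr0 mulr1 mulr_ge0// ltW.
set G := foldr (Lj xi t) g s; have sG : smooth U G by exact: smooth_Lword.
have mG := maj_Lword s k0 sg mg.
(* Either the new letter differentiates, which costs [t del] instead of [t], or the gain was already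
   made in the shorter word. *)
rewrite (_ : (fun x => _) = fun x => Dj i G x +
    ((t * xi ord0 i)%:C)%C * (G x - symbol_word s * g x)); last first.
  by apply/funext => x; rewrite /symbol_word big_cons /Lj; ring.
have sd : smooth U (fun x => G x - symbol_word s * g x).
  have -> : (fun x => G x - symbol_word s * g x) = fun x => G x + (- symbol_word s) * g x.
    by apply/funext => x; rewrite mulNr.
  exact: (smoothD oU sG (smoothZ oU _ sg)).
have kc0 : 0 <= kap * (c * t) ^+ size s by rewrite mulr_ge0 ?exprn_ge0.
have kd0 : 0 <= kap * (del * (c * t) ^+ size s).
  by rewrite !mulr_ge0 ?exprn_ge0// ltW.
have h1 := maj_Dj i kc0 sG mG.
have h2 := majZ ((t * xi ord0 i)%:C)%C sd IH.
have h2' := maj_mono (mulr_ge0 (normc_ge0 _) kd0) (lexx _) (leqnSn _) h2.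
have h3 := majD (smooth_Dj i oU sG) (smoothZ oU _ sd) h1 h2'.
rewrite addnS; apply: (maj_mono _ _ (leqnn _) h3).
  apply: addr_ge0; apply: mulr_ge0 => //; last exact: normc_ge0.
  by rewrite divr_ge0 ?ltW.
rewrite normc_real normrM (ger0_norm t0) exprS.
have -> : kap * (del * (c * t * (c * t) ^+ size s)) =
  kap * (c * t) ^+ size s * (c * (t * del)) by ring.
have -> : t * `|xi ord0 i| * (kap * (del * (c * t) ^+ size s)) =
  kap * (c * t) ^+ size s * (`|xi ord0 i| * (t * del)) by ring.
rewrite -mulrDr; apply: ler_wpM2l => //.
apply: le_trans (lerD price (lexx _)) _; rewrite -mulrDl.
by apply: ler_wpM2r; [rewrite mulr_ge0// ltW|exact: cge].
Qed.

Variables (d : nat) (P : diffop R n d) (al be : R).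
Hypotheses (sP : forall a : {ffun 'I_n -> 'I_d.+1}, (mlen (mnat a) <= d)%N -> smooth U (P a)).
Hypotheses (al0 : 0 <= al) (be0 : 0 <= be).
Hypotheses (cP : forall a : {ffun 'I_n -> 'I_d.+1}, (mlen (mnat a) <= d)%N -> coef_maj al (P a)).
Hypothesis csym : coef_maj (be * del) (fun x => principal_symbol P x xi).

Definition conj_op g : 'rV[R]_n -> R[i] := fun x =>
  \sum_(a : {ffun 'I_n -> 'I_d.+1} | (mlen (mnat a) <= d)%N)
    P a x * foldr (Lj xi t) g (rev_word a) x.

Lemma size_rev_word (a : {ffun 'I_n -> 'I_d.+1}) : size (rev_word a) = mlen (mnat a).
Proof. by rewrite size_rev size_index_word. Qed.

Lemma prod_index_word (b : 'I_n -> nat) (F : 'I_n -> R[i]) :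
  \prod_(i <- index_word b) F i = \prod_i F i ^+ b i.
Proof.
rewrite /index_word -[RHS]big_enum /=; elim: (enum 'I_n) => [|i r IH] /=.
  by rewrite !big_nil.
rewrite big_cat big_cons -IH /=; congr (_ * _).
by elim: (b i) => [|k IHk] /=; rewrite ?big_nil ?expr0// big_cons exprS IHk.
Qed.

Lemma complexrM (u v : R) : ((u * v)%:C)%C = ((u%:C) * (v%:C))%C :> R[i].
Proof. by rewrite rmorphM. Qed.

Lemma complexrX (u : R) k : ((u ^+ k)%:C)%C = ((u%:C)%C ^+ k) :> R[i].
Proof. by rewrite rmorphXn. Qed.

Lemma symbol_rev_word (a : {ffun 'I_n -> 'I_d.+1}) : mlen (mnat a) = d ->
  symbol_word (rev_word a) =
  ((t ^+ d)%:C)%C * \prod_i ((xi ord0 i)%:C)%C ^+ mnat a i.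
Proof.
move=> ad; rewrite /symbol_word (perm_big (index_word (mnat a))); last by rewrite perm_rev.
rewrite prod_index_word.
under eq_bigr do rewrite complexrM exprMn.
rewrite big_split /= complexrX; congr (_ * _).
rewrite -[X in _ = _ ^+ X]ad /mlen; by elim/big_rec2: _ => [|i k z _ ->]; rewrite ?expr0// exprD.
Qed.

Lemma smooth_conj_op g : smooth U g -> smooth U (conj_op g).
Proof.
move=> sg; apply: (smooth_sum oU) => a ad; apply: (smoothM oU (sP ad)).
exact: smooth_Lword.
Qed.

Definition conj_const : R :=
  #|{ffun 'I_n -> 'I_d.+1}|%:R * (2 * al * c ^+ d) + 2 * be.

(** Each part gains [del] over [t^d] for its own reason: words of order [d] minus their symbols by
    [maj_Ldiff]; words of lower order because [1 <= del t]; the subtracted symbols because they add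
    up to [t^d] times the principal symbol, which is small by [csym]. *)
Lemma maj_conj_op kap J g : 0 <= kap -> smooth U g -> maj kap J g ->
  maj (kap * (conj_const * (del * t ^+ d))) (J + d) (conj_op g).
Proof.
move=> k0 sg mg.
pose H (a : {ffun 'I_n -> 'I_d.+1}) : 'rV[R]_n -> R[i] := fun x =>
  foldr (Lj xi t) g (rev_word a) x -
  (if mlen (mnat a) == d then symbol_word (rev_word a) else 0) * g x.
have kd0 : 0 <= kap * (del * (c * t) ^+ d) by rewrite !mulr_ge0 ?exprn_ge0// ltW.
have sH (a : {ffun 'I_n -> 'I_d.+1}) : smooth U (H a).
  have -> : H a = fun x => foldr (Lj xi t) g (rev_word a) x +
     (- (if mlen (mnat a) == d then symbol_word (rev_word a) else 0)) * g x.
    by apply/funext => x; rewrite /H mulNr.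
  by apply: (smoothD oU _ (smoothZ oU _ sg)); exact: smooth_Lword.
have mH (a : {ffun 'I_n -> 'I_d.+1}) : (mlen (mnat a) <= d)%N -> maj (kap * (del * (c * t) ^+ d)) (J + d) (H a).
  rewrite leq_eqVlt => /predU1P[ad|ad]; rewrite /H.
    rewrite ad eqxx; have := maj_Ldiff (rev_word a) k0 sg mg.
    by rewrite size_rev_word ad.
  rewrite ltn_eqF//.
  rewrite (_ : (fun x => _) = foldr (Lj xi t) g (rev_word a)); last first.
    by apply/funext => x; rewrite mul0r subr0.
  have := maj_Lword (rev_word a) k0 sg mg; rewrite size_rev_word.
  set m := mlen _ in ad *; apply: maj_mono; rewrite ?leq_add2l ?(ltnW ad)//.
    by rewrite mulr_ge0 ?exprn_ge0.
  apply: ler_wpM2l => //; rewrite -(subnKC ad) addSnnS exprD mulrCA.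
  rewrite ler_peMr ?exprn_ge0// exprS mulrA mulr_ege1 ?exprn_ege1//.
  by apply: le_trans tdel _; apply: ler_wpM2l; [exact: ltW|rewrite ler_peMl].
have E : conj_op g = fun x =>
    \sum_(a : {ffun 'I_n -> 'I_d.+1} | (mlen (mnat a) <= d)%N) P a x * H a x +
    ((t ^+ d)%:C)%C * (principal_symbol P x xi * g x).
  apply/funext => x; rewrite /conj_op.
  rewrite (eq_bigr (fun a => P a x * H a x + P a x *
    ((if mlen (mnat a) == d then symbol_word (rev_word a) else 0) * g x))); last first.
    by move=> a _; rewrite /H -mulrDr subrK.
  rewrite big_split /=; congr (_ + _).
  rewrite /principal_symbol mulrA mulr_sumr mulr_suml.
  rewrite [RHS]big_mkcond [LHS]big_mkcond /=; apply: eq_bigr => a _.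
  case: (leqP (mlen (mnat a)) d) => [|ad]; last by rewrite gtn_eqF.
  case: eqP => [ad _|_ _]; last by rewrite mul0r mulr0.
  by rewrite (symbol_rev_word ad); ring.
rewrite E.
have ssym : smooth U (fun x => principal_symbol P x xi).
  apply: (smooth_sum oU) => a /eqP ad.
  rewrite (_ : (fun x => _) = fun x =>
    (\prod_i ((xi ord0 i)%:C)%C ^+ mnat a i) * P a x); last by apply/funext => x; rewrite mulrC.
  by apply: (smoothZ oU _ (sP _)); rewrite ad.
have m1 : maj ((#|{ffun 'I_n -> 'I_d.+1}|)%:R * (2 * al * (kap * (del * (c * t) ^+ d)))) (J + d)
    (fun x => \sum_(a : {ffun 'I_n -> 'I_d.+1} | (mlen (mnat a) <= d)%N) P a x * H a x).
  rewrite cardE -[enum _]/(enum _) enumT; apply: maj_sum.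
  - by apply: mulr_ge0 kd0; exact: mulr_ge0.
  - by move=> a ad; exact: (smoothM oU (sP ad) (sH a)).
  - by move=> a ad; apply: (maj_coefM al0 kd0 (sP ad) (sH a) (cP ad) (mH a ad)).
have bd0 : 0 <= be * del by rewrite mulr_ge0// ltW.
have m2 := maj_coefM bd0 k0 ssym sg csym mg.
have m3 := majZ ((t ^+ d)%:C)%C (smoothM oU ssym sg) m2.
have m3' := maj_mono (mulr_ge0 (normc_ge0 _) (mulr_ge0 (mulr_ge0 (ler0n _ 2) bd0) k0))
  (lexx _) (leq_addr d J) m3.
have s1 : smooth U (fun x => \sum_(a : {ffun 'I_n -> 'I_d.+1} | (mlen (mnat a) <= d)%N) P a x * H a x).
  by apply: (smooth_sum oU) => a ad; exact: (smoothM oU (sP ad) (sH a)).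
have := majD s1 (smoothZ oU _ (smoothM oU ssym sg)) m1 m3'.
rewrite normc_real (ger0_norm (exprn_ge0 _ t0)) /conj_const.
have -> // : #|{ffun 'I_n -> 'I_d.+1}|%:R * (2 * al * (kap * (del * (c * t) ^+ d))) +
   t ^+ d * (2 * (be * del) * kap) =
   kap * ((#|{ffun 'I_n -> 'I_d.+1}|%:R * (2 * al * c ^+ d) + 2 * be) * (del * t ^+ d)).
by rewrite exprMn; ring.
Qed.

Lemma conj_const_ge0 : 0 <= conj_const.
Proof. by rewrite addr_ge0 ?mulr_ge0 ?exprn_ge0. Qed.

Lemma maj_iter_conj_op kap g k : 0 <= kap -> smooth U g -> maj kap 0 g ->
  smooth U (iter k conj_op g) /\
  maj (kap * (conj_const * (del * t ^+ d)) ^+ k) (d * k)%N (iter k conj_op g).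
Proof.
move=> k0 sg mg; elim: k => [|k [IH1 IH2]]; first by rewrite expr0 mulr1 muln0.
split; first exact: smooth_conj_op.
rewrite exprSr mulrA mulnS addnC /=; apply: maj_conj_op => //.
rewrite mulr_ge0// exprn_ge0// mulr_ge0 ?conj_const_ge0// mulr_ge0 ?exprn_ge0//.
exact: ltW.
Qed.

End conjugated_operator.

End majorants.

(** * Weight sequences *)

Lemma powR_ge1 (R : realType) (a r : R) : 1 <= a -> 0 <= r -> 1 <= a `^ r.
Proof. by move=> a1 r0; rewrite -(@powRr0 _ a); exact: ler_powR. Qed.

Lemma powRX (R : realType) (a r : R) k : 0 <= a -> (a `^ r) ^+ k = (a ^+ k) `^ r.
Proof. by move=> a0; rewrite -(powR_mulrn _ a0) -(powR_mulrn _ (powR_ge0 _ _)) -!powRrM mulrC. Qed.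

Section weight_sequence_theory.
Variables (R : realType) (M : nat -> R).
Hypothesis hM : weight_sequence M.

Let mu k := quot M k.

Lemma weight_gt0 k : 0 < M k. Proof. by case: hM. Qed.

Lemma weight0 : M 0 = 1. Proof. by case: hM. Qed.

Lemma weightS k : M k.+1 = M k * mu k.+1.
Proof. by rewrite /mu /quot /= mulrC divfK// gt_eqF// weight_gt0. Qed.

Lemma quot_mono j k : (1 <= j <= k)%N -> mu j <= mu k.
Proof. by case: hM => _ _ _ + _; exact. Qed.

Lemma quot_ge1 k : (0 < k)%N -> 1 <= mu k.
Proof.
move=> k0; apply: (@le_trans _ _ (mu 1%N)); last by apply: quot_mono; rewrite k0.
by rewrite /mu /quot /= weight0 divr1; case: hM.
Qed.

Lemma quot_gt0 k : (0 < k)%N -> 0 < mu k.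
Proof. by move=> k0; exact: lt_le_trans (quot_ge1 k0). Qed.

Lemma weight_ge1 k : 1 <= M k.
Proof.
by elim: k => [|k IH]; rewrite ?weight0// weightS mulr_ege1// quot_ge1.
Qed.

Lemma weight_addn j m : (0 < j)%N -> M j * mu j ^+ m <= M (j + m)%N.
Proof.
move=> j0; elim: m => [|m IH]; first by rewrite expr0 mulr1 addn0.
rewrite exprSr mulrA addnS weightS; apply: ler_pM => //.
- by rewrite mulr_ge0 ?exprn_ge0 ?ltW ?weight_gt0 ?quot_gt0.
- by rewrite ltW ?quot_gt0.
- by apply: quot_mono; rewrite j0 leqW// leq_addr.
Qed.

Lemma weight_subn j m : (m <= j)%N -> M j <= M (j - m)%N * mu j ^+ m.
Proof.
elim: m => [|m IH] mj; first by rewrite expr0 mulr1 subn0.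
apply: le_trans (IH (ltnW mj)) _; rewrite -subnSK// weightS exprS mulrA.
apply: ler_wpM2r; first by rewrite exprn_ge0// ltW// quot_gt0//; case: (j) mj.
apply: ler_wpM2l; first exact: ltW (weight_gt0 _).
by apply: quot_mono; rewrite /= subnSK// leq_subr.
Qed.

(* Log-convexity: the line of slope [mu j] through [j] supports [M]. *)
Lemma weight_support j N : (0 < j)%N -> M j * mu j ^+ N <= M N * mu j ^+ j.
Proof.
move=> j0; have m0 := ltW (quot_gt0 j0); have [jN|Nj] := leqP j N.
  have -> : mu j ^+ N = mu j ^+ (N - j) * mu j ^+ j by rewrite -exprD subnK.
  rewrite mulrA; apply: ler_wpM2r; first exact: exprn_ge0.
  by have := weight_addn (N - j) j0; rewrite subnKC.
have -> : mu j ^+ j = mu j ^+ (j - N) * mu j ^+ N by rewrite -exprD subnK// ltnW.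
rewrite mulrA; apply: ler_wpM2r; first exact: exprn_ge0.
by have := weight_subn (leq_subr N j); rewrite subKn// ltnW.
Qed.

(** Monotonicity of [M_j^(1/j)] without roots: as [M_0 = 1], [M_j <= mu_j^j], and the quotients from
    [j] to [N] are at least [mu_j]. *)
Lemma weight_exp_le j N : (j <= N)%N -> M j ^+ N <= M N ^+ j.
Proof.
case: j => [|j] jN; first by rewrite weight0 expr1n expr0.
have m0 := ltW (quot_gt0 (ltn0Sn j)); have M0 k := ltW (weight_gt0 k).
rewrite -{1}(subnKC jN) exprD.
have h1 : M j.+1 <= mu j.+1 ^+ j.+1.
  by have := weight_subn (leqnn j.+1); rewrite subnn weight0 mul1r.
have h2 := weight_addn (N - j.+1) (ltn0Sn j); rewrite subnKC// in h2.
apply: (@le_trans _ _ ((M j.+1 * mu j.+1 ^+ (N - j.+1)) ^+ j.+1)).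
  rewrite exprMn; apply: ler_wpM2l; first exact: exprn_ge0.
  by rewrite -exprM mulnC exprM lerXn2r ?nnegrE ?exprn_ge0.
by rewrite lerXn2r ?nnegrE ?mulr_ge0 ?exprn_ge0.
Qed.

Lemma weight_powR_le j N (r : R) : (j <= N)%N -> (0 < N)%N -> 0 <= r ->
  M j `^ r <= M N `^ (r * j%:R / N%:R).
Proof.
move=> jN N0 r0; have M0 k := ltW (weight_gt0 k).
have Nn : N%:R != 0 :> R by rewrite pnatr_eq0 -lt0n.
have -> : M j `^ r = (M j ^+ N) `^ (r / N%:R).
  by rewrite -powR_mulrn// -powRrM mulrCA divff// mulr1.
have -> : M N `^ (r * j%:R / N%:R) = (M N ^+ j) `^ (r / N%:R).
  by rewrite -powR_mulrn// -powRrM mulrCA mulrA.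
apply: ge0_ler_powR; rewrite ?nnegrE ?exprn_ge0 ?divr_ge0//.
exact: weight_exp_le.
Qed.

(** [mu_k^s] eventually exceeds [H]. This provides the arbitrary [h > 0] of the Beurling class and
    separates [M^nu] from [M]. *)
Lemma weight_dominates (H s : R) : 0 < s -> exists2 C : R, 0 < C &
  forall k, H ^+ k <= C * M k `^ s.
Proof.
move=> s0; wlog H1 : H / 1 <= H.
  move=> wl; have H1 : 1 <= Num.max 1 `|H| by rewrite le_max lexx.
  have [C C0 HC] := wl _ H1; exists C => // k; apply: (le_trans _ (HC k)).
  apply: le_trans (ler_norm _) _; rewrite normrX lerXn2r ?nnegrE ?normr_ge0//.
  by rewrite le_max lexx orbT.
have [_ _ _ _ /cvgryPge/(_ (H `^ s^-1)) muy] := hM.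
have [k0 _ Hk0] := muy; have H0 : 0 < H := lt_le_trans ltr01 H1.
exists (H ^+ k0); first exact: exprn_gt0.
have step k : (k0 <= k)%N -> H <= mu k `^ s.
  move=> /Hk0 /= h; have -> : H = (H `^ s^-1) `^ s.
    by rewrite -powRrM mulVf ?gt_eqF// powRr1// ltW.
  apply: ge0_ler_powR => //; rewrite ?nnegrE ?powR_ge0 ?(ltW s0)//.
  exact: le_trans (powR_ge0 _ _) h.
move=> k; have [kk0|/ltnW kk0] := leqP k k0.
  apply: (@le_trans _ _ (H ^+ k0)); first exact: ler_weXn2l.
  by rewrite ler_peMr ?exprn_ge0 ?(ltW H0)// powR_ge1 ?weight_ge1// ltW.
rewrite -(subnK kk0); elim: (k - k0)%N => [|m IH].
  by rewrite ler_peMr ?exprn_ge0 ?(ltW H0)// powR_ge1 ?weight_ge1// ltW.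
rewrite addSn weightS exprS powRM; [|exact: ltW (weight_gt0 _)|by rewrite ltW ?quot_gt0].
rewrite mulrC mulrA; apply: ler_pM => //; rewrite ?exprn_ge0 ?(ltW H0)//.
by apply: step; rewrite leqW// leq_addl.
Qed.

Section saddle.
Variables (rho nu : R).
Hypotheses (rho0 : 0 <= rho) (nu0 : 0 < nu).

(* [freq j] is where [N |-> M_N^nu / t^N] is minimal at [N = j]. *)
Definition freq j : R := mu j `^ nu.
Definition amp j : R := M j `^ nu / freq j ^+ j.

Lemma freq_ge1 j : (0 < j)%N -> 1 <= freq j.
Proof.
by move=> j0; rewrite powR_ge1 ?quot_ge1// ltW.
Qed.

Lemma amp_gt0 j : (0 < j)%N -> 0 < amp j.
Proof.
move=> j0; rewrite divr_gt0 ?powR_gt0 ?weight_gt0// exprn_gt0//.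
exact: lt_le_trans (freq_ge1 j0).
Qed.

Lemma amp_le j N : (0 < j)%N -> amp j <= M N `^ nu / freq j ^+ N.
Proof.
move=> j0; have f0 : 0 < freq j := lt_le_trans ltr01 (freq_ge1 j0).
rewrite /amp ler_pdivrMr ?exprn_gt0// mulrAC ler_pdivlMr ?exprn_gt0//.
have m0 := quot_gt0 j0; have M0 k := ltW (weight_gt0 k).
have E (k l : nat) : M k `^ nu * freq j ^+ l = (M k * mu j ^+ l) `^ nu.
  by rewrite (powRM _ (M0 k) (exprn_ge0 _ (ltW m0))) /freq powRX ?ltW.
rewrite !E; apply: ge0_ler_powR; rewrite ?nnegrE ?mulr_ge0 ?exprn_ge0 ?(ltW m0) ?(ltW nu0)//.
exact: weight_support.
Qed.

Lemma amp_le1 j : (0 < j)%N -> amp j <= 1.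
Proof. by move=> j0; apply: le_trans (amp_le 0 j0) _; rewrite weight0 powR1 divr1. Qed.

(** Since [amp j <= 1], it is at most its power [theta = a / N <= 1], and [amp_le] at [N] gives
    [t^a amp j <= M_N^(nu a / N)]. Log-convexity gives [M_i^rho <= M_N^(rho i / N)]; the exponents
    add up to at most [e]. *)
Lemma saddle_bound j N i (a e : R) : (0 < j)%N -> (0 < N)%N -> (i <= N)%N ->
  0 <= a <= N%:R -> nu * a + rho * i%:R <= e * N%:R ->
  freq j `^ a * M i `^ rho * amp j <= M N `^ e.
Proof.
move=> j0 N0 iN /andP[a0 aN] He; have f1 := freq_ge1 j0.
have f0 : 0 < freq j := lt_le_trans ltr01 f1.
have A0 := amp_gt0 j0; have A1 := amp_le1 j0; have M0 k := ltW (weight_gt0 k).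
have NR : 0 < N%:R :> R by rewrite ltr0n.
set th := a / N%:R; have th0 : 0 <= th by rewrite divr_ge0// ltW.
have th1 : th <= 1 by rewrite ler_pdivrMr// mul1r.
have hA : amp j <= (M N `^ nu / freq j ^+ N) `^ th.
  apply: (@le_trans _ _ (amp j `^ th)).
    rewrite -[leLHS]powRr1 ?(ltW A0)//; apply: ger_powR => //.
    by rewrite A0 A1.
  apply: ge0_ler_powR => //; rewrite ?nnegrE ?(ltW A0) ?amp_le// divr_ge0 ?powR_ge0//.
  by rewrite exprn_ge0// ltW.
have EE : freq j `^ a * (M N `^ nu / freq j ^+ N) `^ th = M N `^ (nu * th).
  rewrite powRM ?powR_ge0 ?invr_ge0 ?exprn_ge0 ?(ltW f0)// -powRrM.
  have -> : (freq j ^+ N)^-1 `^ th = (freq j `^ a)^-1.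
    rewrite -powR_mulrn ?(ltW f0)// -powRN -powRrM mulNr /th mulrC divfK ?gt_eqF//.
    by rewrite powRN.
  by rewrite mulrCA divff ?mulr1// gt_eqF// powR_gt0.
have hM' := weight_powR_le iN N0 rho0.
apply: (@le_trans _ _ (M N `^ (nu * th) * M N `^ (rho * i%:R / N%:R))).
  rewrite mulrAC; apply: ler_pM; rewrite ?mulr_ge0 ?powR_ge0 ?(ltW A0)//.
    by rewrite invr_ge0 exprn_ge0// ltW.
  by rewrite -EE; apply: ler_wpM2l => //; exact: powR_ge0.
rewrite -powRD; last by rewrite (gt_eqF (weight_gt0 N)) implybT.
apply: ler_powR; first exact: weight_ge1.
by rewrite /th mulrA -mulrDl ler_pdivrMr.
Qed.

End saddle.
End weight_sequence_theory.

(** * Consequences of the growth index for [M^rho] *)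

Section derivative_of_order_rho.
Variables (R : realType) (M : nat -> R).
Hypothesis hM : weight_sequence M.
Variable rho : R.
Hypotheses (rho0 : 0 < rho) (hgam : ((rho^-1)%:E < gamma_index M)%E).

Let w k := quot M k `^ rho.
Let W := wpow M rho.

Lemma wpow_gt0 k : 0 < W k. Proof. by rewrite powR_gt0// weight_gt0. Qed.

Lemma wpow_ge1 k : 1 <= W k. Proof. by rewrite powR_ge1 ?weight_ge1// ltW. Qed.

Lemma wpowS k : W k.+1 = W k * w k.+1.
Proof.
by rewrite /W /wpow (weightS hM) (powRM _ (ltW (weight_gt0 hM k)) (ltW (quot_gt0 hM _))).
Qed.

(** Some [g > 1 / rho] is admissible in the supremum, and the power [rho] of its inequality has
    exponent [s = g rho > 1]. *)
Lemma quot_powR_almost_increasing : exists s K : R, [/\ 1 < s, 1 <= K &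
  forall j k, (1 <= j <= k)%N -> w j * k%:R `^ s <= K * (w k * j%:R `^ s)].
Proof.
have : ((rho^-1)%:E < ereal_sup [set g%:E | g in
    [set g : R | (0 < g)%R /\ almost_increasing (fun k => quot M k / k%:R `^ g)%R]])%E.
  move: hgam; rewrite /gamma_index lt_max => /orP[|//].
  by rewrite lte_fin ltNge invr_ge0 ltW.
move=> /ereal_sup_gt[_ [g [g0 [C C0 HC]] <-] +]; rewrite lte_fin => rg.
have C1 : 1 <= Num.max 1 C by rewrite le_max lexx.
exists (g * rho), (Num.max 1 C `^ rho); split.
- by rewrite -ltr_pdivrMr// div1r.
- by rewrite powR_ge1// ltW.
move=> j k /andP[j0 jk].
have jp : 0 < j%:R `^ g by rewrite powR_gt0// ltr0n.
have kp : 0 < k%:R `^ g by rewrite powR_gt0// ltr0n (leq_trans j0).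
have qj := ltW (quot_gt0 hM j0); have qk := ltW (quot_gt0 hM (leq_trans j0 jk)).
have E (x y : R) : 0 <= x -> 0 < y `^ g -> x `^ rho * y `^ (g * rho) = (x * y `^ g) `^ rho.
  by move=> x0 y0; rewrite powRrM powRM// ltW.
rewrite /w (E _ _ qj kp) (E _ _ qk jp) -(powRM _ (ltW (lt_le_trans ltr01 C1)) (mulr_ge0 qk (ltW jp))).
apply: (ge0_ler_powR (ltW rho0)); rewrite ?nnegrE.
- exact: mulr_ge0 qj (ltW kp).
- exact: (mulr_ge0 (le_trans ler01 C1) (mulr_ge0 qk (ltW jp))).
have := HC j k; rewrite j0 jk => /(_ isT).
rewrite ler_pdivrMr// mulrA mulrAC ler_pdivlMr// => h.
apply: le_trans h _; rewrite -mulrA; apply: ler_wpM2r; first by rewrite mulr_ge0// ltW.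
by rewrite le_max lexx orbT.
Qed.

(** Induction on [i] with [q = m - i] fixed: the step multiplies the left side by
    [w_(i+1) (q+i+1) / (i+1)], which is at most [K w_(q+i+1)], hence at most [K w_(j+q+i+1)]. The
    shift [j] makes the inequality applicable inside [Wsum]. *)
Lemma wpow_bin : exists2 K : R, 1 <= K & forall j m i, (i <= m)%N ->
  'C(m, i)%:R * (W i * W (j + (m - i))%N) <= K ^+ i * W (j + m)%N.
Proof.
have [s [K [s1 K1 HK]]] := quot_powR_almost_increasing; exists K => // j m i im.
rewrite -{1 3}(subnK im); move: (m - i)%N => q {m im}.
have w0 k : (0 < k)%N -> 0 < w k by move=> k0; rewrite powR_gt0 ?quot_gt0.
have W0 k := ltW (wpow_gt0 k); have K0 : 0 <= K := le_trans ler01 K1.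
(* The exponent [s] is lowered to [1] by [l^(s - 1) <= k^(s - 1)]. *)
have ratio l k : (1 <= l <= k)%N -> w l * k%:R <= K * (w k * l%:R).
  move=> /andP[l0 lk]; have k0 := leq_trans l0 lk.
  have := HK l k; rewrite l0 lk => /(_ isT) h.
  have l0' : 0 < l%:R :> R by rewrite ltr0n.
  have k0' : 0 < k%:R :> R by rewrite ltr0n.
  have E (x : R) : 0 < x -> x `^ s = x * x `^ (s - 1).
    move=> x0; have h1 := powRr1 (ltW x0).
    have := @powRD R x 1 (s - 1); rewrite (gt_eqF x0) implybT h1 => /(_ isT) <-.
    by rewrite subrKC.
  move: h; rewrite (E _ l0') (E _ k0') => h.
  have p0 : 0 < k%:R `^ (s - 1) by rewrite powR_gt0.
  rewrite -(ler_pM2r p0) -mulrA; apply: le_trans h _.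
  rewrite [K * _ * _]mulrC [leRHS]mulrCA; apply: ler_wpM2l => //.
  rewrite !mulrA [_ * w k]mulrC -!mulrA; apply: ler_wpM2l; first exact/ltW/w0.
  rewrite mulrC; apply: ler_wpM2r; first exact: ltW.
  by apply: ge0_ler_powR; rewrite ?nnegrE ?subr_ge0 ?(ltW s1)// ler_nat.
elim: i => [|i IH].
  by rewrite bin0 addn0 expr0 !mul1r /W {1}/wpow (weight0 hM) powR1 mul1r.
have i0 : 0 < i.+1%:R :> R by rewrite ltr0n.
have B : i.+1%:R * 'C(q + i.+1, i.+1)%:R = (q + i).+1%:R * 'C(q + i, i)%:R :> R.
  by rewrite -!natrM addnS -mul_bin_diag.
rewrite -(ler_pM2l i0) (mulrA i.+1%:R) B (wpowS i).
have -> (a b c x y : R) : a * b * (c * x * y) = b * (c * y) * (x * a) by ring.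
apply: le_trans (ler_wpM2r _ IH) _; first by rewrite mulr_ge0 ?ltW ?w0.
have r := ratio i.+1 (q + i).+1 _; rewrite /= ltnS leq_addl in r.
apply: le_trans (ler_wpM2l _ (r isT)) _; first by rewrite mulr_ge0 ?exprn_ge0.
rewrite !addnS wpowS exprSr.
have -> (a b c x y : R) : a * b * (c * (x * y)) = y * (a * c * (b * x)) by ring.
apply: ler_wpM2l; first exact: ltW.
apply: ler_wpM2l; first by rewrite mulr_ge0 ?exprn_ge0.
apply: ler_wpM2l => //; apply: ge0_ler_powR; rewrite ?nnegrE ?(ltW rho0) ?(ltW (quot_gt0 hM _))//.
by apply: (quot_mono hM); rewrite /= ltnS addnC leq_addl.
Qed.

(** Consecutive terms of [gev] have ratio [(m + 1)^(1 + 1/p)], at most [(m + 1)^s] as soon as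
    [1/p <= s - 1]; comparison with index [1], where [w_1 >= 1], bounds this by [K w_(m + 1)]. *)
Lemma gev_wpow : exists p K : _, [/\ (0 < p)%N, 1 <= K &
  forall m, gev R p m <= K ^+ m * W m].
Proof.
have [s [K [s1 K1 HK]]] := quot_powR_almost_increasing.
have K0 : 0 <= K := le_trans ler01 K1.
pose p := (Num.truncn (s - 1)^-1).+1; exists p, K; split=> //.
have ps : 1 + p%:R^-1 <= s.
  rewrite -lerBrDl invf_ple ?posrE ?subr_gt0 ?ltr0n//.
  exact/ltW/Num.Theory.truncnS_gt.
elim=> [|m IH]; first by rewrite expr0 mul1r /gev fact0 powR1 mulr1 wpow_ge1.
have -> : gev R p m.+1 = gev R p m * m.+1%:R `^ (1 + p%:R^-1).
  rewrite powRD ?powRr1 ?pnatr_eq0 ?implybT// /gev factS mulnC natrM powRM//; ring.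
rewrite exprSr wpowS.
have -> (a b c x : R) : a * b * (c * x) = a * c * (b * x) by ring.
apply: le_trans (ler_wpM2r (powR_ge0 _ _) IH) _.
apply: ler_wpM2l; first by rewrite mulr_ge0 ?exprn_ge0// ltW ?wpow_gt0.
apply: (@le_trans _ _ (m.+1%:R `^ s)); first by rewrite ler_powR// ler1n.
have := HK 1%N m.+1 isT; rewrite powR1 mulr1; apply: le_trans.
by rewrite ler_peMl ?powR_ge0// powR_ge1 ?(quot_ge1 hM)// ltW.
Qed.

End derivative_of_order_rho.

(** * Wave packets at a zero of the principal symbol *)

Section operator_limits.
Variables (R : realType) (n d : nat).
Variables (U : set 'rV[R]_n).
Hypothesis oU : open U.
Implicit Types (f g a : 'rV[R]_n -> R[i]) (G : nat -> 'rV[R]_n -> R[i]) (s : seq 'I_n).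
Variable P : diffop R n d.
Hypothesis sP : forall a : {ffun 'I_n -> 'I_d.+1}, (mlen (mnat a) <= d)%N -> smooth U (P a).

(** Pointwise convergence of all derivatives is stable under differentiation and under
    multiplication by smooth coefficients, hence under [P]. *)
Definition words_cvg G g := forall s x, U x -> ccvg (fun N => dw (G N) s x) (dw g s x).

Lemma ccvg_ext (u v : nat -> R[i]) (k l : R[i]) : v =1 u -> l = k -> ccvg u k -> ccvg v l.
Proof. by move=> /funext -> ->. Qed.

Lemma words_cvg_partial i G g : words_cvg G g ->
  words_cvg (fun N => partial i (G N)) (partial i g).
Proof.
move=> Gg s x Ux; apply: (ccvg_ext _ _ (Gg (rcons s i) x Ux)).
  by move=> N; rewrite foldr_partial_rcons.
by rewrite foldr_partial_rcons.
Qed.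

Lemma words_partialM a f i s x : smooth U a -> smooth U f -> U x ->
  dw (fun y => a y * f y) (rcons s i) x =
  dw (fun y => partial i a y * f y) s x + dw (fun y => a y * partial i f y) s x.
Proof.
move=> sa sf Ux; rewrite foldr_partial_rcons.
have E : eq_on U (partial i (fun y => a y * f y))
    (fun y => partial i a y * f y + a y * partial i f y).
  by move=> y Uy; exact: (partialM i (smooth_C1at sa Uy) (smooth_C1at sf Uy)).
rewrite (eq_on_words s oU E Ux).
exact: (words_D oU s (smoothM oU (smooth_partial i sa) sf) (smoothM oU sa (smooth_partial i sf)) Ux).
Qed.

Lemma words_cvgM a G g : smooth U a -> (forall N, smooth U (G N)) -> smooth U g ->
  words_cvg G g -> words_cvg (fun N x => a x * G N x) (fun x => a x * g x).
Proof.
move=> sa sG sg Gg s; elim/last_ind: s a sa G g sG sg Gg => [|s i IH] a sa G g sG sg Gg x Ux.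
  exact: (ccvgM (ccvg_cst (a x)) (Gg [::] x Ux)).
have h1 := IH _ (smooth_partial i sa) _ _ sG sg Gg x Ux.
have h2 := IH _ sa _ _ (fun N => smooth_partial i (sG N)) (smooth_partial i sg)
  (words_cvg_partial i Gg) x Ux.
apply: (ccvg_ext _ _ (ccvgD h1 h2)); last exact: (words_partialM i s sa sg Ux).
by move=> N; exact: (words_partialM i s sa (sG N) Ux).
Qed.

Lemma words_cvg_Dword s G g : (forall N, smooth U (G N)) -> smooth U g -> words_cvg G g ->
  words_cvg (fun N => foldr (@Dj R n) (G N) s) (foldr (@Dj R n) g s).
Proof.
move=> sG sg Gg; elim: s => [//|i s IH].
have sG' N := smooth_partial i (smooth_Dword s oU (sG N)).
have sg' := smooth_partial i (smooth_Dword s oU sg).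
exact: (words_cvgM (smooth_cst (- 'i%C) oU) sG' sg' (words_cvg_partial i IH)).
Qed.

Lemma smooth_diffop_fun f : smooth U f -> smooth U (diffop_fun P f).
Proof.
move=> sf; apply: (smooth_sum oU) => a ad.
exact: (smoothM oU (sP ad) (smooth_Dword _ oU sf)).
Qed.

Lemma smooth_iter_diffop_fun f k : smooth U f -> smooth U (iter k (diffop_fun P) f).
Proof. by move=> sf; elim: k => [//|k IH]; exact: smooth_diffop_fun. Qed.

Lemma words_cvg_diffop_fun G g : (forall N, smooth U (G N)) -> smooth U g -> words_cvg G g ->
  words_cvg (fun N => diffop_fun P (G N)) (diffop_fun P g).
Proof.
move=> sG sg Gg s x Ux.
have sT f (a : {ffun 'I_n -> 'I_d.+1}) : smooth U f -> (mlen (mnat a) <= d)%N ->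
    smooth U (fun x => P a x * foldr (@Dj R n) f (rev_word a) x).
  by move=> sf ad; exact: (smoothM oU (sP ad) (smooth_Dword _ oU sf)).
have := @ccvg_sum R _ (index_enum _) (fun a : {ffun 'I_n -> 'I_d.+1} => (mlen (mnat a) <= d)%N)
  (fun b N => dw (fun x => P b x * foldr (@Dj R n) (G N) (rev_word b) x) s x)
  (fun b => dw (fun x => P b x * foldr (@Dj R n) g (rev_word b) x) s x).
move=> H; apply: (ccvg_ext _ _ (H _)).
- move=> N; exact: (words_sum oU s (index_enum _) (fun b => @sT (G N) b (sG N)) Ux).
- exact: (words_sum oU s (index_enum _) (fun b => @sT g b sg) Ux).
- move=> a ad; exact: (words_cvgM (sP ad) (fun N => smooth_Dword (rev_word a) oU (sG N))
    (smooth_Dword (rev_word a) oU sg) (words_cvg_Dword (rev_word a) sG sg Gg) s Ux).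
Qed.

Lemma words_cvg_iter G g k : (forall N, smooth U (G N)) -> smooth U g -> words_cvg G g ->
  words_cvg (fun N => iter k (diffop_fun P) (G N)) (iter k (diffop_fun P) g).
Proof.
move=> sG sg Gg; elim: k => [//|k IH].
exact: (words_cvg_diffop_fun (fun N => smooth_iter_diffop_fun k (sG N))
  (smooth_iter_diffop_fun k sg) IH).
Qed.

Lemma eq_on_Dword s f g : eq_on U f g ->
  eq_on U (foldr (@Dj R n) f s) (foldr (@Dj R n) g s).
Proof.
move=> fg; elim: s => [//|i s IH] x Ux /=.
by rewrite /Dj (near_eq_partial i (eq_on_near oU Ux IH)).
Qed.

Lemma eq_on_diffop_fun f g : eq_on U f g -> eq_on U (diffop_fun P f) (diffop_fun P g).
Proof.
move=> fg x Ux; rewrite /diffop_fun; apply: eq_bigr => a _.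
by rewrite (eq_on_Dword _ fg Ux).
Qed.

Lemma iter_diffop_fun_lincomb (N : nat) (c : nat -> R[i]) (F : nat -> 'rV[R]_n -> R[i]) k :
  (forall j, smooth U (F j)) ->
  eq_on U (iter k (diffop_fun P) (fun x => \sum_(j < N) c j * F j x))
    (fun x => \sum_(j < N) c j * iter k (diffop_fun P) (F j) x).
Proof.
move=> sF; elim: k => [//|k IH] x Ux; rewrite iterS (eq_on_diffop_fun IH Ux).
have sI j : smooth U (iter k (diffop_fun P) (F j)) by exact: smooth_iter_diffop_fun.
have sS : smooth U (fun x => \sum_(j < N) c j * iter k (diffop_fun P) (F j) x).
  by apply: (smooth_sum oU) => j _; exact: (smoothZ oU _ (sI j)).
rewrite /diffop_fun.
under [RHS]eq_bigr do rewrite /= mulr_sumr.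
rewrite [RHS]exchange_big /=; apply: eq_bigr => a ad.
rewrite (Dwords _ oU sS Ux) (words_sum oU _ (index_enum _) (fun (j : 'I_N) _ => smoothZ oU (c j) (sI j)) Ux).
rewrite !mulr_sumr; apply: eq_bigr => j _.
by rewrite (words_Z oU _ (c j) (sI j) Ux) (Dwords _ oU (sI j) Ux); ring.
Qed.

Lemma iter_diffop_fun_wave x0 xi t g k : smooth U g ->
  eq_on U (iter k (diffop_fun P) (fun x => wave x0 xi t x * g x))
    (fun x => wave x0 xi t x * iter k (conj_op xi t P) g x).
Proof.
move=> sg; elim: k => [//|k IH] x Ux; rewrite iterS (eq_on_diffop_fun IH Ux).
have sI : smooth U (iter k (conj_op xi t P) g).
  by elim: (k) => [//|l IHl]; rewrite iterS; exact: (smooth_conj_op oU xi t sP IHl).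
rewrite /diffop_fun /= {1}/conj_op mulr_sumr; apply: eq_bigr => a _.
by rewrite (Dword_wave x0 xi t _ oU sI Ux) mulrCA.
Qed.

End operator_limits.

Lemma normc_sum_le (R : realType) (I : Type) (r : seq I) (Q : pred I) (F : I -> R[i]) :
  Normc.normc (\sum_(k <- r | Q k) F k) <= \sum_(k <- r | Q k) Normc.normc (F k).
Proof.
elim/big_rec2: _ => [|k u v _ le]; first by rewrite Normc.normc0.
by apply: le_trans (le_normcD _ _) _; rewrite lerD2l.
Qed.

(** * Bounds for the coefficients and the symbol near its zero *)

Section coefficient_bounds.
Variables (R : realType) (n d : nat).
Variables (W : nat -> R) (Omega : set 'rV[R]_n).
Hypotheses (W0 : forall m, 0 < W m) (oO : open Omega).

Lemma open_cube_sub x0 : Omega x0 -> exists2 r : R, 0 < r & cube x0 r `<=` Omega.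
Proof.
move=> Ox; have [r r0 xrU] := open_ball_sub oO Ox; exists (r / 2); first by rewrite divr_gt0.
move=> y xy; apply: xrU; split => // i j; rewrite ord1 -ball_normE /= distrC.
by apply: le_lt_trans (xy j) _; rewrite ltr_pdivrMr// mulr2n mulrDr mulr1 ltrDr.
Qed.

Lemma cube_sub (x0 : 'rV[R]_n) (r r' : R) : r <= r' -> cube x0 r `<=` cube x0 r'.
Proof. by move=> rr x xr i; exact: le_trans (xr i) rr. Qed.

Lemma cube_center (x0 : 'rV[R]_n) (r : R) : 0 <= r -> cube x0 r x0.
Proof. by move=> r0 i; rewrite subrr normr0. Qed.

Variable P : diffop R n d.
Hypothesis hP : coefficients_in (roumieu Omega W) P.

Lemma coefficients_bound K : compact K -> K `<=` Omega ->
  exists C h : R, [/\ 0 < C, 0 < h & forall a, (mlen (mnat a) <= d)%N ->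
    forall s x, K x -> Normc.normc (dw (P a) s x) <= C * h ^+ size s * W (size s)].
Proof.
move=> cK KO.
have : forall a : {ffun 'I_n -> 'I_d.+1}, exists q : R * R, [/\ 0 < q.1, 0 < q.2 &
    (mlen (mnat a) <= d)%N -> forall s x, K x ->
    Normc.normc (dw (P a) s x) <= q.1 * q.2 ^+ size s * W (size s)].
  move=> a; have [ad|] := boolP (mlen (mnat a) <= d)%N; last by exists (1, 1).
  by have [C [h [C0 h0 H]]] := roumieu_words oO (hP ad) cK KO; exists (C, h).
move=> /choice[q Hq].
have q1 a : 0 < (q a).1 by have [] := Hq a.
have q2 a : 0 < (q a).2 by have [] := Hq a.
have S1 : 0 <= \sum_a (q a).1 by rewrite sumr_ge0// => a _; exact: ltW.
have S2 : 0 <= \sum_a (q a).2 by rewrite sumr_ge0// => a _; exact: ltW.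
(* Sums over the finitely many coefficients stand in for maxima. *)
exists (1 + \sum_a (q a).1), (1 + \sum_a (q a).2); rewrite !ltr_pwDl//; split=> // a ad s x Kx.
have [_ _ /(_ ad s x Kx) h] := Hq a; apply: le_trans h _.
apply: ler_wpM2r; first exact: ltW.
apply: ler_pM; rewrite ?exprn_ge0 ?(ltW (q1 a)) ?(ltW (q2 a))//.
  rewrite (bigD1 a)//= addrCA lerDl addr_ge0// sumr_ge0// => b _; exact: ltW.
rewrite lerXn2r ?nnegrE ?(ltW (q2 a)) ?addr_ge0//.
rewrite (bigD1 a)//= addrCA lerDl addr_ge0// sumr_ge0// => b _; exact: ltW.
Qed.

Lemma smooth_symbol xi : smooth Omega (fun x => principal_symbol P x xi).
Proof.
apply: (smooth_sum oO) => a /eqP ad.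
rewrite (_ : (fun x => _) = fun x =>
  (\prod_i ((xi ord0 i)%:C)%C ^+ mnat a i) * P a x); last by apply/funext => x; rewrite mulrC.
by apply: (smoothZ oO); have [] := hP (eq_leq ad).
Qed.

Lemma symbol_bound K xi (C h : R) : K `<=` Omega -> 0 <= C -> 0 <= h ->
  (forall a, (mlen (mnat a) <= d)%N ->
    forall s x, K x -> Normc.normc (dw (P a) s x) <= C * h ^+ size s * W (size s)) ->
  exists2 C' : R, 0 <= C' & forall s x, K x ->
    Normc.normc (dw (fun x => principal_symbol P x xi) s x) <= C' * h ^+ size s * W (size s).
Proof.
move=> KO C0 h0 HC.
pose z (a : {ffun 'I_n -> 'I_d.+1}) : R[i] := \prod_i ((xi ord0 i)%:C)%C ^+ mnat a i.
exists (\sum_a Normc.normc (z a) * C).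
  by apply: sumr_ge0 => a _; rewrite mulr_ge0// normc_ge0.
move=> s x Kx; have Ox := KO _ Kx.
have -> : (fun x => principal_symbol P x xi) = fun x =>
    \sum_(a : {ffun 'I_n -> 'I_d.+1} | mlen (mnat a) == d) z a * P a x.
  by apply/funext => y; apply: eq_bigr => a _; rewrite mulrC.
have sP a : mlen (mnat a) == d -> smooth Omega (P a).
  by move=> /eqP ad; have [] := hP (eq_leq ad).
rewrite (words_sum oO s (index_enum _) (fun a ad => smoothZ oO (z a) (sP a ad)) Ox).
apply: le_trans (normc_sum_le _ _ _) _.
rewrite 2!mulr_suml big_mkcond; apply: ler_sum => a _.
rewrite -!mulrA.
have cc : 0 <= Normc.normc (z a) * (C * (h ^+ size s * W (size s))).
  by rewrite !mulr_ge0 ?normc_ge0 ?exprn_ge0// ltW.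
case: ifPn => [ad|_] //.
rewrite (words_Z oO s (z a) (sP a ad) Ox) Normc.normcM.
apply: ler_wpM2l; first exact: normc_ge0.
by rewrite mulrA; apply: HC => //; rewrite (eqP ad).
Qed.

(* The symbol vanishes at [x0], so it gains a factor [del] on a cube of size [r * del]. *)
Lemma symbol_small x0 xi (C h r del : R) : 0 < r -> 0 <= del <= 1 -> 0 <= C -> 0 <= h ->
  cube x0 r `<=` Omega -> principal_symbol P x0 xi = 0 ->
  (forall s x, cube x0 r x ->
    Normc.normc (dw (fun x => principal_symbol P x xi) s x) <= C * h ^+ size s * W (size s)) ->
  forall x, cube x0 (r * del) x ->
    Normc.normc (principal_symbol P x xi) <= 2 * (C * h * W 1) * n%:R * r * del.
Proof.
move=> r0 /andP[del0 del1] C0 h0 rO q0 HC x xr.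
set q := fun x => principal_symbol P x xi.
have qx : Normc.normc (principal_symbol P x xi) <=
   `|complex.Re (q x) - complex.Re (q x0)| + `|complex.Im (q x) - complex.Im (q x0)|.
  by rewrite {2 4}/q q0 !subr0; exact: normc_le_absReIm.
apply: le_trans qx _.
have E0 : 0 <= C * h * W 1 by rewrite !mulr_ge0// ltW.
have S : \sum_i `|x ord0 i - x0 ord0 i| <= n%:R * (r * del).
  apply: (@le_trans _ _ (\sum_(i < n) r * del)); first by apply: ler_sum => i _; exact: xr.
  by rewrite sumr_const card_ord mulr_natl.
have -> : 2 * (C * h * W 1) * n%:R * r * del = (C * h * W 1) * (n%:R * (r * del)) + (C * h * W 1) * (n%:R * (r * del)).
  by ring.
have zr (z : 'rV[R]_n) : (forall i, `|z ord0 i - x0 ord0 i| <= `|x ord0 i - x0 ord0 i|) -> cube x0 r z.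
  move=> zx i; apply: le_trans (zx i) _; apply: le_trans (xr i) _.
  by rewrite ler_piMr// ltW.
have key (z : 'rV[R]_n) i : cube x0 r z -> C1at q z /\ Normc.normc (partial i q z) <= C * h * W 1.
  move=> zz; split; first exact: (smooth_C1at (smooth_symbol xi) (rO _ zz)).
  by have := HC [:: i] z zz; rewrite /= expr1.
have S' := ler_wpM2l E0 S.
apply: lerD.
  apply: le_trans S'; apply: (@box_lipschitz _ _ (fun y => complex.Re (q y))) => z /zr zz i.
  have [c b] := key z i zz; split; first exact: C1at_Re.
  exact: le_trans (normc_ge_absRe (partial i q z)) b.
apply: le_trans S'; apply: (@box_lipschitz _ _ (fun y => complex.Im (q y))) => z /zr zz i.
have [c b] := key z i zz; split; first exact: C1at_Im.
exact: le_trans (normc_ge_absIm (partial i q z)) b.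
Qed.

End coefficient_bounds.

Lemma words_cst (R : realType) n (c : R[i]) j s :
  dw (fun _ : 'rV[R]_n => c) (j :: s) = fun=> 0.
Proof. by elim: s j => [|k s IH] j; [rewrite /= partial_cst|rewrite [LHS]/= -/(dw _ (k :: s)) IH partial_cst]. Qed.

(** * Cutoffs on small cubes *)

Section cutoff.
Variables (R : realType) (n : nat) (W : nat -> R) (K : R).
Hypotheses (W0 : forall m, 0 < W m) (W01 : W 0%N = 1) (K1 : 1 <= K).
Hypothesis WM : forall j m i, (i <= m)%N ->
  'C(m, i)%:R * (W i * W (j + (m - i))%N) <= K ^+ i * W (j + m)%N.
Variables (Psi : nat -> R -> R) (C h : R).
Hypotheses (jPsi : jet Psi) (C0 : 0 <= C) (h0 : 0 <= h).
Hypothesis PsiB : forall m x, `|Psi m x| <= C * h ^+ m * W m.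
Hypothesis Psi1 : forall x, `|x| <= 1 -> Psi 0%N x = 1.
Hypothesis Psi0 : forall x, 2 <= `|x| -> Psi 0%N x = 0.
Variable x0 : 'rV[R]_n.

Definition cut1 (a : R) (i : 'I_n) := coordf i (jet_affine a (- (a * x0 ord0 i)) Psi) 0.

Definition cutoff (a : R) : 'rV[R]_n -> R[i] := fun x => \prod_(i <- index_enum 'I_n) cut1 a i x.

Lemma cut1E a i (x : 'rV[R]_n) : cut1 a i x = ((Psi 0%N (a * (x ord0 i - x0 ord0 i)))%:C)%C.
Proof. by rewrite /cut1 /coordf /jet_affine expr0 mul1r mulrBr. Qed.

Lemma cutoff_eq1 (a : R) (x : 'rV[R]_n) : 0 <= a -> (forall i, a * `|x ord0 i - x0 ord0 i| <= 1) -> cutoff a x = 1.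
Proof.
move=> a0 xa; rewrite /cutoff big1// => i _; rewrite cut1E Psi1//.
by rewrite normrM (ger0_norm a0).
Qed.

Lemma cutoff_eq0 (a : R) (x : 'rV[R]_n) i : 0 <= a -> 2 <= a * `|x ord0 i - x0 ord0 i| -> cutoff a x = 0.
Proof.
move=> a0 xa; rewrite /cutoff (bigD1 i)//= cut1E Psi0 ?mul0r//.
by rewrite normrM (ger0_norm a0).
Qed.

Lemma smooth_cut1 U a i : open U -> smooth U (cut1 a i).
Proof. by move=> oU; apply: coordf_smooth oU _; exact: jet_affineP. Qed.

Let smooth_prod (r : seq 'I_n) a :
  smooth setT (fun x => \prod_(i <- r) cut1 a i x).
Proof.
elim: r => [|i r IH].
  rewrite (_ : (fun x => _) = fun=> 1); first exact: (smooth_cst 1 openT).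
  by apply/funext => x; rewrite big_nil.
rewrite (_ : (fun x => _) = fun x => cut1 a i x * \prod_(j <- r) cut1 a j x).
  exact: (smoothM openT (smooth_cut1 a i openT) IH).
by apply/funext => x; rewrite big_cons.
Qed.

Lemma smooth_cutoff a : smooth setT (cutoff a).
Proof. exact: smooth_prod. Qed.

(** The derivatives of each one-variable factor grow like [(a h)^m W_m], so each factor counts as a
    coefficient in [maj_coefM] and costs [2 C]. As [J = 0], [lam] may still be chosen freely. *)
Lemma maj_cutoff (B : set 'rV[R]_n) tau lam a : 0 < tau -> 0 < lam -> 0 <= a ->
  a * h <= tau / (2 * K) -> maj B W tau lam ((2 * C) ^+ n) 0 (cutoff a).
Proof.
move=> tau0 lam0 a0 at'.
suff H (r : seq 'I_n) : maj B W tau lam ((2 * C) ^+ size r) 0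
    (fun x => \prod_(i <- r) cut1 a i x).
  have E : size (index_enum 'I_n) = n by rewrite -[RHS]card_ord cardT enumT.
  by have := H (index_enum 'I_n); rewrite E.
elim: r => [|i r IH].
  rewrite (_ : (fun x => _) = fun=> 1); last by apply/funext => x; rewrite big_nil.
  move=> s x _; rewrite /Wsum big_ord_recl big_ord0 !expr0 addr0 !mul1r.
  case: s => [|j s]; first by rewrite [leLHS](@Normc.normc1 R) expr0 W01 mulr1.
  rewrite words_cst Normc.normc0 mulr_ge0 ?exprn_ge0 ?ltW//.
rewrite (_ : (fun x => _) = fun x => cut1 a i x * \prod_(j <- r) cut1 a j x); last first.
  by apply/funext => x; rewrite big_cons.
rewrite exprS; apply: (maj_coefM openT (@subsetT _ B) W0 K1 WM tau0 lam0 C0) => //.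
- by rewrite exprn_ge0// mulr_ge0.
- exact: (smooth_cut1 a i openT).
move=> s x Bx; apply: (@coordf_words_le _ _ i _ s x
  (fun m => C * (tau / (2 * K)) ^+ m * W m)); first exact: jet_affineP.
move=> m y; rewrite /jet_affine normrM normrX (ger0_norm a0).
apply: le_trans (ler_wpM2l (exprn_ge0 _ a0) (PsiB _ _)) _.
rewrite mulrA mulrCA -exprMn; apply: ler_wpM2r; first exact: ltW.
have ah0 := mulr_ge0 a0 h0.
by apply: ler_wpM2l => //; rewrite lerXn2r// nnegrE// (le_trans ah0 at').
Qed.

End cutoff.

Section wave_packets.
Variables (R : realType) (n d : nat) (W : nat -> R) (K : R).
Hypotheses (W0 : forall m, 0 < W m) (W01 : W 0%N = 1) (K1 : 1 <= K).
Hypothesis WM : forall j m i, (i <= m)%N ->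
  'C(m, i)%:R * (W i * W (j + (m - i))%N) <= K ^+ i * W (j + m)%N.
Variables (Psi : nat -> R -> R) (Cp hp : R).
Hypotheses (jPsi : jet Psi) (Cp0 : 0 <= Cp) (hp0 : 0 <= hp).
Hypothesis PsiB : forall m x, `|Psi m x| <= Cp * hp ^+ m * W m.
Hypothesis Psi1 : forall x, `|x| <= 1 -> Psi 0%N x = 1.
Hypothesis Psi0 : forall x, 2 <= `|x| -> Psi 0%N x = 0.
Variables (Omega : set 'rV[R]_n) (P : diffop R n d) (x0 xi : 'rV[R]_n) (eps : R).
Hypotheses (oO : open Omega) (hP : coefficients_in (roumieu Omega W) P).
Hypotheses (Ox0 : Omega x0) (symbol0 : principal_symbol P x0 xi = 0).
Hypotheses (eps0 : 0 < eps) (eps1 : eps < 1).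

Lemma packets_exist : exists r kap A : R, [/\ 0 < r, 0 <= kap, 1 <= A,
  cube x0 r `<=` Omega & forall t, 1 <= t -> exists v, [/\ test_on (cube x0 r) v,
    exists2 s : R, 0 < s & forall x, cube x0 s x -> v x = wave x0 xi t x,
    forall k x, Normc.normc (iter k (diffop_fun P) v x) <=
      kap * (A * (t `^ (- eps) * t ^+ d)) ^+ k * Wsum W (t `^ (- (1 - 2 * eps))) (d * k) 0
  & forall s x, Normc.normc (dw v s x) <=
      kap * (A * t) ^+ size s * Wsum W (t `^ (- (1 - 2 * eps))) (size s) 0]].
Proof.
have [r r0 rO] := open_cube_sub oO Ox0.
have [al [h [al0 h0 HP]]] := coefficients_bound W0 oO hP (@cube_compact R n x0 r) rO.
have [q q0 Hq] := symbol_bound W0 oO hP xi rO (ltW al0) (ltW h0) HP.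
have K0 : 0 < K := lt_le_trans ltr01 K1.
(* The cutoff is [Psi] scaled by [a = (2 / r) t^eps]: as [a r del = 2], it vanishes outside the cube
   of size [r del] and equals [1] on half of it. *)
pose ka := 2 / r; have ka0 : 0 < ka by rewrite divr_gt0.
(* [g t^eps] dominates the growth rates of the coefficients and of the scaled cutoff. [H] is chosen
   so that [tau = H t^eps] satisfies [tau / (2 K) = g t^eps]. *)
pose g := h + ka * hp; have g0 : 0 < g by rewrite ltr_pwDl// mulr_ge0// ltW.
pose H := 2 * K * g; have H0 : 0 < H by rewrite !mulr_gt0.
pose be := q + 2 * (q * h * W 1) * n%:R * r.
have be1 : 0 <= 2 * (q * h * W 1) * n%:R * r.
  by apply: mulr_ge0 (ltW r0); apply: mulr_ge0 => //; rewrite !mulr_ge0// ltW.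
have be0 : 0 <= be by rewrite addr_ge0.
pose c := 1 + H + \sum_i `|xi ord0 i|.
have S0 : 0 <= \sum_i `|xi ord0 i| by rewrite sumr_ge0.
have c1 : 1 <= c by rewrite /c -addrA lerDl addr_ge0// ltW.
have cge i : H + `|xi ord0 i| <= c.
  rewrite /c (bigD1 i)//= addrA -[1 + H + _]addrA -[leRHS]addrA [leRHS]addrC -!addrA.
  by rewrite lerD2l lerDl addr_ge0// sumr_ge0.
pose cc := conj_const n c d al be.
have cc0 : 0 <= cc.
  apply: addr_ge0; apply: mulr_ge0 => //; apply: mulr_ge0; first by rewrite mulr_ge0// ltW.
  by rewrite exprn_ge0// (le_trans ler01).
exists r, ((2 * Cp) ^+ n), (1 + cc + c).
have kap0 : 0 <= (2 * Cp) ^+ n by rewrite exprn_ge0// mulr_ge0.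
have c0 : 0 <= c := le_trans ler01 c1.
have A0 : 0 <= 1 + cc + c := addr_ge0 (addr_ge0 ler01 cc0) c0.
split=> //; first by rewrite -addrA lerDl; exact: addr_ge0.
move=> t t1; have t0 : 0 < t := lt_le_trans ltr01 t1.
pose T := t `^ eps; have T0 : 0 < T by rewrite powR_gt0.
have T1 : 1 <= T by rewrite powR_ge1// ltW.
pose del := t `^ (- eps); have delE : del = T^-1 by rewrite /del powRN.
have del0 : 0 < del by rewrite delE invr_gt0.
have del1 : del <= 1 by rewrite delE invf_le1.
pose lam := t `^ (- (1 - 2 * eps)); have lam0 : 0 < lam by rewrite powR_gt0.
pose tau := H * T; have tau0 : 0 < tau by rewrite mulr_gt0.
have tne : (t == 0) = false by rewrite gt_eqF.
have tD a b : t `^ (a + b) = t `^ a * t `^ b by rewrite powRD// tne implybT.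
have tdel : 1 <= del * t.
  rewrite -[X in _ * X](powRr1 (ltW t0)) /del -tD powR_ge1//.
  by rewrite addrC subr_ge0 ltW.
(* The exponent of [lam] is fixed by this balance: [eps + (1 - 2 eps) = 1 - eps]. *)
have price : tau / lam <= H * (t * del).
  rewrite /lam powRN invrK /tau /T /del -mulrA -[X in _ <= _ * (X * _)](powRr1 (ltW t0)) -!tD.
  by have -> : eps + (1 - 2 * eps) = 1 + - eps by ring.
have tauK : tau / (2 * K) = g * T.
  by rewrite /tau /H; field; rewrite gt_eqF.
pose B := cube x0 (r * del).
have BO : B `<=` Omega.
  by move=> x Bx; apply: rO; apply: (cube_sub _ Bx); rewrite ler_piMr// ltW.
have Br y (By : B y) : cube x0 r y by apply: (cube_sub _ By); rewrite ler_piMr// ltW.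
have gT m : h ^+ m <= (tau / (2 * K)) ^+ m.
  rewrite tauK lerXn2r ?nnegrE ?mulr_ge0 ?(ltW h0) ?(ltW g0) ?(ltW T0)//.
  apply: (@le_trans _ _ g); last by rewrite ler_peMr// ltW.
  by rewrite lerDl mulr_ge0// ltW.
have sP a : (mlen (mnat a) <= d)%N -> smooth Omega (P a) by move=> /hP[].
have cP a : (mlen (mnat a) <= d)%N -> coef_maj B W K tau al (P a).
  move=> ad s x Bx; apply: le_trans (HP a ad s x (Br x Bx)) _.
  by apply: ler_wpM2r; [exact: ltW|apply: ler_wpM2l => //; exact: ltW].
(* The symbol itself owes the factor [del] to its zero at [x0]. For its derivatives [del] is
   cancelled by one of the powers of [T], as [del T = 1]. *)
have csym : coef_maj B W K tau (be * del) (fun x => principal_symbol P x xi).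
  move=> s x Bx; case: s => [|i s].
    rewrite /= expr0 mulr1 W01 mulr1.
    have dd : 0 <= del <= 1 by rewrite del1 ltW.
    apply: le_trans (symbol_small W0 oO hP r0 dd q0 (ltW h0) rO symbol0 Hq Bx) _.
    by apply: ler_wpM2r; [exact: ltW|rewrite lerDr].
  apply: le_trans (Hq _ x (Br x Bx)) _; apply: ler_wpM2r; first exact: ltW.
  rewrite tauK /= !exprS.
  have -> : be * del * (g * T * (g * T) ^+ size s) = be * (del * T) * (g * (g * T) ^+ size s).
    by ring.
  rewrite delE mulVf ?gt_eqF// mulr1; apply: ler_pM; rewrite ?mulr_ge0 ?exprn_ge0 ?(ltW h0)//.
    by rewrite lerDl.
  apply: ler_pM; rewrite ?exprn_ge0 ?(ltW h0)//; first by rewrite lerDl mulr_ge0// ltW.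
  by rewrite -tauK.
pose a := ka * T; have a0 : 0 <= a by rewrite mulr_ge0// ltW.
have ahp : a * hp <= tau / (2 * K).
  rewrite tauK /a mulrAC; apply: ler_wpM2r; first exact: ltW.
  by rewrite lerDr ltW.
pose phi := cutoff Psi x0 a.
have sphi U : smooth U phi by exact: (smooth_sub (@subsetT _ U) (smooth_cutoff jPsi x0 a)).
have mphi := maj_cutoff W0 W01 K1 WM jPsi Cp0 hp0 PsiB x0 (B := B) tau0 lam0 a0 ahp.
have cB : compact B by exact: cube_compact.
have phi0 x : ~ B x -> phi x = 0.
  move=> /existsNP[i /negP]; rewrite -ltNge => xi'.
  apply: (@cutoff_eq0 _ _ _ Psi0 x0 a x i a0).
  have -> : 2 = a * (r * del) by rewrite /a delE /ka; field; rewrite !gt_eqF.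
  by apply: ler_wpM2l => //; exact: ltW.
pose v x := wave x0 xi t x * phi x.
have tv : test_on B v.
  exact: (test_onM openT cB (@subsetT _ B) (wave_smooth x0 xi t openT) (conj (sphi setT) phi0)).
have Wg0 J : 0 <= Wsum W lam J 0 by exact: Wsum_ge0.
exists v; split.
- by have [sv v0] := tv; split=> // x xr; apply: v0 => /Br.
- exists (r * del / 2); first by rewrite divr_gt0// mulr_gt0.
  move=> x xr; rewrite /v /phi cutoff_eq1 ?mulr1// => i.
  apply: le_trans (ler_wpM2l a0 (xr i)) _.
  by rewrite le_eqVlt; apply/orP; left; apply/eqP; rewrite /a delE /ka; field; rewrite !gt_eqF.
- move=> k x.
  have td0 : 0 <= del * t ^+ d by rewrite mulr_ge0 ?exprn_ge0// ltW.
  have [Bx|Bx] := pselect (B x); last first.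
    have [[_ f0] _] := iter_diffop oO cB BO sP tv k.
    rewrite f0// Normc.normc0; apply: mulr_ge0 => //; apply: mulr_ge0 => //.
    exact: (exprn_ge0 _ (mulr_ge0 A0 td0)).
  rewrite (iter_diffop_fun_wave oO sP x0 xi t k (sphi Omega) (BO _ Bx)).
  rewrite Normc.normcM normc_wave mul1r.
  have [_ mk] := maj_iter_conj_op oO BO W0 K1 WM tau0 lam0 t1 del0 del1 tdel
    (ltW H0) price cge c1 sP (ltW al0) be0 cP csym k kap0 (sphi Omega) mphi.
  apply: (le_trans (mk [::] x Bx)); rewrite expr0 mulr1.
  apply: ler_wpM2r => //; apply: ler_wpM2l => //.
  apply: lerXn2r; rewrite ?nnegrE; [exact: mulr_ge0 cc0 td0|exact: mulr_ge0 A0 td0|].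
  by apply: ler_wpM2r => //; rewrite addrAC lerDr; exact: addr_ge0.
move=> s x; have [Bx|Bx] := pselect (B x); last first.
  rewrite (words_vanish s cB tv.2 Bx) Normc.normc0; apply: mulr_ge0 => //.
  exact: (mulr_ge0 kap0 (exprn_ge0 _ (mulr_ge0 A0 (ltW t0)))).
have sv : smooth Omega v by exact: (smooth_sub (@subsetT _ Omega) tv.1).
rewrite -(normc_Dwords s oO sv (BO _ Bx)).
rewrite (Dword_wave x0 xi t s oO (sphi Omega) (BO _ Bx)) Normc.normcM normc_wave mul1r.
have mL := maj_Lword oO BO W0 tau0 lam0 t1 del1 (ltW H0) price cge c1 s kap0 (sphi Omega) mphi.
apply: (le_trans (mL [::] x Bx)); rewrite expr0 mulr1 add0n.
apply: ler_wpM2r => //; apply: ler_wpM2l => //.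
apply: lerXn2r; rewrite ?nnegrE; [exact: mulr_ge0 c0 (ltW t0)|exact: mulr_ge0 A0 (ltW t0)|].
by apply: ler_wpM2r; [exact: ltW|rewrite lerDr; exact: addr_ge0].
Qed.

End wave_packets.

(** * Packet bounds weighed against the amplitudes *)

Section packet_weights.
Variables (R : realType) (M : nat -> R) (rho nu : R).
Hypotheses (hM : weight_sequence M) (rho0 : 0 < rho) (rho1 : rho <= 1) (nu1 : 1 <= nu).

Let t j := freq M nu j.
Let W := wpow M rho.
Let nu0 : 0 < nu := lt_le_trans ltr01 nu1.

(** [saddle_bound] for each of the [N + 1 <= 2^N] terms, with [a = b - rho i]: [rho N <= b] keeps
    [a] non-negative, and [nu >= 1] gives [nu a + rho i <= nu b]. *)
Lemma amp_Wsum j N (b e : R) : (0 < j)%N -> (0 < N)%N -> rho * N%:R <= b <= N%:R ->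
  nu * b <= e * N%:R ->
  amp M nu j * (t j `^ b * Wsum W (t j `^ (- rho)) N 0) <= 2 ^+ N * M N `^ e.
Proof.
move=> j0 N0 /andP[bN1 bN2] be.
have t0 : 0 < t j := lt_le_trans ltr01 (freq_ge1 hM nu0 j0).
apply: (@le_trans _ _ (\sum_(i < N.+1) M N `^ e)).
  rewrite /Wsum !mulr_sumr; apply: ler_sum => i _.
  have iN : (i <= N)%N by rewrite -ltnS.
  have iR : i%:R <= N%:R :> R by rewrite ler_nat.
  have ri : rho * i%:R <= rho * N%:R by rewrite ler_pM2l.
  have ri0 : 0 <= rho * i%:R by rewrite mulr_ge0// ltW.
  rewrite addn0.
  have -> : amp M nu j * (t j `^ b * ((t j `^ (- rho)) ^+ i * W i)) =
      t j `^ (b - rho * i%:R) * M i `^ rho * amp M nu j.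
    rewrite powRD; last by rewrite (gt_eqF t0) implybT.
    by rewrite -mulNr powRrM powR_mulrn ?powR_ge0// /W /wpow; ring.
  apply: (saddle_bound hM (ltW rho0) nu0 j0 N0 iN).
    by apply/andP; split; lra.
  rewrite mulrBr.
  have : rho * i%:R <= nu * (rho * i%:R) by rewrite ler_peMl.
  lra.
rewrite sumr_const card_ord -[leLHS]mulr_natl; apply: ler_wpM2r; first exact: powR_ge0.
by rewrite -natrX ler_nat ltn_expl.
Qed.

Lemma amp_Wsum_words j m : (0 < j)%N ->
  amp M nu j * (t j ^+ m * Wsum W (t j `^ (- rho)) m 0) <= 2 ^+ m * M m `^ nu.
Proof.
move=> j0; have t0 : 0 < t j := lt_le_trans ltr01 (freq_ge1 hM nu0 j0).
case: m => [|m].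
  rewrite /Wsum big_ord_recl big_ord0 !expr0 !mul1r addr0 /W /wpow addn0 (weight0 hM) !powR1 mulr1.
  exact: amp_le1.
rewrite -powR_mulrn ?(ltW t0)//; apply: amp_Wsum => //.
by rewrite lexx andbT ler_piMl.
Qed.

(** [amp_Wsum] with [N = d k] and [b = (d - eps) k], where [rho d <= d - eps] because
    [eps = (1 - rho) / 2 <= (1 - rho) d]. The case [k = 0] is apart, since [saddle_bound] divides by
    [N]. *)
Lemma amp_Wsum_iter j d k : (0 < j)%N -> (0 < d)%N ->
  amp M nu j * ((t j `^ (- ((1 - rho) / 2)) * t j ^+ d) ^+ k *
    Wsum W (t j `^ (- rho)) (d * k) 0) <=
  (2 ^+ d) ^+ k * M (d * k)%N `^ (nu * (1 - (1 - rho) / 2 / d%:R)).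
Proof.
move=> j0 d0; have t0 : 0 < t j := lt_le_trans ltr01 (freq_ge1 hM nu0 j0).
case: k => [|k].
  rewrite muln0 /Wsum big_ord_recl big_ord0 !expr0 !mul1r addr0 /W /wpow addn0 (weight0 hM) !powR1 mulr1.
  exact: amp_le1.
have dR : 1 <= d%:R :> R by rewrite ler1n.
have -> : (t j `^ (- ((1 - rho) / 2)) * t j ^+ d) ^+ k.+1 =
    t j `^ ((d%:R - (1 - rho) / 2) * k.+1%:R).
  rewrite -(powR_mulrn d (ltW t0)) -powRD ?(gt_eqF t0) ?implybT//.
  by rewrite powRrM powR_mulrn ?powR_ge0// addrC.
rewrite -exprM; apply: amp_Wsum; rewrite ?muln_gt0 ?d0// natrM.
  rewrite mulrA !ler_pM2r ?ltr0n//.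
  have : (1 - rho) * 1 <= (1 - rho) * d%:R by rewrite ler_wpM2l// subr_ge0.
  rewrite mulr1 mulrBl mul1r => h.
  have r1 : 0 <= 1 - rho by rewrite subr_ge0.
  by apply/andP; split; lra.
rewrite mulrA mulrA ler_pM2r ?ltr0n// -mulrA ler_pM2l//.
by rewrite [leRHS]mulrBl mul1r divfK// pnatr_eq0 -lt0n.
Qed.

End packet_weights.

(** * Superposition of wave packets *)

Lemma sum_half_le1 (R : realFieldType) N : \sum_(j < N) 2^-1 ^+ j.+1 <= 1 :> R.
Proof.
have -> : \sum_(j < N) 2^-1 ^+ j.+1 = 1 - 2^-1 ^+ N :> R.
  elim: N => [|N IH]; first by rewrite big_ord0 expr0 subrr.
  by rewrite big_ord_recr /= IH exprS; field.
by rewrite gerBl exprn_ge0.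
Qed.

Lemma wave_words_nseq (R : realType) n (x0 xi : 'rV[R]_n) t i k :
  dw (wave x0 xi t) (nseq k i) = fun x => ('i * (t * xi ord0 i)%:C)%C ^+ k * wave x0 xi t x.
Proof.
elim: k => [|k IH]; apply/funext => x; first by rewrite /= expr0 mul1r.
have [cw dwv] := wave_C1 x0 xi t x.
rewrite [LHS]/= -/(dw _ (nseq k i)) IH (partialZ i _ cw) dwv exprSr.
exact: mulrA.
Qed.

Section superposition.
Variables (R : realType) (n d : nat) (M : nat -> R) (Omega K0 : set 'rV[R]_n).
Variables (P : diffop R n d) (x0 xi : 'rV[R]_n) (nu e : R).
Variables (c t : nat -> R) (v : nat -> 'rV[R]_n -> R[i]) (C A : R).
Hypotheses (hM : weight_sequence M) (oO : open Omega).
Hypothesis sP : forall a : {ffun 'I_n -> 'I_d.+1}, (mlen (mnat a) <= d)%N -> smooth Omega (P a).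
Hypotheses (cK : compact K0) (KO : K0 `<=` Omega) (Kx0 : K0 x0).
Hypotheses (hd : (1 <= d)%N) (nu1 : 1 < nu) (e1 : e < 1).
Hypothesis tv : forall j, test_on K0 (v j).
Hypothesis vw : forall j, exists2 s : R, 0 < s &
  forall x, cube x0 s x -> v j x = wave x0 xi (t j) x.
Hypotheses (c0 : forall j, 0 <= c j) (t0 : forall j, 0 <= t j).
Hypothesis ct : forall k, c k * t k ^+ k.+1 = 2^-1 ^+ k.+1 * M k.+1 `^ nu.
Hypotheses (C0 : 0 <= C) (A0 : 0 < A).
Hypothesis vP : forall j k x, c j * Normc.normc (iter k (diffop_fun P) (v j) x) <=
  2^-1 ^+ j.+1 * (C * A ^+ k * M (d * k)%N `^ e).
Hypothesis vW : forall j s x, c j * Normc.normc (dw (v j) s x) <=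
  2^-1 ^+ j.+1 * (C * A ^+ size s * M (size s) `^ nu).

Let cc j : R[i] := ((c j)%:C)%C.

Definition partial_sums N : 'rV[R]_n -> R[i] := fun x => \sum_(j < N) cc j * v j x.

Definition sum_words s : 'rV[R]_n -> R[i] := fun x =>
  (lim ((\sum_(j < N) complex.Re (cc j * dw (v j) s x)) @[N --> \oo]) +i*
   lim ((\sum_(j < N) complex.Im (cc j * dw (v j) s x)) @[N --> \oo]))%C.

Definition superposition := sum_words [::].

Let normc_cc j : Normc.normc (cc j) = c j.
Proof. by rewrite /cc normc_real ger0_norm. Qed.

Let bound_sum (F : nat -> R[i]) N (B : R) : 0 <= B ->
  (forall j, c j * Normc.normc (F j) <= 2^-1 ^+ j.+1 * B) ->
  Normc.normc (\sum_(j < N) cc j * F j) <= B.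
Proof.
move=> B0 FB; apply: le_trans (normc_sum_le _ _ _) _.
apply: (@le_trans _ _ (\sum_(j < N) 2^-1 ^+ j.+1 * B)).
  by apply: ler_sum => j _; rewrite Normc.normcM normc_cc.
by rewrite -mulr_suml ler_piMl// sum_half_le1.
Qed.

Let boundW (s : seq 'I_n) : 0 <= C * A ^+ size s * M (size s) `^ nu.
Proof. by rewrite !mulr_ge0 ?exprn_ge0 ?powR_ge0// ltW. Qed.

Let sum_cvg s x : ccvg (fun N => \sum_(j < N) cc j * dw (v j) s x) (sum_words s x).
Proof.
apply: (@ccvg_geometric _ (fun j => cc j * dw (v j) s x) (2^-1 * (C * A ^+ size s * M (size s) `^ nu))).
move=> j; rewrite Normc.normcM normc_cc; apply: le_trans (vW j s x) _.
by rewrite exprS [leLHS]mulrAC.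
Qed.

Let sv j : smooth setT (v j) := (tv j).1.

Let partial_sums_words N s x : dw (partial_sums N) s x = \sum_(j < N) cc j * dw (v j) s x.
Proof.
rewrite (words_sum openT s (index_enum 'I_N) (fun (j : 'I_N) _ => smoothZ openT (cc j) (sv j)) (I : setT x)).
by apply: eq_bigr => j _; rewrite (words_Z openT s (cc j) (sv j) (I : setT x)).
Qed.

Let smooth_partial_sums N : smooth setT (partial_sums N).
Proof.
by apply: (smooth_sum openT) => j _; exact: (smoothZ openT (cc j) (sv j)).
Qed.

Let bound_words s : exists B : R, forall N x, Normc.normc (dw (partial_sums N) s x) <= B.
Proof.
exists (C * A ^+ size s * M (size s) `^ nu) => N x; rewrite partial_sums_words.
exact: (@bound_sum (fun j => dw (v j) s x) N _ (boundW s) (fun j => vW j s x)).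
Qed.

Let cvg_words s x : ccvg (fun N => dw (partial_sums N) s x) (sum_words s x).
Proof.
by apply: (ccvg_ext _ _ (sum_cvg s x)) => // N; exact: partial_sums_words.
Qed.

Let superposition_words s : dw superposition s = sum_words s :=
  limit_words smooth_partial_sums bound_words cvg_words s.

Lemma test_on_superposition : test_on K0 superposition.
Proof.
split; first exact: (smooth_limit smooth_partial_sums bound_words cvg_words).
move=> x Kx; apply: (ccvg_unique (cvg_words [::] x)).
apply: (ccvg_ext _ _ (ccvg_cst 0)) => // N /=.
by rewrite /partial_sums big1// => j _; rewrite (tv j).2// mulr0.
Qed.

Lemma superposition_words_le s x :
  Normc.normc (dw superposition s x) <= C * A ^+ size s * M (size s) `^ nu.
Proof.
rewrite superposition_words; apply: (ccvg_normc_le (cvg_words s x)) => N.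
rewrite partial_sums_words.
exact: (@bound_sum (fun j => dw (v j) s x) N _ (boundW s) (fun j => vW j s x)).
Qed.

Lemma roumieu_superposition : roumieu Omega (wpow M nu) superposition.
Proof.
apply: (words_roumieu oO).
  exact: (smooth_sub (@subsetT _ Omega) test_on_superposition.1).
exists (1 + C), A; split; rewrite ?ltr_wpDr// => s x _.
apply: le_trans (superposition_words_le s x) _; rewrite -!mulrA.
by apply: ler_wpM2r; rewrite ?mulr_ge0 ?exprn_ge0 ?powR_ge0 ?(ltW A0)// lerDr.
Qed.

Lemma superposition_iter_le k x :
  Normc.normc (iter k (diffop_fun P) superposition x) <= C * A ^+ k * M (d * k)%N `^ e.
Proof.
have B0 : 0 <= C * A ^+ k * M (d * k)%N `^ e.
  by rewrite !mulr_ge0 ?exprn_ge0 ?powR_ge0// ltW.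
(* The limit argument needs smooth coefficients, hence a point of [Omega]; off [K0] the iterates
   vanish. *)
have [Kx|Kx] := pselect (K0 x); last first.
  have [[_ f0] _] := iter_diffop oO cK KO sP test_on_superposition k.
  by rewrite f0// Normc.normc0.
have Ox := KO Kx; have sO f : smooth setT f -> smooth Omega f.
  exact: (smooth_sub (@subsetT _ Omega)).
have wc : words_cvg Omega partial_sums superposition.
  by move=> s y _; rewrite superposition_words; exact: cvg_words.
have := words_cvg_iter oO sP k (fun N => sO _ (smooth_partial_sums N))
  (sO _ test_on_superposition.1) wc.
move=> /(_ [::] x Ox) h; apply: (ccvg_normc_le h) => N /=.
rewrite (iter_diffop_fun_lincomb oO sP N cc k (fun j => sO _ (sv j)) Ox).
exact: (@bound_sum (fun j => iter k (diffop_fun P) (v j) x) N _ B0 (fun j => vP j k x)).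
Qed.

Lemma beurling_superposition : beurling_vectors Omega M P (distribution_of Omega superposition).
Proof.
have tu := test_on_superposition; have [su u0] := tu.
have suO : smooth Omega superposition by exact: (smooth_sub (@subsetT _ Omega) su).
split.
  apply: (@distribution_of_is_distribution _ _ Omega superposition (C * A ^+ 0 * M 0 `^ nu) oO suO).
  by move=> x _; exact: (superposition_words_le [::] x).
have [L L0 KL] := compact_sub_cube cK.
pose vol := Num.sqrt (fine (lebesgue_rV R n (cube 0 L))).
have F k := iter_diffop oO cK KO sP tu k.
have L2 K k : compact K -> (L2norm K (iter k (diffop_fun P) superposition) <=
    ((C * A ^+ k * M (d * k)%N `^ e) * vol)%:E)%E.
  move=> cK'; have [[sf f0] _] := F k; apply: (L2norm_le cK' sf).
  - by move=> x xL; apply: f0 => /KL.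
  - by rewrite !mulr_ge0 ?exprn_ge0 ?powR_ge0// ltW.
  - by move=> x; exact: superposition_iter_le.
exists (fun k => iter k (diffop_fun P) superposition); split.
  move=> k; have [[sf f0] H] := F k; split; last exact: H.
  have [cR cI] := smooth_continuous sf; split.
  - by apply: measurable_funTS; exact: continuous_measurable_rV cR.
  - by apply: measurable_funTS; exact: continuous_measurable_rV cI.
  - by move=> K cK' _; apply: le_lt_trans (L2 K k cK') _; rewrite ltry.
move=> K cK' _ h h0.
(* The spare power [M_(d k)^(1 - e)] absorbs [(A / h)^k] for every [h > 0]; this turns a bound with
   one fixed [A] into a Beurling bound. *)
have s0 : 0 < 1 - e by rewrite subr_gt0.
pose H := Num.max 1 (A / h).
have [D D0 HD] := weight_dominates hM H s0.
have H1 : 1 <= H by rewrite le_max lexx.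
exists (1 + C * D * vol); first by rewrite ltr_pwDl// !mulr_ge0 ?sqrtr_ge0// ltW.
move=> k; apply: le_trans (L2 K k cK') _; rewrite lee_fin.
have AH : A ^+ k <= h ^+ k * (D * M (d * k)%N `^ (1 - e)).
  have -> : A = h * (A / h) by rewrite mulrC divfK// gt_eqF.
  rewrite exprMn; apply: ler_wpM2l; first by rewrite exprn_ge0// ltW.
  apply: le_trans (HD (d * k)%N).
  apply: (@le_trans _ _ (H ^+ k)).
    by rewrite lerXn2r ?nnegrE ?(le_trans ler01 H1) ?divr_ge0 ?(ltW A0) ?(ltW h0)// le_max lexx orbT.
  by apply: ler_weXn2l => //; rewrite leq_pmull.
have MM : M (d * k)%N `^ (1 - e) * M (d * k)%N `^ e = M (d * k)%N.
  rewrite -powRD ?subrK ?powRr1 ?(ltW (weight_gt0 hM _))//.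
  by rewrite (gt_eqF (weight_gt0 hM _)) implybT.
have vol0 : 0 <= vol by exact: sqrtr_ge0.
apply: (@le_trans _ _ (C * (h ^+ k * (D * M (d * k)%N `^ (1 - e))) * M (d * k)%N `^ e * vol)).
  apply: ler_wpM2r => //; apply: ler_wpM2r; first exact: powR_ge0.
  exact: ler_wpM2l.
have -> : C * (h ^+ k * (D * M (d * k)%N `^ (1 - e))) * M (d * k)%N `^ e * vol =
  C * D * vol * h ^+ k * (M (d * k)%N `^ (1 - e) * M (d * k)%N `^ e) by ring.
rewrite MM; apply: ler_wpM2r; first exact: ltW (weight_gt0 hM _).
apply: ler_wpM2r; first by rewrite exprn_ge0// ltW.
by rewrite lerDr.
Qed.

(* All terms of the series have the same phase at [x0]. *)
Lemma superposition_center i k :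
  2^-1 ^+ k * M k `^ nu * `|xi ord0 i| ^+ k <=
    Normc.normc (dw superposition (nseq k i) x0) \/ k = 0%N.
Proof.
case: k => [|k]; [by right|left].
have wv j : dw (v j) (nseq k.+1 i) x0 = ('i * (t j * xi ord0 i)%:C)%C ^+ k.+1.
  have [s s0 vs] := vw j.
  have E : eq_on (ball x0 s) (v j) (wave x0 xi (t j)).
    move=> x [_ bx]; apply: vs => l; have := bx ord0 l.
    by rewrite -ball_normE /= distrC => /ltW.
  rewrite (eq_on_words _ (ball_open x0 s) E (ballxx x0 s0)).
  by rewrite wave_words_nseq wave_center mulr1.
rewrite superposition_words.
apply: (ccvg_normc_ge (k := k.+1) (cvg_words (nseq k.+1 i) x0)).
  by rewrite !mulr_ge0 ?exprn_ge0 ?powR_ge0.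
move=> N kN; rewrite partial_sums_words.
have -> : \sum_(j < N) cc j * dw (v j) (nseq k.+1 i) x0 =
    ('i%C * ((xi ord0 i)%:C)%C) ^+ k.+1 * ((\sum_(j < N) c j * t j ^+ k.+1)%:C)%C.
  have E : ((\sum_(j < N) c j * t j ^+ k.+1)%:C)%C = \sum_(j < N) cc j * ((t j ^+ k.+1)%:C)%C.
    by rewrite rmorph_sum; apply: eq_bigr => j _; rewrite /cc -complexrM.
  rewrite E mulr_sumr; apply: eq_bigr => j _; rewrite wv complexrX complexrM.
  by rewrite [RHS]mulrCA -exprMn; congr (_ * _ ^+ _); rewrite -mulrA; congr (_ * _); exact: mulrC.
rewrite Normc.normcM normc_exp Normc.normcM !normc_real.
have -> : Normc.normc ('i%C : R[i]) = 1 by rewrite /= expr0n/= add0r expr1n sqrtr1.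
rewrite mul1r mulrC; apply: ler_wpM2l; first by rewrite exprn_ge0.
rewrite ger0_norm; last by apply: sumr_ge0 => j _; rewrite mulr_ge0 ?exprn_ge0.
(* The remaining factors are non-negative, so the single term [k] bounds the sum from below; its
   amplitude is the extremal one for order [k + 1]. *)
rewrite (bigD1 (Ordinal kN))//= ct lerDl.
by apply: sumr_ge0 => j _; rewrite mulr_ge0 ?exprn_ge0.
Qed.

(** Pure derivatives in a direction with [xi_i != 0], at the single point [x0], already force the
    growth [M^nu]; [T 0 = 1] settles order [0], which the lower bound excludes. With [T = M] the
    same lemma shows that [u] is not of class [M]. *)
Lemma superposition_optimal i (T : nat -> R) : xi ord0 i != 0 -> T 0%N = 1 ->
  roumieu Omega T superposition -> wle (wpow M nu) T.
Proof.
move=> xi0 T0 rT.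
have K1 : compact [set x0] by exact: compact_set1.
have KO1 : [set x0] `<=` Omega by move=> _ ->; exact: KO.
have [D [h [D0 h0 HD]]] := roumieu_words oO rT K1 KO1.
have x0' : 0 < `|xi ord0 i| by rewrite normr_gt0.
exists (1 + D), (2 * h / `|xi ord0 i|); split; first by rewrite ltr_pwDl// ltW.
  by rewrite divr_gt0// mulr_gt0.
move=> k; have [h1|->] := superposition_center i k; last first.
  by rewrite /wpow (weight0 hM) powR1 T0 expr0 !mulr1 lerDl ltW.
have h2 := HD (nseq k i) x0 erefl; rewrite size_nseq in h2.
have h3 := le_trans h1 h2.
have -> : wpow M nu k = (2^-1 ^+ k * M k `^ nu * `|xi ord0 i| ^+ k) * (2 / `|xi ord0 i|) ^+ k.
  have E : 2^-1 ^+ k * `|xi ord0 i| ^+ k * (2 / `|xi ord0 i|) ^+ k = 1.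
    rewrite -!exprMn (_ : _ * _ = 1) ?expr1n//.
    by field; rewrite gt_eqF.
  by rewrite -[LHS]mulr1 -[X in _ * X = _]E /wpow; ring.
apply: le_trans (ler_wpM2r _ h3) _; first by rewrite exprn_ge0// divr_ge0// ltW.
have -> : D * h ^+ k * T k * (2 / `|xi ord0 i|) ^+ k = D * (2 * h / `|xi ord0 i|) ^+ k * T k.
  by rewrite [2 * h / _]mulrAC [(_ * h) ^+ k]exprMn; ring.
have DT : 0 <= D * h ^+ k * T k := le_trans (normc_ge0 _) h2.
(* The sign of [T k] is read off the bound, whose left side is a norm. *)
have Tk : 0 <= T k by rewrite -(pmulr_rge0 _ (mulr_gt0 D0 (exprn_gt0 k h0))).
apply: ler_wpM2r => //; apply: ler_wpM2r; first by rewrite exprn_ge0// divr_ge0 ?mulr_ge0// ltW.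
by rewrite lerDr.
Qed.

End superposition.

(** Combined with [(2 h)^k <= D M_k^(nu - 1)], the relation would bound the powers of [2]. *)
Lemma not_wle_wpow (R : realType) (M : nat -> R) nu : weight_sequence M -> 1 < nu ->
  ~ wle (wpow M nu) M.
Proof.
move=> hM nu1 [C [h [C0 h0 HC]]].
have s0 : 0 < nu - 1 by rewrite subr_gt0.
have [D D0 HD] := weight_dominates hM (2 * h) s0.
have H k : 2 ^+ k <= D * C.
  have hk : 0 < h ^+ k by exact: exprn_gt0.
  rewrite -(ler_pM2r hk) -exprMn; apply: le_trans (HD k) _; rewrite -mulrA.
  apply: ler_wpM2l; first exact: ltW.
  rewrite -(ler_pM2r (weight_gt0 hM k)); apply: le_trans (HC k).
  rewrite -[X in _ * X](powRr1 (ltW (weight_gt0 hM k))) -powRD ?subrK//.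
  by rewrite (gt_eqF (weight_gt0 hM k)) implybT.
have := H (Num.truncn (D * C)).+1; apply/negP; rewrite -ltNge.
apply: lt_le_trans (truncnS_gt _) _; rewrite -natrX ler_nat ltnW// ltn_expl//.
Qed.

Theorem theorem5p6 (R : realType) (M : nat -> R)
  (hM : weight_sequence M)
  (hgamma : (1 < gamma_index M < +oo)%E)
  (hroot : (ereal_sup [set (quot M k `^ k%:R^-1)%:E | k in [set k : nat | (1 <= k)%N]]
            < +oo)%E)
  (n d : nat) (hd : (1 <= d)%N)
  (Omega : set 'rV[R]_n) (hOmega : open Omega)
  (P : diffop R n d) (hord : of_order Omega P)
  (hell : ~ elliptic Omega P)
  (rho : R) (hrho : 1 < rho^-1) (hrhogamma : ((rho^-1)%:E < gamma_index M)%E)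
  (hcoef : coefficients_in (roumieu Omega (wpow M rho)) P) :
  exists (u : 'rV[R]_n -> R[i]) (nu : R),
    [/\ smooth Omega u,
        1 < nu,
        beurling_vectors Omega M P (distribution_of Omega u),
        ~ roumieu Omega M u
      & optimal_function Omega (wpow M nu) u].
Proof.
have rho0 : 0 < rho by rewrite -invr_gt0 (lt_trans ltr01).
have rho1 : rho < 1 by rewrite -(invrK rho) invf_lt1// (lt_trans ltr01).
have [x0 [xi [Ox0 xi0 symbol0]]] : exists x0 xi,
    [/\ Omega x0, xi != 0 & principal_symbol P x0 xi = 0].
  apply: contrapT => H; apply: hell => x xi Ox xi0; apply/eqP => s0.
  by apply: H; exists x, xi.
have [i xii] : exists i, xi ord0 i != 0.
  by apply/rV0Pn.
have W0 := wpow_gt0 hM rho.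
have W01 : wpow M rho 0 = 1 by rewrite /wpow (weight0 hM) powR1.
have [K K1 WM] := wpow_bin hM rho0 hrhogamma.
have [p [Kg [p0 Kg1 HKg]]] := gev_wpow hM rho0 hrhogamma.
have [Psi [jPsi [Cp [hp [Cp0 hp0 PsiB]]] Psi1 Psi0]] := bump_exists R p0.
have Kg0 : 0 <= Kg := le_trans ler01 Kg1.
have PsiB' m x : `|Psi m x| <= Cp * (hp * Kg) ^+ m * wpow M rho m.
  apply: le_trans (PsiB m x) _; rewrite exprMn -!mulrA.
  do 2 (apply: ler_wpM2l; first by rewrite ?exprn_ge0// ltW).
  exact: HKg.
(* This value makes [1 - 2 eps = rho], so that [lam^i W_i = t^(-rho i) M_i^rho]. *)
pose eps := (1 - rho) / 2.
have eps0 : 0 < eps by rewrite divr_gt0// subr_gt0.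
have eps1 : eps < 1 by rewrite /eps; lra.
have epsE : 1 - 2 * eps = rho by rewrite /eps; field.
have [r [kap [A [r0 kap0 A1 rO Hv]]]] := packets_exist W0 W01 K1 WM jPsi Cp0
  (mulr_ge0 (ltW hp0) Kg0) PsiB' Psi1 Psi0 hOmega hcoef Ox0 symbol0 eps0 eps1.
rewrite epsE in Hv.
have dR : 1 <= d%:R :> R by rewrite ler1n.
have d0 : 0 < d%:R :> R := lt_le_trans ltr01 dR.
pose q := eps / d%:R.
have q0 : 0 < q by rewrite divr_gt0.
have q1 : q < 1 by rewrite ltr_pdivrMr// mul1r (lt_le_trans eps1).
(* Any [nu] strictly between [1] and [1 / (1 - q)] would give [e < 1]; here
   [e = (1 - q) / (1 - q / 2)]. *)
pose nu := (1 - q / 2)^-1; pose e := nu * (1 - q).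
have z0 : 0 < 1 - q / 2 by lra.
have nu1 : 1 < nu by rewrite invf_gt1//; lra.
have e1 : e < 1 by rewrite /e /nu mulrC ltr_pdivrMr// mul1r; lra.
(* The shift avoids index [0], where [quot] has no meaning. *)
pose t j := freq M nu j.+1.
have t1 j : 1 <= t j by exact: (freq_ge1 hM (lt_trans ltr01 nu1)).
have [v Hv'] := choice (fun j => Hv (t j) (t1 j)).
pose c j := 2^-1 ^+ j.+1 * amp M nu j.+1.
have c0 j : 0 <= c j.
  by rewrite mulr_ge0 ?exprn_ge0// ltW// (amp_gt0 hM (lt_trans ltr01 nu1)).
have t0 j : 0 <= t j := le_trans ler01 (t1 j).
have ct k : c k * t k ^+ k.+1 = 2^-1 ^+ k.+1 * M k.+1 `^ nu.
  rewrite -mulrA /amp divfK// gt_eqF// exprn_gt0//.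
  exact: lt_le_trans ltr01 (t1 k).
(* The factor [2^d] comes from counting the terms of [Wsum]: at most [2^(d k)] for [P^k], and at
   most [2^m] for words of size [m]. *)
have A0 : 0 < A * 2 ^+ d by rewrite mulr_gt0 ?exprn_gt0// (lt_le_trans ltr01).
have A0' : 0 <= A := le_trans ler01 A1.
have vP j k x : c j * Normc.normc (iter k (diffop_fun P) (v j) x) <=
    2^-1 ^+ j.+1 * (kap * (A * 2 ^+ d) ^+ k * M (d * k)%N `^ e).
  have [_ _ H _] := Hv' j; apply: le_trans (ler_wpM2l (c0 j) (H k x)) _.
  rewrite /c -[leLHS]mulrA; apply: ler_wpM2l; first exact: exprn_ge0.
  rewrite [(A * _) ^+ k]exprMn.
  have -> (a b x1 y z : R) : a * (b * (x1 * y) * z) = b * x1 * (a * (y * z)) by ring.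
  rewrite [(A * _) ^+ k]exprMn [in leRHS]mulrA -[leRHS]mulrA; apply: ler_wpM2l.
    by rewrite mulr_ge0 ?exprn_ge0.
  exact: (amp_Wsum_iter hM rho0 (ltW rho1) (ltW nu1) k (ltn0Sn j) hd).
have vW j s x : c j * Normc.normc (dw (v j) s x) <=
    2^-1 ^+ j.+1 * (kap * (A * 2 ^+ d) ^+ size s * M (size s) `^ nu).
  have [_ _ _ H] := Hv' j; apply: le_trans (ler_wpM2l (c0 j) (H s x)) _.
  rewrite /c -[leLHS]mulrA; apply: ler_wpM2l; first exact: exprn_ge0.
  rewrite [(A * _) ^+ _]exprMn.
  have -> (a b x1 y z : R) : a * (b * (x1 * y) * z) = b * x1 * (a * (y * z)) by ring.
  rewrite [(A * _) ^+ _]exprMn [in leRHS]mulrA -[leRHS]mulrA; apply: ler_wpM2l.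
    by rewrite mulr_ge0 ?exprn_ge0.
  apply: le_trans (amp_Wsum_words hM rho0 (ltW rho1) (ltW nu1) (size s) (ltn0Sn j)) _.
  apply: ler_wpM2r; first exact: powR_ge0.
  by rewrite -exprM; apply: ler_weXn2l; rewrite ?ler1n// leq_pmull.
have sP a : (mlen (mnat a) <= d)%N -> smooth Omega (P a) by move=> /hcoef[].
have tv j : test_on (cube x0 r) (v j) by have [] := Hv' j.
have vw j : exists2 s : R, 0 < s & forall x, cube x0 s x -> v j x = wave x0 xi (t j) x.
  by have [] := Hv' j.
have cK : compact (cube x0 r) by exact: cube_compact.
have Kx0 := cube_center x0 (ltW r0).
pose u := superposition c v.
have opt T : T 0 = 1 -> roumieu Omega T u -> wle (wpow M nu) T.
  exact: (superposition_optimal hM hOmega rO Kx0 tv vw c0 t0 ct kap0 A0 vW xii).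
have tu := test_on_superposition tv c0 kap0 A0 vW.
have su : smooth Omega u by exact: (smooth_sub (@subsetT _ Omega) tu.1).
exists u, nu; split => //.
- exact: (beurling_superposition hM hOmega sP cK rO hd e1 tv c0 kap0 A0 vP vW).
- by move=> rM; apply: (not_wle_wpow hM nu1); apply: opt rM; exact: weight0.
split=> //; first exact: (roumieu_superposition hOmega tv c0 kap0 A0 vW).
by move=> T wT [_ nTN] rT; apply: nTN; apply: opt rT; exact: weight0.
Qed.
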